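(* Let $\alpha>0$ and let $\mathcal{S}_\alpha=(-\alpha,\alpha)\times\mathbb{R}\subseteq\mathbb{R}^2$. For every $1<p<\infty$ we have \[ \mathfrak{S}_{\mathrm{ess},p}(\mathcal{S}_\alpha)=\left[\left(\frac{\pi_p}{2\,\alpha}\right)^p,+\infty\right)\qquad\text{and}\qquad\mathfrak{S}_{\mathrm{eigen},p}(\mathcal{S}_\alpha)=\emptyset. \]
   Context: $\pi_p=\inf\{\|\varphi'\|_{L^p(I)} : \varphi\in C^\infty_0(I),\ \|\varphi\|_{L^p(I)}=1\}$ with $I=(-\tfrac12,\tfrac12)$. Let $\Omega\subseteq\mathbb{R}^N$ be open and $B_R=\{x\in\mathbb{R}^N: |x|<R\}$. $W^{1,p}_0(\Omega)$ is the closure of $C^\infty_0(\Omega)$ in $W^{1,p}(\Omega)$, endowed with the norm $\|\varphi\|_{W^{1,p}(\Omega)}=(\int_\Omega|\varphi|^p\,dx+\int_\Omega|\nabla\varphi|^p\,dx)^{1/p}$, and $W^{-1,p'}(\Omega)$ is its topological dual with the dual norm, $p'=p/(p-1)$. For $u\in W^{1,p}_0(\Omega)$, $-\Delta_p u\in W^{-1,p'}(\Omega)$ is defined by $\langle-\Delta_p u,\varphi\rangle=\int_\Omega\langle|\nabla u|^{p-2}\nabla u,\nabla\varphi\rangle\,dx$, and $|u|^{p-2}u$ is identified with the functional $\varphi\mapsto\int_\Omega|u|^{p-2}u\,\varphi\,dx$. Eigenvalues: $\lambda\in\mathfrak{S}_{\mathrm{eigen},p}(\Omega)$ if and only if $\lambda\in\mathbb{R}$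 and there is $u\in W^{1,p}_0(\Omega)\setminus\{0\}$ with $\int_\Omega\langle|\nabla u|^{p-2}\nabla u,\nabla\varphi\rangle\,dx=\lambda\int_\Omega|u|^{p-2}u\,\varphi\,dx$ for every $\varphi\in W^{1,p}_0(\Omega)$. A constrained Palais-Smale sequence at the level $\lambda\in\mathbb{R}$ is a sequence $\{u_n\}_{n\in\mathbb{N}}\subseteq W^{1,p}_0(\Omega)$ such that: (i) $\|u_n\|_{L^p(\Omega)}=1$ for every $n$; (ii) $\lim_{n\to\infty}\int_\Omega|\nabla u_n|^p\,dx=\lambda$; (iii) $\lim_{n\to\infty}\|-\Delta_p u_n-\lambda|u_n|^{p-2}u_n\|_{W^{-1,p'}(\Omega)}=0$. It is singular if $\lim_{n\to\infty}\|u_n\|_{L^p(\Omega\cap B_R)}=0$ for every $R>0$. Variational essential spectrum: $\mathfrak{S}_{\mathrm{ess},p}(\Omega)=\{\lambda : \text{there exists a singular constrained Palais-Smale sequence at the level }\lambda\}$. *)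

(* Defs.v *)
From HB Require Import structures.
From mathcomp Require Import all_boot all_order all_algebra.
From mathcomp Require Import all_classical all_reals all_analysis.

Set Implicit Arguments.
Unset Strict Implicit.
Unset Printing Implicit Defensive.

Import Order.TTheory GRing.Theory Num.Theory.
Import numFieldNormedType.Exports.

Local Open Scope classical_set_scope.
Local Open Scope ring_scope.

(* On a finite-dimensional space, being of class C^k in the usual sense amounts
   to the existence and continuity of all iterated directional derivatives of
   order at most k. *)
Fixpoint Ck (R : realType) (V : normedModType R) (k : nat) (f : V -> R)
    : Prop :=
  continuous f /\
  (if k is k'.+1 then
     forall v : V, (forall x, derivable f x v) /\ Ck k' (fun x => 'D_v f x)
   else True).

Definition smooth (R : realType) (V : normedModType R) (f : V -> R) : Prop :=
  forall k, Ck k f.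

(* Elements of C^oo_0(Omega), extended by zero to the whole space. *)
Definition test_function (R : realType) (V : normedModType R)
    (Omega : set V) (phi : V -> R) : Prop :=
  [/\ smooth phi,
      compact (closure [set x | phi x != 0]) &
      closure [set x | phi x != 0] `<=` Omega].

Definition unit_interval (R : realType) : set R := `]- (1 / 2), 1 / 2[%classic.

Definition pi_p (R : realType) (p : R) : R :=
  inf [set t : R | exists phi : R -> R,
    [/\ test_function (@unit_interval R) phi,
        'N[@lebesgue_measure R]_(p%:E)
          [EFin \o (phi \_ (@unit_interval R))]%E = 1%E &
        'N[@lebesgue_measure R]_(p%:E)
          [EFin \o (phi^`()%classic \_ (@unit_interval R))]%E = t%:E]].

(* The library's norm on [R * R] is the maximum norm; the Euclidean structure
   is therefore introduced separately (the topologies coincide). *)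
Definition dot (R : realType) (v w : R * R) : R := v.1 * w.1 + v.2 * w.2.

Definition enorm (R : realType) (v : R * R) : R := Num.sqrt (dot v v).

Definition eball (R : realType) (r : R) : set (R * R) := [set x | enorm x < r].

Definition leb2 (R : realType) :
    {measure set (measurableTypeR R * measurableTypeR R) -> \bar R} :=
  (@lebesgue_measure R \x @lebesgue_measure R)%E.

Definition grad (R : realType) (phi : R * R -> R) (x : R * R) : R * R :=
  ('D_((1, 0) : R * R) phi x, 'D_((0, 1) : R * R) phi x).

(* Functions are defined on the whole plane, but only their values on [Omega]
   matter.  Classes modulo a.e. equality are represented by their (Borel)
   members. *)
Definition inLp (R : realType) (Omega : set (R * R)) (p : R)
    (f : R * R -> R) : Prop :=
  f \_ Omega \in Lfun (@leb2 R) p%:E.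

Definition Lp_norm (R : realType) (Omega : set (R * R)) (p : R)
    (f : R * R -> R) : \bar R :=
  'N[@leb2 R]_(p%:E)[EFin \o (f \_ Omega)]%E.

(* [u] belongs to W^{1,p}(Omega) and [g] is (a member of the class of) its weak
   gradient. *)
Definition inW1p (R : realType) (Omega : set (R * R)) (p : R)
    (u : R * R -> R) (g : R * R -> R * R) : Prop :=
  [/\ inLp Omega p u,
      inLp Omega p (fun x => (g x).1),
      inLp Omega p (fun x => (g x).2) &
      forall phi : R * R -> R, test_function Omega phi ->
        (\int[@leb2 R]_(x in Omega) (u x * (grad phi x).1)) =
          - (\int[@leb2 R]_(x in Omega) ((g x).1 * phi x)) /\
        (\int[@leb2 R]_(x in Omega) (u x * (grad phi x).2)) =
          - (\int[@leb2 R]_(x in Omega) ((g x).2 * phi x))].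

(* \int_Omega |g|^p, for a vector field g. *)
Definition energy (R : realType) (Omega : set (R * R)) (p : R)
    (g : R * R -> R * R) : \bar R :=
  (\int[@leb2 R]_(x in Omega) (enorm (g x) `^ p)%:E)%E.

Definition W1p_norm (R : realType) (Omega : set (R * R)) (p : R)
    (u : R * R -> R) (g : R * R -> R * R) : \bar R :=
  ((\int[@leb2 R]_(x in Omega) (`|u x| `^ p)%:E + energy Omega p g) `^ p^-1)%E.

(* W^{1,p}_0(Omega): an element is packed with its weak gradient, which is
   determined up to a.e. equality. *)
Record W01p (R : realType) (Omega : set (R * R)) (p : R) := MkW01p {
  W01p_fun :> R * R -> R ;
  W01p_grad : R * R -> R * R ;
  W01p_inW1p : inW1p Omega p W01p_fun W01p_grad ;
  W01p_closure : forall e : R, 0 < e ->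
    exists2 phi : R * R -> R, test_function Omega phi &
      (W1p_norm Omega p (fun x => W01p_fun x - phi x)%R
         (fun x => W01p_grad x - grad phi x)%R < e%:E)%E
}.

Definition W01p_norm (R : realType) (Omega : set (R * R)) (p : R)
    (u : W01p Omega p) : \bar R :=
  W1p_norm Omega p u (W01p_grad u).

(* [u] is the zero element of W^{1,p}_0(Omega), that is, u = 0 a.e. in Omega. *)
Definition W01p_is_zero (R : realType) (Omega : set (R * R)) (p : R)
    (u : W01p Omega p) : Prop :=
  {ae @leb2 R, forall x, Omega x -> u x = 0}.

(* The norm of W^{-1,p'}(Omega), for a functional F on W^{1,p}_0(Omega). *)
Definition dual_norm (R : realType) (Omega : set (R * R)) (p : R)
    (F : W01p Omega p -> R) : \bar R :=
  ereal_sup [set `|F phi|%:E | phi in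
    [set phi : W01p Omega p | (W01p_norm phi <= 1)%E]].

(* <- Delta_p u, phi>.  When p < 2 the factor |grad u|^{p-2} is 0 (not +oo)
   where grad u = 0, so that the field |grad u|^{p-2} grad u vanishes there, as
   it should; similarly in [power_functional]. *)
Definition plaplacian (R : realType) (Omega : set (R * R)) (p : R)
    (u phi : W01p Omega p) : R :=
  \int[@leb2 R]_(x in Omega)
    dot (enorm (W01p_grad u x) `^ (p - 2) *: W01p_grad u x) (W01p_grad phi x).

(* The functional associated with |u|^{p-2} u. *)
Definition power_functional (R : realType) (Omega : set (R * R)) (p : R)
    (u phi : W01p Omega p) : R :=
  \int[@leb2 R]_(x in Omega) (`|u x| `^ (p - 2) * u x * phi x).

Definition eigen_spectrum (R : realType) (Omega : set (R * R)) (p : R)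
    : set R :=
  [set lambda | exists2 u : W01p Omega p, ~ W01p_is_zero u &
    forall phi : W01p Omega p,
      plaplacian u phi = lambda * power_functional u phi].

Definition palais_smale (R : realType) (Omega : set (R * R)) (p lambda : R)
    (u : nat -> W01p Omega p) : Prop :=
  [/\ forall n, Lp_norm Omega p (u n) = 1%E,
      energy Omega p (W01p_grad (u n)) @[n --> \oo] --> lambda%:E &
      dual_norm (fun phi : W01p Omega p =>
        plaplacian (u n) phi - lambda * power_functional (u n) phi)
        @[n --> \oo] --> 0%E].

Definition singular (R : realType) (Omega : set (R * R)) (p : R)
    (u : nat -> W01p Omega p) : Prop :=
  forall r : R, 0 < r ->
    Lp_norm (Omega `&` eball r) p (u n) @[n --> \oo] --> 0%E.

Definition ess_spectrum (R : realType) (Omega : set (R * R)) (p : R) : set R :=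
  [set lambda | exists2 u : nat -> W01p Omega p,
    palais_smale lambda u & singular u].

Definition strip (R : realType) (alpha : R) : set (R * R) :=
  `]- alpha, alpha[%classic `*` [set: R].

(* Main.v *)
(* Eigenvalues.  Let u solve the eigenvalue equation, with gradient G, and test it against
   th(x_2) (u(x + h e_2) - u(x)), where 0 <= th <= 1.  Convexity of |.|^p and h -> 0 (through
   both signs) yield the inner variation identity
     int th' (lambda |u|^p - |G|^p) + p int th' |G|^{p-2} G_2^2 = 0.
   Take th' proportional to cos(c x_2) and let c -> 0: since int |G|^p = lambda int |u|^p, it
   follows that G_2 = 0, so that u does not depend on x_2, and then u = 0 by integrability.

   Essential spectrum.  The lower bound is the one-dimensional Poincare inequality on the
   slices x_2 = const.  Conversely, for lambda above the threshold let L be the infimum of the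
   lengths for which some test function of the cell (-alpha, alpha) x (0, L) has a Rayleigh
   quotient below lambda.  On the cell of length exactly L the infimum of the quotient is
   lambda, and by convexity almost minimizers are almost critical.  Reflect such a function
   oddly across the edges of the cell and repeat it over n periods: a test function is folded
   back into the cell up to terms living on the two extreme periods, which are bounded
   independently of n, whereas normalising in L^p divides the residual by n^{(p-1)/p}.
   Translating far away makes the sequence singular; the threshold itself is reached by
   approximation from above. *)

Require Import Defs.
From HB Require Import structures.
From mathcomp Require Import all_boot all_order all_algebra.
From mathcomp Require Import all_classical all_reals all_analysis.
From mathcomp Require Import measurable_realfun ring lra.

Set Implicit Arguments.
Unset Strict Implicit.
Unset Printing Implicit Defensive.

Import Order.TTheory GRing.Theory Num.Theory.
Import numFieldNormedType.Exports.

Local Open Scope classical_set_scope.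
Local Open Scope ring_scope.

(** * Plane vectors *)

(** Everything rests on approximation by test functions and on the tangent inequality for |.|^p. An
    eigenfunction is only in W^{1,p}_0, so its x_2-derivative is not an admissible test function;
    its increments are, and convexity controls them to first order in h. The resulting inequality is
    linear in h up to o(h), so the two signs of h turn it into an identity. For the converse
    inclusion the obstacle is nonlinearity: modes cannot be superposed. The p-Laplacian is however
    additive on disjoint supports and commutes with reflections and translations, which is all that
    a chain of cells requires. Oddness is the right symmetry: a cell only sees the odd part of a
    folded test function, and this part vanishes on the edges as soon as the test function vanishes
    at the two ends of the chain. Constants are chosen in a strict order: the bound for the extreme
    periods before the number n of periods, and n before the accuracy of the almost minimizer, so
    that constants growing with n are harmless. Estimates concern integrals of p-th powers and use
    Young's inequality with a free small parameter. *)

Section plane_vectors.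
Context {R : realType}.
Implicit Types (a b c : R * R) (k : R).

Lemma scaler_pair k a : k *: a = (k * a.1, k * a.2).
Proof. by []. Qed.

Lemma dotC a b : dot a b = dot b a.
Proof. by rewrite /dot; ring. Qed.

Lemma dotDr a b c : dot a (b + c) = dot a b + dot a c.
Proof. by rewrite /dot /=; ring. Qed.

Lemma dotDl a b c : dot (a + b) c = dot a c + dot b c.
Proof. by rewrite /dot /=; ring. Qed.

Lemma dotNr a b : dot a (- b) = - dot a b.
Proof. by rewrite /dot /=; ring. Qed.

Lemma dotNl a b : dot (- a) b = - dot a b.
Proof. by rewrite /dot /=; ring. Qed.

Lemma dotBr a b c : dot a (b - c) = dot a b - dot a c.
Proof. by rewrite dotDr dotNr. Qed.

Lemma dotBl a b c : dot (a - b) c = dot a c - dot b c.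
Proof. by rewrite dotDl dotNl. Qed.

Lemma dotZr k a b : dot a (k *: b) = k * dot a b.
Proof. by rewrite scaler_pair /dot /=; ring. Qed.

Lemma dotZl k a b : dot (k *: a) b = k * dot a b.
Proof. by rewrite scaler_pair /dot /=; ring. Qed.

Lemma dot_ge0 a : 0 <= dot a a.
Proof. by rewrite /dot addr_ge0// -expr2 sqr_ge0. Qed.

Lemma enorm_ge0 a : 0 <= enorm a.
Proof. exact: sqrtr_ge0. Qed.

Lemma sqr_enorm a : enorm a ^+ 2 = dot a a.
Proof. by rewrite /enorm sqr_sqrtr// dot_ge0. Qed.

Lemma enormZ k a : enorm (k *: a) = `|k| * enorm a.
Proof.
by rewrite /enorm dotZl dotZr mulrA -expr2 sqrtrM ?sqr_ge0// sqrtr_sqr.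
Qed.

Lemma enormN a : enorm (- a) = enorm a.
Proof. by rewrite -scaleN1r enormZ normrN1 mul1r. Qed.

Lemma enorm0 : enorm (0 : R * R) = 0.
Proof. by rewrite -(scale0r (0 : R * R)) enormZ normr0 mul0r. Qed.

Lemma enorm_fst (x : R) : enorm (x, 0) = `|x|.
Proof. by rewrite /enorm /dot /= mulr0 addr0 -expr2 sqrtr_sqr. Qed.

Lemma enorm_snd (x : R) : enorm (0, x) = `|x|.
Proof. by rewrite /enorm /dot /= mulr0 add0r -expr2 sqrtr_sqr. Qed.

Lemma ler_fst_enorm a : `|a.1| <= enorm a.
Proof.
rewrite -(ler_pXn2r (n := 2))// ?nnegrE ?enorm_ge0//.
by rewrite sqr_enorm real_normK ?num_real// /dot -!expr2 lerDl sqr_ge0.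
Qed.

Lemma ler_snd_enorm a : `|a.2| <= enorm a.
Proof.
rewrite -(ler_pXn2r (n := 2))// ?nnegrE ?enorm_ge0//.
by rewrite sqr_enorm real_normK ?num_real// /dot -!expr2 lerDr sqr_ge0.
Qed.

Lemma enorm_eq0 a : enorm a = 0 -> a = 0.
Proof.
move=> a0; move: (ler_fst_enorm a) (ler_snd_enorm a).
by rewrite a0 !normr_le0; case: a {a0} => x y /= /eqP-> /eqP->.
Qed.

Lemma dot_le_enorm a b : `|dot a b| <= enorm a * enorm b.
Proof.
rewrite -(ler_pXn2r (n := 2)) ?nnegrE ?mulr_ge0 ?enorm_ge0//.
rewrite exprMn !sqr_enorm real_normK ?num_real//.
rewrite -subr_ge0 [leRHS](_ : _ = (a.1 * b.2 - a.2 * b.1) ^+ 2) ?sqr_ge0//.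
by rewrite /dot; ring.
Qed.

Lemma ler_enormD a b : enorm (a + b) <= enorm a + enorm b.
Proof.
rewrite -(ler_pXn2r (n := 2)) ?nnegrE ?addr_ge0 ?enorm_ge0//.
rewrite sqrrD !sqr_enorm dotDl !dotDr (dotC b a).
have := le_trans (ler_norm _) (dot_le_enorm a b).
lra.
Qed.

Lemma ler_enorm_sum a : enorm a <= `|a.1| + `|a.2|.
Proof.
have -> : a = (a.1, 0) + (0, a.2).
  by case: a => x y; rewrite /GRing.add/= /add_pair /= addr0 add0r.
by rewrite (le_trans (ler_enormD _ _))// enorm_fst enorm_snd /= addr0 add0r.
Qed.

Lemma ler_enormB a b : enorm a - enorm b <= enorm (a - b).
Proof. by rewrite lerBlDr -{1}(subrK b a) ler_enormD. Qed.

End plane_vectors.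

(* The map [a |-> |a|^(p-2) a] is [p^-1] times the gradient of [|a|^p]; scalar
   functions are treated as vector fields with zero second component. *)
Definition pfield (R : realType) (p : R) (a : R * R) : R * R :=
  enorm a `^ (p - 2) *: a.

Section pfield.
Context {R : realType} (p : R) (hp : 1 < p).
Implicit Types (a b c : R * R) (k s t : R).
Local Notation V := (pfield p).

Let p0 : 0 < p. Proof. exact: lt_trans hp. Qed.
Let p10 : 0 < p - 1. Proof. by rewrite subr_gt0. Qed.

Lemma pfield0 : V 0 = 0.
Proof. by rewrite /pfield scaler0. Qed.

Lemma powRp s : 0 <= s -> s `^ p = s `^ (p - 1) * s.
Proof. by move=> s0; rewrite -(mulr_powRB1 s0 p0) mulrC. Qed.

Lemma powRp1 s : 0 <= s -> s `^ (p - 1) = s `^ (p - 2) * s.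
Proof. by move=> s0; rewrite -(mulr_powRB1 s0 p10) mulrC; congr (_ `^ _ * _); ring. Qed.

Lemma dot_pfield a : dot (V a) a = enorm a `^ p.
Proof.
by rewrite /pfield dotZl -sqr_enorm expr2 mulrA -powRp1 ?enorm_ge0// -powRp ?enorm_ge0.
Qed.

Lemma enorm_pfield a : enorm (V a) = enorm a `^ (p - 1).
Proof. by rewrite enormZ ger0_norm ?powR_ge0// -powRp1 ?enorm_ge0. Qed.

Lemma pfieldZ k a : V (k *: a) = (`|k| `^ (p - 2) * k) *: V a.
Proof.
rewrite /pfield enormZ powRM ?enorm_ge0// !scalerA; congr (_ *: _).
by rewrite -!mulrA; congr (_ * _); rewrite mulrC.
Qed.

Lemma pfieldN a : V (- a) = - V a.
Proof. by rewrite /pfield enormN scalerN. Qed.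

Lemma pfieldZp k a : 0 <= k -> V (k *: a) = k `^ (p - 1) *: V a.
Proof. by move=> k0; rewrite pfieldZ ger0_norm// -powRp1. Qed.

Lemma pfield_fst (x : R) : V (x, 0) = (`|x| `^ (p - 2) * x, 0).
Proof. by rewrite /pfield enorm_fst scaler_pair /= mulr0. Qed.

(** Compare [t] with [k * s]: in one case the first term alone dominates, in the other the second.
    The constants are not sharp; what counts is the free parameter [k]. *)
Lemma young k s t : 0 < k -> 0 <= s -> 0 <= t ->
  s `^ (p - 1) * t <= k * s `^ p + k `^ (1 - p) * t `^ p.
Proof.
move=> k0 s0 t0; have [tks|kst] := leP t (k * s).
  rewrite -[leLHS]addr0 lerD ?mulr_ge0 ?powR_ge0//.
  rewrite powRp// [leRHS](_ : _ = s `^ (p - 1) * (k * s)); last by ring.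
  by rewrite ler_wpM2l ?powR_ge0.
rewrite -[leLHS]add0r lerD ?mulr_ge0 ?powR_ge0//; first exact: ltW.
have t_gt0 : 0 <= k^-1 by rewrite invr_ge0 ltW.
rewrite (powRp t0) mulrA ler_wpM2r//.
have -> : k `^ (1 - p) = k^-1 `^ (p - 1).
  by rewrite -powR_inv1 ?ltW// -powRrM mulN1r opprB.
rewrite -powRM// ge0_ler_powR ?nnegrE ?mulr_ge0 ?(ltW p10)//.
by rewrite mulrC ler_pdivlMr// mulrC ltW.
Qed.

(** Cauchy-Schwarz and Young's inequality with exact conjugate exponents. Sharp constants are
    essential here: equality at [b = a] is what turns this bound into the tangent inequality
    [enorm_powR_convex]. *)
Lemma dot_pfield_le a b :
  p * dot (V a) b <= (p - 1) * enorm a `^ p + enorm b `^ p.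
Proof.
have := le_trans (ler_norm _) (dot_le_enorm (V a) b).
rewrite enorm_pfield => h.
have q0 : 0 < p / (p - 1) by rewrite divr_gt0.
have := @conjugate_powR _ (enorm a `^ (p - 1)) (enorm b) (p / (p - 1)) p
  (powR_ge0 _ _) (enorm_ge0 b) q0 p0.
rewrite -powRrM (_ : (p - 1) * (p / (p - 1)) = p); last by field; rewrite gt_eqF.
rewrite invf_div => /(_ _)/wrap[|/(le_trans h)].
  by field; rewrite gt_eqF.
rewrite -(ler_pM2l p0) => /le_trans; apply.
rewrite le_eqVlt; apply/orP; left; apply/eqP.
by field; rewrite !gt_eqF.
Qed.

Lemma enorm_powR_convex a b :
  enorm a `^ p + p * dot (V a) (b - a) <= enorm b `^ p.
Proof. by have := dot_pfield_le a b; rewrite dotBr dot_pfield; lra. Qed.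

(** The tangent inequalities at the intermediate point, towards [a] and towards [b], are averaged;
    the first-order terms cancel. *)
Lemma enorm_powR_comb t a b : 0 <= t <= 1 ->
  enorm (a + t *: (b - a)) `^ p <= (1 - t) * enorm a `^ p + t * enorm b `^ p.
Proof.
move=> /andP[t0 t1]; set c := a + _.
have := enorm_powR_convex c a; have := enorm_powR_convex c b.
have -> : b - c = (1 - t) *: (b - a).
  by rewrite /c scalerBl scale1r opprD addrA.
have -> : a - c = - t *: (b - a) by rewrite /c opprD addrA subrr add0r scaleNr.
rewrite !dotZr; set D := dot _ _; set N := enorm c `^ p.
move=> hb ha.
have -> : N = (1 - t) * (N + p * (- t * D)) + t * (N + p * ((1 - t) * D)) by ring.
by rewrite lerD// ler_wpM2l// subr_ge0.
Qed.

Lemma enorm_powR_sum n (f : 'I_n -> R * R) :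
  enorm (\sum_i f i) `^ p <= n%:R `^ (p - 1) * \sum_i enorm (f i) `^ p.
Proof.
case: n f => [|n] f; first by rewrite !big_ord0 enorm0 powR0 ?mulr0// gt_eqF.
set m := n.+1%:R : R; have m0 : 0 < m by rewrite ltr0n.
(* Jensen's inequality: the tangent inequalities at the mean [c] are summed, and their linear parts
   cancel. *)
pose c := m^-1 *: \sum_i f i.
have : \sum_(i < n.+1) (enorm c `^ p + p * dot (V c) (f i - c)) <= \sum_i enorm (f i) `^ p.
  by apply: ler_sum => i _; exact: enorm_powR_convex.
rewrite big_split/= sumr_const card_ord -mulr_sumr.
have -> : \sum_(i < n.+1) dot (V c) (f i - c) = 0.
  have -> : \sum_(i < n.+1) dot (V c) (f i - c) = dot (V c) (\sum_(i < n.+1) (f i - c)).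
    by elim/big_ind2 : _ => [|? ? ? ? -> ->|//]; rewrite ?dotDr// /dot/= !mulr0 addr0.
  rewrite sumrB sumr_const card_ord -scaler_nat scalerA mulfV ?gt_eqF// scale1r subrr.
  by rewrite /dot/= !mulr0 addr0.
have mV : 0 <= m^-1 by rewrite invr_ge0 ltW.
rewrite mulr0 addr0 {1}/c enormZ ger0_norm// powRM ?enorm_ge0//.
rewrite -mulr_natl -/m mulrA => h.
have -> : enorm (\sum_i f i) `^ p =
    m `^ (p - 1) * (m * m^-1 `^ p * enorm (\sum_i f i) `^ p).
  rewrite !mulrA -(powRp (ltW m0)) -(powRM _ (ltW m0) mV) mulfV ?gt_eqF//.
  by rewrite powR1 mul1r.
by rewrite ler_wpM2l ?powR_ge0.
Qed.

(** Either [b] is at most [r] times [a], or [a] is less than [r^-1] times [b]. For small [r] the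
    factor of [a] is close to 1, so that approximation arguments lose nothing in the limit. *)
Lemma enorm_powRD r a b : 0 < r -> enorm (a + b) `^ p <=
  (1 + r) `^ p * enorm a `^ p + (1 + r^-1) `^ p * enorm b `^ p.
Proof.
move=> r0; have rV0 : 0 < r^-1 by rewrite invr_gt0.
have r1 : 0 <= 1 + r by lra.
have rV1 : 0 <= 1 + r^-1 by lra.
have [h|h] := leP (enorm b) (r * enorm a).
  rewrite -[leLHS]addr0 lerD ?mulr_ge0 ?powR_ge0// -powRM ?enorm_ge0//.
  rewrite ge0_ler_powR ?nnegrE ?mulr_ge0 ?enorm_ge0//; first exact: ltW.
  by rewrite (le_trans (ler_enormD _ _))//; lra.
rewrite -[leLHS]add0r lerD ?mulr_ge0 ?powR_ge0// -powRM ?enorm_ge0//.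
rewrite ge0_ler_powR ?nnegrE ?mulr_ge0 ?enorm_ge0//; first exact: ltW.
rewrite (le_trans (ler_enormD _ _))// mulrDl mul1r addrC lerD2l.
by rewrite mulrC ler_pdivlMr// mulrC ltW.
Qed.

(* Near the unit circle by continuity of [s |-> s^(p-2)] at 1, elsewhere
   because [a] is then dominated by [b]. *)
Lemma pfield_continuity d : 0 < d -> exists2 C, 0 <= C & forall a b,
  enorm (V (a + b) - V a) <=
    d * enorm a `^ (p - 1) + C * enorm b `^ (p - 1).
Proof.
move=> d0.
have cont : {for (1:R), continuous (fun s : R => s `^ (p - 2))}.
  apply: differentiable_continuous; apply/derivable1_diffP.
  by apply: derivable_powR; rewrite in_itv/= ltr01.
have d4 : 0 < d / 4 by lra.
move: cont => /cvgrPdist_le /(_ _ d4); rewrite powR1 => -[r /= r0 hr].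
(* With this [q] the relative change [|1 - s|] of the modulus stays below [r], and
   [d / 4 * (2 * A) + q * A] is at most [d * A]. *)
pose q := Num.min (r / 2) (Num.min (d / 2) (1 / 2)).
have q0 : 0 < q by rewrite /q !lt_min; apply/and3P; split; lra.
have qr : q < r by rewrite /q gt_min; apply/orP; left; lra.
have qd : q <= d / 2 by rewrite /q !ge_min lexx !orbT.
have q1 : q <= 1 / 2 by rewrite /q !ge_min lexx !orbT.
have qV : 0 <= 1 + q^-1 by rewrite addr_ge0// invr_ge0 ltW.
exists ((1 + q^-1) `^ (p - 1) + q^-1 `^ (p - 1)).
  by rewrite addr_ge0 ?powR_ge0.
move=> a b.
have [h|h] := leP (enorm b) (q * enorm a); last first.
  rewrite -[leLHS]add0r lerD ?mulr_ge0 ?powR_ge0//; first exact: ltW.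
  have ab : enorm a <= q^-1 * enorm b by rewrite mulrC ler_pdivlMr// mulrC ltW.
  rewrite (le_trans (ler_enormD _ _))// enormN !enorm_pfield mulrDl.
  rewrite -!powRM ?enorm_ge0 ?invr_ge0 ?(ltW q0)//.
  rewrite lerD// ge0_ler_powR ?nnegrE ?mulr_ge0 ?enorm_ge0 ?invr_ge0 ?(ltW q0) ?(ltW p10)//.
  by rewrite (le_trans (ler_enormD _ _))// mulrDl mul1r addrC lerD2l.
have [a0|a0] := eqVneq (enorm a) 0.
  have b0 : enorm b = 0 by apply/eqP; rewrite eq_le enorm_ge0 -(mulr0 q) -a0 h.
  rewrite (enorm_eq0 b0) addr0 subrr enorm0.
  by rewrite addr_ge0// mulr_ge0 ?powR_ge0 ?addr_ge0 ?powR_ge0// ltW.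
have {}a0 : 0 < enorm a by rewrite lt_neqAle eq_sym a0 enorm_ge0.
set c := a + b; set A := enorm a in a0 h *.
have cA : enorm c <= 2 * A.
  by rewrite (le_trans (ler_enormD _ _))// (le_trans (lerD (lexx _) h))// -/A; nra.
pose s := enorm c / A.
have cs : enorm c = s * A by rewrite /s divfK ?gt_eqF.
have s1 : `|1 - s| <= q.
  have -> : 1 - s = (A - enorm c) / A by rewrite /s; field; rewrite gt_eqF.
  rewrite normrM normfV (gtr0_norm a0) ler_pdivrMr//.
  have := ler_enormB a (- b); rewrite opprK enormN -/c -/A => h1.
  have := ler_enormD a b; rewrite -/c -/A => h2.
  by rewrite ler_norml; apply/andP; split; lra.
have s0 : 0 < s by move: s1; rewrite ler_norml => /andP[? ?]; lra.
have hs : `|1 - s `^ (p - 2)| <= d / 4.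
  by apply: hr => /=; rewrite (le_lt_trans s1).
have -> : V c - V a = A `^ (p - 2) *: ((s `^ (p - 2) - 1) *: c + b).
  rewrite /pfield -/A cs (powRM _ (ltW s0) (ltW a0)) /c.
  by apply: injective_projections; rewrite /= !/(_ *: _)/=; ring.
rewrite enormZ ger0_norm ?powR_ge0// (powRp1 (ltW a0)) -[leLHS]addr0 lerD//; last first.
  by rewrite mulr_ge0 ?powR_ge0 ?addr_ge0 ?powR_ge0.
rewrite mulrCA ler_wpM2l ?powR_ge0// (le_trans (ler_enormD _ _))// enormZ distrC.
have : `|1 - s `^ (p - 2)| * enorm c <= d / 4 * (2 * A) by rewrite ler_pM ?enorm_ge0.
nra.
Qed.

End pfield.

(** * Affine changes of variables and integration over the plane *)

Definition scaled_image d1 d2 (T1 : measurableType d1) (T2 : measurableType d2)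
    (R : realType) (m : {measure set T1 -> \bar R}) (f : T1 -> T2)
    (mf : measurable_fun setT f) (c : {nonneg R}) :
    {measure set T2 -> \bar R} :=
  mscale c (measure_function_pushforward__canonical__measure_function_Measure m mf).

Lemma scaled_imageE d1 d2 (T1 : measurableType d1) (T2 : measurableType d2)
    (R : realType) (m : {measure set T1 -> \bar R}) (f : T1 -> T2)
    (mf : measurable_fun setT f) (c : {nonneg R}) (A : set T2) :
  scaled_image m mf c A = (c%:num%:E * m (f @^-1` A))%E.
Proof. by []. Qed.

Lemma ge0_integral_image d (T : measurableType d) (R : realType)
    (m : {measure set T -> \bar R}) (f : T -> T) (c : R) (g : T -> \bar R) :
  measurable_fun setT f -> 0 < c ->
  (forall A, measurable A -> m (f @^-1` A) = (c%:E * m A)%E) ->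
  measurable_fun setT g -> (forall x, 0 <= g x)%E ->
  (\int[m]_x g (f x) = c%:E * \int[m]_x g x)%E.
Proof.
move=> mf c0 mfA mg g0.
have -> : (\int[m]_x g (f x) = \int[pushforward m f]_x g x)%E.
  by rewrite ge0_integral_pushforward// => x _; exact: g0.
rewrite -(ge0_integral_mscale _ _ (NngNum (ltW c0)))//.
by apply: eq_measure_integral => A mA _; exact: mfA.
Qed.

(** Integration is over the whole plane: functions on the strip are extended by zero, so that
    translations, reflections and dilations act on integrands without moving a domain. *)
HB.lock Definition Int (R : realType) (f : R * R -> R) : R := \int[@leb2 R]_x f x.

HB.lock Definition pint (R : realType) (f : R * R -> R) : Prop :=
  (@leb2 R).-integrable setT (EFin \o f).

Lemma IntE (R : realType) (f : R * R -> R) : Int f = \int[@leb2 R]_x f x.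
Proof. by rewrite Int.unlock. Qed.

Lemma pintE (R : realType) (f : R * R -> R) :
  pint f = (@leb2 R).-integrable setT (EFin \o f).
Proof. by rewrite pint.unlock. Qed.

Section plane_measure.
Context {R : realType}.
Local Notation plane := (measurableTypeR R * measurableTypeR R)%type.
Local Notation mu := (@leb2 R).
Implicit Types (f g : R * R -> R).

Definition affine_map (s h x : R) : R := s * x + h.

Lemma affine_continuous (s h : R) : continuous (affine_map s h).
Proof. by move=> x; apply: cvgD; [apply: cvgM => //; apply: cvg_cst|apply: cvg_cst]. Qed.

Lemma measurable_affine (s h : R) :
  measurable_fun [set: measurableTypeR R] (affine_map s h : measurableTypeR R -> measurableTypeR R).
Proof. by apply: continuous_measurable_fun; exact: affine_continuous. Qed.

(** The image measure multiplied by [|s|] agrees with Lebesgue measure on half-open intervals, hence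
    everywhere by uniqueness. *)
Lemma lebesgue_affine (s h : R) (s0 : s != 0) (A : set (measurableTypeR R)) :
  measurable A ->
  lebesgue_measure (affine_map s h @^-1` A) = ((`|s|^-1)%:E * lebesgue_measure A)%E.
Proof.
move=> mA; have n0 : 0 < `|s| by rewrite normr_gt0.
pose m' := scaled_image (@lebesgue_measure R) (measurable_affine s h) (NngNum (ltW n0)).
have : lebesgue_measure A = m' A.
  apply: lebesgue_measure_unique => //= X [[a b] _ <-]/=.
  rewrite /m' scaled_imageE /= lebesgue_measure_itv/=.
  have [sp|sn] : 0 < s \/ 0 < - s by case: ltrgt0P s0 => //; [left|right; rewrite oppr_gt0].
    rewrite gtr0_norm//.
    have -> : affine_map s h @^-1` `]a, b] = `](a - h) / s, (b - h) / s]%classic.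
      apply/seteqP; split => x /=; rewrite !in_itv/= /affine_map ltr_pdivrMr// ler_pdivlMr//;
      by rewrite ltrBlDr lerBrDr (mulrC x).
    rewrite lebesgue_measure_itv/= !lte_fin.
    rewrite ltr_pM2r ?invr_gt0// ltrD2r; case: ifPn => // _; last by rewrite mule0.
    by rewrite -!EFinD -EFinM; congr EFin; field.
  rewrite -normrN gtr0_norm//.
  (* A negative slope exchanges the open and the closed end of the interval. *)
  have -> : affine_map s h @^-1` `]a, b] = `[(h - b) / - s, (h - a) / - s[%classic.
    apply/seteqP; split => x /=; rewrite !in_itv/= /affine_map ltr_pdivlMr// ler_pdivrMr//;
    by move=> /andP[? ?]; apply/andP; split; lra.
  rewrite lebesgue_measure_itv/= !lte_fin.
  rewrite ltr_pM2r ?invr_gt0// ltrD2l ltrN2; case: ifPn => // _; last by rewrite mule0.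
  by rewrite -!EFinD -EFinM; congr EFin; field.
rewrite /m' scaled_imageE/= => ->.
by rewrite muleA -EFinM mulVf ?gt_eqF// mul1e.
Qed.

Definition affine2 (s h x : R * R) : R * R := (affine_map s.1 h.1 x.1, affine_map s.2 h.2 x.2).

Lemma measurable_affine2 (s h : R * R) :
  measurable_fun [set: plane] (affine2 s h : plane -> plane).
Proof.
apply/measurable_fun_pairP; split.
  by apply: (@measurableT_comp _ _ _ _ _ _ (affine_map s.1 h.1)) => //; exact: measurable_affine.
by apply: (@measurableT_comp _ _ _ _ _ _ (affine_map s.2 h.2)) => //; exact: measurable_affine.
Qed.

Lemma leb2_affine (s h : R * R) (s1 : s.1 != 0) (s2 : s.2 != 0) (A : set plane) :
  measurable A ->
  mu (affine2 s h @^-1` A) = (`|s.1 * s.2|^-1%:E * mu A)%E.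
Proof.
move=> mA; have n0 : 0 < `|s.1 * s.2| by rewrite normr_gt0 mulf_neq0.
pose m' := scaled_image mu (measurable_affine2 s h) (NngNum (ltW n0)).
have : mu A = m' A.
  apply: product_measure_unique => //= X Y mX mY.
  rewrite /m' scaled_imageE /=.
  have -> : affine2 s h @^-1` (X `*` Y) =
      (affine_map s.1 h.1 @^-1` X) `*` (affine_map s.2 h.2 @^-1` Y) by [].
  rewrite product_measure1E//=.
  - rewrite !lebesgue_affine//.
    rewrite [X in (_ * X)%E]muleACA !muleA.
    have -> : (`|s.1 * s.2|%:E * (`|s.1|^-1)%:E * (`|s.2|^-1)%:E = 1)%E.
      by rewrite normrM -!EFinM; congr EFin; field; rewrite !normr_eq0 ?s1 ?s2.
    by rewrite mul1e.
  - by rewrite -[X in measurable X]setTI; apply: measurable_affine.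
  - by rewrite -[X in measurable X]setTI; apply: measurable_affine.
rewrite /m' scaled_imageE/= => ->.
by rewrite muleA -EFinM mulVf ?mul1e// gt_eqF.
Qed.

Definition mes f := measurable_fun [set: plane] (f : plane -> measurableTypeR R).

Lemma pint_mes f : pint f -> mes f.
Proof. by rewrite pintE => /integrableP[/measurable_EFinP]. Qed.

Lemma EFin_Int f : pint f -> (\int[mu]_x (f x)%:E = (Int f)%:E)%E.
Proof.
by rewrite pintE => If; rewrite IntE /Rintegral fineK//; exact: integral_fune_fin_num.
Qed.

Lemma pint_le f g : mes f -> (forall x, `|f x| <= g x) -> pint g -> pint f.
Proof.
move=> mf fg; rewrite !pintE; apply: le_integrable => //; first exact/measurable_EFinP.
by move=> x _ /=; rewrite lee_fin (le_trans (fg x))// ler_norm.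
Qed.

Lemma pintD f g : pint f -> pint g -> pint (fun x => f x + g x).
Proof. by rewrite !pintE => pf pg; have := integrableD measurableT pf pg; exact: eq_integrable. Qed.

Lemma pintZ (k : R) f : pint f -> pint (fun x => k * f x).
Proof. by rewrite !pintE => pf; have := integrableZl measurableT k pf; exact: eq_integrable. Qed.

Lemma pintN f : pint f -> pint (fun x => - f x).
Proof. by rewrite !pintE => pf; have := integrableN pf; exact: eq_integrable. Qed.

Lemma pintB f g : pint f -> pint g -> pint (fun x => f x - g x).
Proof. by move=> pf pg; apply: pintD => //; exact: pintN. Qed.

Lemma pint0 : pint (fun=> 0 : R).
Proof. by rewrite pintE; exact: integrable0. Qed.

Lemma pint_sum n (F : 'I_n -> R * R -> R) :
  (forall i, pint (F i)) -> pint (fun x => \sum_i F i x).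
Proof.
elim: n F => [|n ih] F pF.
  by rewrite (_ : (fun x => _) = fun=> 0 : R); [exact: pint0|apply/funext => x; rewrite big_ord0].
rewrite (_ : (fun x => _) = (fun x => F ord0 x + \sum_(i < n) F (lift ord0 i) x)).
  by apply: pintD => //; apply: ih.
by apply/funext => x; rewrite big_ord_recl.
Qed.

Lemma pint_norm f : pint f -> pint (fun x => `|f x|).
Proof. by rewrite !pintE => pf; have := integrable_abse pf; exact: eq_integrable. Qed.

Lemma IntD f g : pint f -> pint g -> Int (fun x => f x + g x) = Int f + Int g.
Proof. by rewrite !pintE !IntE => pf pg; exact: RintegralD. Qed.

Lemma IntZ (k : R) f : pint f -> Int (fun x => k * f x) = k * Int f.
Proof. by rewrite !pintE !IntE => pf; exact: RintegralZl. Qed.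

Lemma IntN f : pint f -> Int (fun x => - f x) = - Int f.
Proof.
move=> pf; rewrite -mulN1r -IntZ//; congr Int; apply/funext => x.
by rewrite mulN1r.
Qed.

Lemma IntB f g : pint f -> pint g -> Int (fun x => f x - g x) = Int f - Int g.
Proof. by move=> pf pg; rewrite IntD ?IntN//; exact: pintN. Qed.

Lemma Int0 : Int (fun=> 0 : R) = 0.
Proof. by rewrite IntE Rintegral_cst// mul0r. Qed.

Lemma Int_sum n (F : 'I_n -> R * R -> R) :
  (forall i, pint (F i)) -> Int (fun x => \sum_i F i x) = \sum_i Int (F i).
Proof.
elim: n F => [|n ih] F pF.
  rewrite big_ord0 (_ : (fun x => _) = fun=> 0) ?Int0//.
  by apply/funext => x; rewrite big_ord0.
rewrite big_ord_recl -ih// -IntD//; last by apply: pint_sum.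
by congr Int; apply/funext => x; rewrite big_ord_recl.
Qed.

Lemma le_Int f g : pint f -> pint g -> (forall x, f x <= g x) -> Int f <= Int g.
Proof. by rewrite !pintE !IntE => pf pg fg; apply: le_Rintegral => // x _; exact: fg. Qed.

Lemma Int_ge0 f : (forall x, 0 <= f x) -> 0 <= Int f.
Proof. by move=> f0; rewrite IntE; apply: Rintegral_ge0. Qed.

Lemma norm_Int f : pint f -> `|Int f| <= Int (fun x => `|f x|).
Proof. by rewrite pintE !IntE => pf; apply: le_normr_Rintegral. Qed.

Lemma norm_Int_le f g : pint f -> pint g -> (forall x, `|f x| <= g x) -> `|Int f| <= Int g.
Proof. by move=> pf pg fg; rewrite (le_trans (norm_Int pf))// le_Int//; exact: pint_norm. Qed.

Lemma affine2_Int (s h : R * R) f : s.1 != 0 -> s.2 != 0 -> pint f ->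
  pint (fun x => f (affine2 s h x)) /\
  Int (fun x => f (affine2 s h x)) = `|s.1 * s.2|^-1 * Int f.
Proof.
move=> s1 s2 pf.
have c0 : 0 < `|s.1 * s.2|^-1 by rewrite invr_gt0 normr_gt0 mulf_neq0.
have key := ge0_integral_image (measurable_affine2 s h) c0 (leb2_affine h s1 s2).
have If : mu.-integrable setT (EFin \o f) by rewrite -pintE.
have pf' : pint (fun x => f (affine2 s h x)).
  rewrite pintE; apply/integrableP; split.
    apply/measurable_EFinP; apply: (measurableT_comp (pint_mes pf)).
    exact: measurable_affine2.
  rewrite /= (key (fun x => `|(f x)%:E|%E))//.
    by rewrite lte_mul_pinfty// ?lee_fin ?(ltW c0)//; case/integrableP : If.
  by do 2 apply: measurableT_comp => //; exact: pint_mes.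
split => //; apply: EFin_inj; rewrite -EFin_Int// EFinM -EFin_Int//.
(* [ge0_integral_image] treats nonnegative integrands, hence the passage through positive and
   negative parts. *)
rewrite [LHS]integralE [X in (_ * X)%E]integralE.
have mf : measurable_fun [set: plane] (EFin \o f) by apply/measurable_EFinP; exact: pint_mes.
have := key _ (measurable_funepos mf) (fun x => funepos_ge0 _ x) => h1.
have := key _ (measurable_funeneg mf) (fun x => funeneg_ge0 _ x) => h2.
rewrite muleBr// -?h1 -?h2; first by
  congr (_ - _)%E; apply: eq_integral => x _; rewrite ?funeposE ?funenegE.
by apply: fin_num_adde_defr; apply: (integrable_pos_fin_num measurableT If).
Qed.

End plane_measure.

(** * Smooth functions *)

Section Ck_calculus.
Context {R : realType} {V : normedModType R}.
Implicit Types (f g : V -> R) (k : nat).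

Lemma eq_Ck k f g : f =1 g -> Ck k f -> Ck k g.
Proof. by move=> /funext ->. Qed.

Lemma Ck_continuous k f : Ck k f -> continuous f.
Proof. by case: k => [|k] []. Qed.

Lemma CkW k f : Ck k.+1 f -> Ck k f.
Proof.
elim: k f => [|k ih] f [cf Df]; first by split.
by split=> // v; have [dv cv] := Df v; split => //; apply: ih.
Qed.

Lemma Ck_cst k (c : R) : Ck k (fun _ : V => c).
Proof.
elim: k c => [|k ih] c; split => //; try by move=> x; exact: cvg_cst.
move=> v; split => [x|]; first exact: derivable_cst.
by apply: eq_Ck (ih 0) => x; rewrite derive_cst.
Qed.

Lemma CkD k f g : Ck k f -> Ck k g -> Ck k (fun x => f x + g x).
Proof.
elim: k f g => [|k ih] f g [cf Df] [cg Dg]; split => //;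
  try by move=> x; apply: cvgD; [exact: cf|exact: cg].
move=> v; have [df Cf] := Df v; have [dg Cg] := Dg v; split => [x|].
  by apply: derivableD; [exact: df|exact: dg].
by apply: eq_Ck (ih _ _ Cf Cg) => x; rewrite -deriveD.
Qed.

Lemma CkM k f g : Ck k f -> Ck k g -> Ck k (fun x => f x * g x).
Proof.
elim: k f g => [|k ih] f g Cf Cg.
  by split => // x; apply: cvgM; [exact: (Ck_continuous Cf)|exact: (Ck_continuous Cg)].
have [cf Df] := Cf; have [cg Dg] := Cg; split.
  by move=> x; apply: cvgM; [exact: cf|exact: cg].
move=> v; have [df Cdf] := Df v; have [dg Cdg] := Dg v; split => [x|].
  by apply: derivableM; [exact: df|exact: dg].
have := CkD (ih _ _ (CkW Cf) Cdg) (ih _ _ (CkW Cg) Cdf).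
by apply: eq_Ck => x; rewrite deriveM.
Qed.

End Ck_calculus.

(** Along an affine map the difference quotients of the composite are literally those of [f] in the
    direction [L v], so induction on [k] replaces a chain rule. Translations, dilations,
    reflections, slices and projections are all instances. *)
Lemma Ck_comp_affine {R : realType} {V W : normedModType R} (l L : W -> V) k (f : V -> R) :
  continuous l -> (forall t v x, l (t *: v + x) = t *: L v + l x) ->
  Ck k f -> Ck k (fun x => f (l x)).
Proof.
move=> cl lL.
elim: k f => [|k ih] f [cf Df]; split => //;
  try by move=> x; apply: continuous_comp; [exact: cl|exact: cf].
have e v x : (fun h : R => h^-1 *: (((fun x => f (l x)) \o shift x) (h *: v) - f (l x))) =
    (fun h : R => h^-1 *: ((f \o shift (l x)) (h *: L v) - f (l x))).
  by apply/funext => h; rewrite /= lL.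
move=> v; have [df Cf] := Df (L v); split => [x|].
  by rewrite /derivable e; exact: df.
by apply: eq_Ck (ih _ Cf) => x; rewrite /derive e.
Qed.

Lemma derive_comp_affine {R : realType} {V W : normedModType R} (l L : W -> V) (f : V -> R) v x :
  (forall t v x, l (t *: v + x) = t *: L v + l x) ->
  'D_v (fun x => f (l x)) x = 'D_(L v) f (l x).
Proof.
move=> lL.
have e : (fun h : R => h^-1 *: (((fun x => f (l x)) \o shift x) (h *: v) - f (l x))) =
    (fun h : R => h^-1 *: ((f \o shift (l x)) (h *: L v) - f (l x))).
  by apply/funext => h; rewrite /= lL.
by rewrite /derive e.
Qed.

Section Ck_real.
Context {R : realType}.
Implicit Types (f : R -> R).

Lemma derive_real f (x v : R) : derivable f x 1 -> derivable f x v /\ 'D_v f x = v * 'D_1 f x.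
Proof.
move=> /derivable1_diffP df; split; first exact: diff_derivable.
rewrite !deriveE// -[v in LHS]mulr1.
by rewrite -[v * 1]/(v *: (1 : R^o)) linearZ.
Qed.

Lemma Ck_derive1 k f f' : (forall x : R, is_derive x 1 f (f' x)) -> Ck k f' -> Ck k.+1 f.
Proof.
move=> df Cf'; split.
  by move=> x; apply: differentiable_continuous; apply/derivable1_diffP; have [] := df x.
move=> v; split => [x|]; first by apply: (proj1 (derive_real v _)); have [] := df x.
apply: eq_Ck (CkM (Ck_cst k v) Cf') => x.
by have [d e] := df x; rewrite (proj2 (derive_real v d)) e.
Qed.

Lemma Ck_is_derive k f (x : R) : Ck k.+1 f -> is_derive x 1 f ('D_1 f x).
Proof. by move=> [_ /(_ 1)[d _]]; apply: DeriveDef. Qed.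

End Ck_real.

Lemma derive_mul (R : realType) (V : normedModType R) (f g : V -> R) (x v : V) :
  derivable f x v -> derivable g x v ->
  'D_v (fun y : V => f y * g y) x = f x * 'D_v g x + g x * 'D_v f x.
Proof. exact: deriveM. Qed.

Section plane_topology.
Context {R : realType}.
Local Notation plane := (measurableTypeR R * measurableTypeR R)%type.
Implicit Types (f g : R * R -> R).

(** The plane carries the product sigma-algebra, so an open set must be exhibited as a countable
    union of rectangles: those with rational centre and radius that it contains. *)
Lemma mes_continuous f : continuous f -> mes f.
Proof.
move=> cf; apply: (measurability _ (RGenOInfty.measurableE R)) => _ [_ [a ->] <-].
rewrite setTI; set O := _ @^-1` _.
pose box (i : rat * rat * rat) : set plane :=
  `]ratr i.1.1 - ratr i.2, ratr i.1.1 + ratr i.2[%classic `*`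
  `]ratr i.1.2 - ratr i.2, ratr i.1.2 + ratr i.2[%classic.
have -> : O = \bigcup_i (if `[< box i `<=` O >] then box i else set0).
  apply/seteqP; split => [x Ox|x [i _]]; last first.
    by case: asboolP => // iO /iO.
  have /nbhs_ballP[e /= e0 eO] : nbhs x O.
    rewrite /O; have /cvgrPdist_lt /(_ (f x - a)) := cf x.
    move: Ox; rewrite /O /= in_itv/= andbT -subr_gt0 => ax /(_ ax).
    apply: filterS => y /=; rewrite ltr_norml => /andP[_].
    by rewrite in_itv/= andbT; lra.
  have e2 : 0 < e / 2 by rewrite divr_gt0.
  have [r] := rat_in_itvoo e2; rewrite in_itv/= => /andP[r0 re].
  have h (y : R) : exists2 q : rat, y - ratr r < ratr q & ratr q < y + ratr r.
    have yr : y - ratr r < y + ratr r by rewrite ltrD2l gtrN.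
    by have [q] := rat_in_itvoo yr; rewrite in_itv/= => /andP[? ?]; exists q.
  have [q1 q1l q1r] := h x.1; have [q2 q2l q2r] := h x.2.
  exists (q1, q2, r) => //; case: asboolP => [_|].
    by split; rewrite /= in_itv/=; apply/andP; split; lra.
  move=> H; exfalso; apply: H => y [/=]; rewrite !in_itv/= => /andP[a1 a2] /andP[a3 a4].
  by apply: eO; split => /=; rewrite /ball/= ltr_norml; apply/andP; split; lra.
apply: countable_bigcupT_measurable => // i.
case: asboolP => // _; apply: measurableX; exact: measurable_itv.
Qed.

Lemma fst_continuous : continuous (fst : R * R -> R).
Proof. by move=> x; exact: cvg_fst. Qed.

Lemma snd_continuous : continuous (snd : R * R -> R).
Proof. by move=> x; exact: cvg_snd. Qed.

(** The maximum is attained, so a pointwise strict bound leaves a uniform margin. This yields the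
    explicit support bounds of [strip_smooth] and [itv_smooth]. *)
Lemma compact_lt_le (T : topologicalType) (K : set T) (f : T -> R) (a : R) :
  compact K -> continuous f -> (forall x, K x -> f x < a) ->
  exists2 b, b < a & forall x, K x -> f x <= b.
Proof.
move=> cK cf Ka; have [K0|/set0P/negP/negPn/eqP K0] := pselect (K !=set0); last first.
  by exists (a - 1); [lra|move=> x; rewrite K0].
have [c cKc cM] := compact_EVT_max K0 cK (continuous_subspaceT cf).
by exists (f c); [apply: Ka; rewrite inE in cKc|move=> x Kx; apply: cM; rewrite inE].
Qed.

Lemma test_functionP (V : normedModType R) (O : set V) (phi : V -> R) (K : set V) :
  smooth phi -> compact K -> K `<=` O -> (forall x, phi x != 0 -> K x) ->
  test_function O phi.
Proof.
move=> sphi cK KO phiK; have clK := compact_closed (@norm_hausdorff _ V) cK.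
have sub : closure [set x | phi x != 0] `<=` K.
  by rewrite [X in _ `<=` X](closure_id _).1//; apply: closureS => x; exact: phiK.
split => //; last exact: subset_trans KO.
by apply: subclosed_compact cK sub; exact: closed_closure.
Qed.

(** Equivalent to [test_function (strip a)] by [strip_smoothP]; in this form the support condition
    passes to sums, products and derivatives without handling topological closures. *)
Definition strip_smooth (a : R) f := smooth f /\
  exists b B : R, b < a /\ forall x, f x != 0 -> `|x.1| <= b /\ `|x.2| <= B.

Lemma strip_smoothP a f : test_function (strip a) f <-> strip_smooth a f.
Proof.
split=> [[sf cf fO]|[sf [b [B [ba fb]]]]].
  split => //; set K := closure _ in cf fO.
  have c1 : continuous (fun x : R * R => `|x.1|).
    by move=> x; apply: continuous_comp; [exact: fst_continuous|exact: norm_continuous].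
  have c2 : continuous (fun x : R * R => `|x.2|).
    by move=> x; apply: continuous_comp; [exact: snd_continuous|exact: norm_continuous].
  have [|b ba bK] := compact_lt_le (a := a) cf c1.
    by move=> x /fO[/=]; rewrite in_itv/= ltr_norml.
  have [M [_ MK]] := compact_bounded cf.
  have [|B _ BK] := compact_lt_le (a := `|M| + 2) cf c2.
    move=> x /(MK (`|M| + 1)) h.
    have : `|x| <= `|M| + 1 by apply: h; rewrite (le_lt_trans (ler_norm M))// ltrDl.
    by rewrite prod_normE ge_max => /andP[_]; lra.
  exists b, B; split => // x fx; split; [apply: bK|apply: BK]; exact: subset_closure.
pose K : set (R * R) := `[- b, b]%classic `*` `[- B, B]%classic.
apply: (test_functionP (K := K)) => //.
- by apply: compact_setX; exact: segment_compact.
- by move=> x [/=]; rewrite !in_itv/= => /andP[? ?] _; split => //=; rewrite in_itv/=; apply/andP; split; lra.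
- by move=> x /fb[h1 h2]; split; rewrite /= in_itv/= -ler_norml.
Qed.

Definition itv_smooth (c : R) (f : R -> R) := smooth f /\
  exists b : R, b < c /\ forall x, f x != 0 -> `|x| <= b.

Lemma itv_smoothP (c : R) (f : R -> R) : test_function `](- c), c[%classic f <-> itv_smooth c f.
Proof.
split=> [[sf cf fO]|[sf [b [ba fb]]]].
  split => //.
  have [|b ba bK] := compact_lt_le (a := c) cf (@norm_continuous _ R).
    by move=> x /fO /=; rewrite in_itv/= ltr_norml.
  by exists b; split => // x fx; apply: bK; exact: subset_closure.
apply: (test_functionP (K := `[- b, b]%classic)) => //.
- exact: segment_compact.
- by move=> x /=; rewrite !in_itv/= => /andP[? ?]; apply/andP; split; lra.
- by move=> x /fb; rewrite /= in_itv/= -ler_norml.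
Qed.

End plane_topology.

Section plane_calculus.
Context {R : realType}.
Local Notation plane := (measurableTypeR R * measurableTypeR R)%type.
Implicit Types (f g : R * R -> R) (e v : R * R).

Definition box (B : R) (x : R * R) : R := ((`|x.1| <= B) && (`|x.2| <= B))%:R.

(** Many limits [h -> 0] in inequalities between fixed numbers are taken through this lemma. *)
Lemma ler_small (C D : R) : (forall h, 0 < h -> h <= 1 -> D <= C * h) -> D <= 0.
Proof.
move=> H; rewrite leNgt; apply/negP => D0.
have [C0|C0] := leP C 0.
  by have := H 1 ltr01 (lexx _); rewrite mulr1; lra.
have q0 : 0 < D / (2 * C) by rewrite divr_gt0 ?mulr_gt0.
have := H (Num.min 1 (D / (2 * C))); rewrite lt_min ltr01 q0 ge_min lexx => /(_ isT isT).
apply/negP; rewrite -ltNge (@le_lt_trans _ _ (C * (D / (2 * C))))//.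
  by rewrite ler_pM2l// ge_min lexx orbT.
rewrite (_ : C * (D / (2 * C)) = D / 2); first by lra.
by field; rewrite gt_eqF.
Qed.

Lemma box_ge0 B x : 0 <= box B x.
Proof. exact: ler0n. Qed.

Lemma box_le1 B x : box B x <= 1.
Proof. by rewrite /box; case: (_ && _). Qed.

Lemma pint_box B : pint (box B).
Proof.
pose D : set plane := `[- B, B]%classic `*` `[- B, B]%classic.
have mD : measurable D by apply: measurableX; exact: measurable_itv.
have -> : box B = \1_D.
  apply/funext => x; rewrite /box indicE; congr (nat_of_bool _)%:R.
  apply/idP/idP.
    by move=> /andP[h1 h2]; rewrite inE; split; rewrite /= in_itv/= -ler_norml.
  by rewrite inE => -[]; rewrite /= !in_itv/= -!ler_norml => -> ->.
rewrite pintE; apply/integrableP; split; first by apply/measurable_EFinP; exact: measurable_indic.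
rewrite (eq_integral (fun x => (\1_D x)%:E)); last first.
  by move=> x _ /=; rewrite ger0_norm.
rewrite integral_indic// setIT.
have -> : @leb2 R D = (lebesgue_measure (`[(- B)%R, B]%classic : set R) *
    lebesgue_measure (`[(- B)%R, B]%classic : set R))%E by exact: product_measure1E.
by rewrite lte_mul_pinfty// lebesgue_measure_itv/=; case: ifPn => // _; rewrite -EFinD ltry.
Qed.

Lemma pint_bounded f M B : mes f -> (forall x, `|f x| <= M * box B x) -> pint f.
Proof. by move=> mf fM; apply: (pint_le mf fM); apply: pintZ; exact: pint_box. Qed.

Lemma Int_shift (k : R * R) f : pint f ->
  pint (fun x => f (x + k)) /\ Int (fun x => f (x + k)) = Int f.
Proof.
move=> pf; have [] := @affine2_Int R (1, 1) k f (oner_neq0 _) (oner_neq0 _) pf.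
have -> : (fun x => f (affine2 (1, 1) k x)) = (fun x => f (x + k)).
  by apply/funext => x; rewrite /affine2 /affine_map /= !mul1r.
by rewrite mulr1 normr1 invr1 mul1r.
Qed.

Lemma norm_increment_le (g g' : R -> R) (h M : R) :
  (forall s, is_derive s (1 : R) g (g' s)) -> (forall s, `|s| <= `|h| -> `|g' s| <= M) ->
  `|g h - g 0| <= M * `|h|.
Proof.
move=> dg gM.
have cg : continuous g.
  by move=> x; apply: differentiable_continuous; apply/derivable1_diffP; have [] := dg x.
have [->|h0] := eqVneq h 0; first by rewrite subrr !normr0 mulr0.
have [hp|hn] : 0 < h \/ h < 0 by move: h0; rewrite neq_lt => /orP[]; [right|left].
  have [c] := MVT hp (fun x _ => dg x) (continuous_subspaceT cg).
  rewrite in_itv/= => /andP[c0 ch] ->; rewrite subr0 normrM ler_wpM2r// gM//.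
  by rewrite !gtr0_norm// ltW.
have [c] := MVT hn (fun x _ => dg x) (continuous_subspaceT cg).
rewrite in_itv/= => /andP[ch c0] e; rewrite distrC e sub0r normrM normrN ler_wpM2r// gM//.
by rewrite !ltr0_norm// lerN2 ltW.
Qed.

Lemma is_derive_line f e x t : Ck 1 f ->
  is_derive t (1 : R) (fun s : R => f (x + s *: e)) ('D_e f (x + t *: e)).
Proof.
move=> Cf.
have lL (u s y : R) : x + (u *: s + y) *: e = u *: (s *: e) + (x + y *: e).
  by rewrite scalerDl scalerA addrCA.
have cl : continuous (fun s : R => x + s *: e).
  move=> s; apply: cvgD; first exact: cvg_cst.
  exact: (@scalel_continuous _ _ e).
have := Ck_is_derive t (Ck_comp_affine cl lL Cf).
by rewrite (derive_comp_affine f (1 : R) t lL) scale1r.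
Qed.

Lemma increment_le f e M : Ck 1 f -> (forall x, `|'D_e f x| <= M) ->
  forall x h, `|f (x + h *: e) - f x| <= M * `|h|.
Proof.
move=> Cf fM x h.
have := norm_increment_le (fun s => is_derive_line e x s Cf) (fun s _ => fM (x + s *: e)).
by move=> /(_ h); rewrite scale0r addr0.
Qed.

(** Once the linear part is subtracted, the derivative of [g] is an increment of the first
    derivative, so the mean value bound applies twice. The factor 1/2 of Taylor's formula is given
    up. *)
Lemma second_increment_le f e M : Ck 2 f -> (forall x, `|'D_e ('D_e f) x| <= M) ->
  forall x h, `|f (x + h *: e) - f x - h * 'D_e f x| <= M * h ^+ 2.
Proof.
move=> Cf fM x h.
pose g s := f (x + s *: e) - 'D_e f x * s.
have dg s : is_derive s (1 : R) g ('D_e f (x + s *: e) - 'D_e f x).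
  have := is_derive_line e x s (CkW Cf) => H.
  have := is_deriveB H (is_deriveZ ('D_e f x) (is_derive_id s (1 : R))).
  by rewrite /GRing.scale/= mulr1.
have M0 : 0 <= M by rewrite (le_trans _ (fM x)).
have := norm_increment_le (h := h) (M := M * `|h|) dg.
rewrite /g scale0r mulr0 addr0 subr0 (mulrC _ h) addrAC -mulrA -expr2.
rewrite real_normK ?num_real//; apply => s sh.
have CDf : Ck 1 ('D_e f) by have [_ /(_ e)[_]] := Cf.
by rewrite (le_trans (increment_le CDf fM x s))// ler_wpM2l.
Qed.

Lemma strip_smooth_derive a v f : strip_smooth a f -> strip_smooth a ('D_v f).
Proof.
move=> [sf [b [B [ba fb]]]]; split.
  by move=> k; have [_ /(_ v)[_]] := sf k.+1.
exists b, B; split => // x; apply: contraNP => nb.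
apply/eqP; have [->|v0] := eqVneq v 0; first exact: derive0.
have -> : 'D_v f x = 'D_v (cst 0) x; last exact: derive_cst.
apply: near_eq_derive => //.
(* The support bounds are closed conditions, so where one of them fails [f] vanishes in a whole
   neighbourhood. *)
have H : \forall y \near x, (b < `|y.1|) || (B < `|y.2|).
  have [h|h] := ltP b `|x.1|.
    have : continuous (fun x : R * R => `|x.1|).
      by move=> y; apply: continuous_comp; [exact: fst_continuous|exact: norm_continuous].
    move=> /(_ x) /cvgr_gt /(_ _ h); apply: filterS => y ->//.
  have [h'|h'] := ltP B `|x.2|.
    have : continuous (fun x : R * R => `|x.2|).
      by move=> y; apply: continuous_comp; [exact: snd_continuous|exact: norm_continuous].
    by move=> /(_ x) /cvgr_gt /(_ _ h'); apply: filterS => y ->; rewrite orbT.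
  by exfalso; apply: nb; split.
apply: filterS H => y H; apply/eqP/negPn/negP => /fb[h1 h2].
by move: H; rewrite !ltNge h1 h2.
Qed.

Lemma strip_smooth_bounded a f : strip_smooth a f ->
  exists M B : R, 0 <= M /\ forall x, `|f x| <= M * box B x.
Proof.
move=> [sf [b [B [ba fb]]]]; pose C := Num.max b B.
pose K : set (R * R) := `[- C, C]%classic `*` `[- C, C]%classic.
have cK : compact K by apply: compact_setX; exact: segment_compact.
have cf : continuous (fun x => `|f x|).
  by move=> x; apply: continuous_comp; [exact: (Ck_continuous (sf 0%N))|exact: norm_continuous].
have fC x : f x != 0 -> `|x.1| <= C /\ `|x.2| <= C.
  by move=> /fb[h1 h2]; rewrite /C; split; rewrite le_max ?h1 ?h2 ?orbT.
have [K0|/set0P/negP/negPn/eqP K0] := pselect (K !=set0); last first.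
  exists 0, 0; split => // x; rewrite mul0r normr_le0; apply/negPn/negP => /fC[h1 h2].
  suff : K x by rewrite K0.
  by split; rewrite /= in_itv/= -ler_norml.
have [c _ cM] := compact_EVT_max K0 cK (continuous_subspaceT cf).
exists `|f c|, C; split => // x.
have [->|fx] := eqVneq (f x) 0; first by rewrite normr0 mulr_ge0// box_ge0.
have [h1 h2] := fC x fx; rewrite /box h1 h2 mulr1 cM// inE.
by split; rewrite /= in_itv/= -ler_norml.
Qed.

Lemma strip_smooth_mes a f : strip_smooth a f -> mes f.
Proof. by move=> [sf _]; apply: mes_continuous; exact: Ck_continuous (sf 0%N). Qed.

Lemma strip_smooth_pint a f : strip_smooth a f -> pint f.
Proof.
move=> sf; have [M [B [_ fM]]] := strip_smooth_bounded sf.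
exact: pint_bounded (strip_smooth_mes sf) fM.
Qed.

Lemma le_box B C x : B <= C -> box B x <= box C x.
Proof.
move=> BC; rewrite /box ler_nat; have [h1|//] := leP `|x.1| B; have [h2|//] := leP `|x.2| B.
by rewrite (le_trans h1)// (le_trans h2).
Qed.

Lemma box_shift B C x k : `|k.1| <= C -> `|k.2| <= C -> box B (x + k) <= box (B + C) x.
Proof.
move=> k1 k2; rewrite /box ler_nat /=.
have [h1|//] := leP `|x.1 + k.1| B; have [h2|//] := leP `|x.2 + k.2| B.
have n (u w : R) : `|u| <= `|u + w| + `|w|.
  by rewrite -[u in leLHS](addrK w) (le_trans (ler_normB _ _)).
by rewrite (le_trans (n x.1 k.1)) ?(le_trans (n x.2 k.2))// lerD.
Qed.

Lemma strip_smooth_increments a e f : strip_smooth a f ->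
  exists M B : R, 0 <= M /\ forall h x, `|h| <= 1 ->
    `|f (x + h *: e) - f x| <= M * `|h| * box B x /\
    `|f (x + h *: e) - f x - h * 'D_e f x| <= M * h ^+ 2 * box B x.
Proof.
move=> sf; have sDf := strip_smooth_derive e sf.
have [M0 [B0 [M00 f0]]] := strip_smooth_bounded sf.
have [M1 [B1 [M10 f1]]] := strip_smooth_bounded sDf.
have [M2 [B2 [M20 f2]]] := strip_smooth_bounded (strip_smooth_derive e sDf).
(* For [|h| <= 1] a shift by [h *: e] moves each coordinate by at most [C], so all terms vanish
   outside the square of half-side [B + C]. *)
pose B := Num.max B0 B1; pose C := Num.max `|e.1| `|e.2|.
have supp (h : R) x : `|h| <= 1 -> box (B + C) x = 0 ->
    [/\ f (x + h *: e) = 0, f x = 0 & 'D_e f x = 0].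
  move=> h1 bx.
  have C0 : 0 <= C by rewrite le_max normr_ge0.
  have z D (y : R * R) u N : box D y = 0 -> `|u| <= N * box D y -> u = 0 :> R.
    by move=> ->; rewrite mulr0 normr_le0 => /eqP.
  have bz D : D <= B + C -> box D x = 0.
    by move=> DB; apply/eqP; rewrite eq_le box_ge0 -bx le_box.
  split.
  - apply: (z B0 (x + h *: e) _ M0) => //.
    apply/eqP; rewrite eq_le box_ge0 andbT -bx.
    rewrite (le_trans (box_shift (C := C) _ _ _ _))//=.
    + by rewrite normrM (le_trans (ler_wpM2r _ h1))// mul1r le_max lexx.
    + by rewrite normrM (le_trans (ler_wpM2r _ h1))// mul1r le_max lexx orbT.
    by rewrite le_box// lerD2r le_max lexx.
  - by apply: (z B0 x _ M0) => //; apply: bz; rewrite /B ler_wpDr// le_max lexx.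
  - by apply: (z B1 x _ M1) => //; apply: bz; rewrite /B ler_wpDr// le_max lexx orbT.
have le1 (N D u : R) x : 0 <= N -> `|u| <= N * box D x -> `|u| <= N.
  by move=> N0 /le_trans; apply; rewrite ler_piMr// box_le1.
exists (Num.max M1 M2), (B + C); split; first by rewrite le_max M10.
move=> h x h1; have [bx|bx] := eqVneq (box (B + C) x) 0.
  by have [-> -> ->] := supp h x h1 bx; rewrite bx !mulr0 !subr0 normr0.
have -> : box (B + C) x = 1 by move: bx; rewrite /box; case: (_ && _) => //; rewrite eqxx.
rewrite !mulr1; split.
  rewrite (increment_le (sf.1 1%N))// => y.
  by rewrite (le_trans (le1 _ _ _ _ M10 (f1 y)))// le_max lexx.
rewrite (second_increment_le (sf.1 2%N))// => y.
by rewrite (le_trans (le1 _ _ _ _ M20 (f2 y)))// le_max lexx orbT.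
Qed.

(* Translation invariance makes the integral of every difference quotient of
   [f] vanish. *)
Lemma Int_derive a e f : strip_smooth a f -> Int ('D_e f) = 0.
Proof.
move=> sf; have [M [B [M0 fM]]] := strip_smooth_increments e sf.
have pf := strip_smooth_pint sf.
have pD := strip_smooth_pint (strip_smooth_derive e sf).
have key h : `|h| <= 1 -> `|h * Int ('D_e f)| <= M * h ^+ 2 * Int (box B).
  move=> h1; have [ps es] := Int_shift (h *: e) pf.
  have -> : h * Int ('D_e f) = - Int (fun x => f (x + h *: e) - f x - h * 'D_e f x).
    by rewrite !IntB//; [rewrite IntZ// es subrr sub0r opprK|exact: pintB|exact: pintZ].
  rewrite normrN -IntZ; last exact: pint_box.
  apply: norm_Int_le; [|by apply: pintZ; exact: pint_box|by move=> x; apply: (fM h x h1).2].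
  by apply: pintB; [exact: pintB|exact: pintZ].
apply/eqP; rewrite -normr_le0; apply: (@ler_small (M * Int (box B))) => h h0 h1.
have hn : `|h| <= 1 by rewrite gtr0_norm.
have := key h hn; rewrite normrM gtr0_norm// expr2.
rewrite (_ : M * (h * h) * Int (box B) = h * (M * Int (box B) * h)); last by ring.
by rewrite ler_pM2l.
Qed.

End plane_calculus.

(** * Trigonometric weights for the inner variation *)

Section trigonometric_weights.
Context {R : realType}.
Implicit Types (c x y : R).

Lemma Ck_sin_cos k : Ck k (@sin R) /\ Ck k (@cos R).
Proof.
elim: k => [|k [ihs ihc]].
  by split; split => //; [exact: continuous_sin|exact: continuous_cos].
split; first exact: (Ck_derive1 (fun x : R => is_derive_sin x)).
apply: (Ck_derive1 (fun x : R => is_derive_cos x)).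
by apply: eq_Ck (CkM (Ck_cst k (-1)) ihs) => x; rewrite mulN1r.
Qed.

Lemma smooth_scale (c : R) (f : R -> R) : smooth f -> smooth (fun y => f (c * y)).
Proof.
move=> sf k; apply: (Ck_comp_affine (l := fun y : R => c * y) (L := fun y : R => c * y)) => //.
  by move=> y; apply: cvgM; [exact: cvg_cst|exact: cvg_id].
by move=> t v x; rewrite mulrDr /GRing.scale/= mulrCA.
Qed.

(** The convexity argument wants a weight with values in [0, 1], which excludes an affine one with
    constant nonzero slope. Here the slope is a multiple of cos(c y), which tends to 1 as [c] tends
    to 0. *)
Definition wave c y : R := 1 / 2 + 1 / 2 * sin (c * y).

Lemma smooth_wave c : smooth (wave c).
Proof.
move=> k; apply: CkD; first exact: Ck_cst.
by apply: CkM; [exact: Ck_cst|apply: smooth_scale => n; case: (Ck_sin_cos n)].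
Qed.

Lemma is_derive_scaled c (g : R -> R) y (dg : R) : is_derive (c * y) (1 : R) g dg ->
  is_derive y (1 : R) (fun y => g (c * y)) (dg * c).
Proof.
move=> H; have := is_deriveZ c (is_derive_id y (1 : R)); rewrite /GRing.scale/= mulr1 => Hc.
exact: (is_derive1_comp H Hc).
Qed.

Lemma derive_wave c y : 'D_1 (wave c) y = c / 2 * cos (c * y).
Proof.
have Hs := is_derive_scaled (is_derive_sin (c * y)).
have H := is_deriveD (is_derive_cst (1 / 2 : R) y (1 : R)) (is_deriveZ (1 / 2) Hs).
have -> : 'D_1 (wave c) y = 0 + (1 / 2) *: (cos (c * y) * c) := derive_val.
by rewrite add0r /GRing.scale/=; field.
Qed.

Lemma derive2_wave c y : 'D_1 ('D_1 (wave c)) y = - (c ^+ 2 / 2) * sin (c * y).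
Proof.
have -> : 'D_1 (wave c) = (fun y => c / 2 * cos (c * y)).
  by apply/funext => z; exact: derive_wave.
have Hs := is_derive_scaled (is_derive_cos (c * y)).
have H := is_deriveZ (c / 2) Hs.
have -> : 'D_1 (fun y => c / 2 * cos (c * y)) y = (c / 2) *: (- sin (c * y) * c) := derive_val.
by rewrite /GRing.scale/=; ring.
Qed.

Lemma wave01 c y : 0 <= wave c y <= 1.
Proof. by rewrite /wave; have := sin_geN1 (c * y); have := sin_le1 (c * y); lra. Qed.

Lemma derive_wave_le c y : 0 <= c <= 1 -> `|'D_1 (wave c) y| <= 1.
Proof.
move=> /andP[c0 c1]; rewrite derive_wave normrM.
have h1 : `|c / 2| <= 1 by rewrite ger0_norm ?divr_ge0//; lra.
have h2 : `|cos (c * y)| <= 1 by rewrite ler_norml cos_geN1 cos_le1.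
by rewrite -[leRHS]mulr1 ler_pM.
Qed.

Lemma derive2_wave_le c y : 0 <= c <= 1 -> `|'D_1 ('D_1 (wave c)) y| <= 1.
Proof.
move=> /andP[c0 c1]; rewrite derive2_wave normrM.
have h1 : `|- (c ^+ 2 / 2)| <= 1.
  rewrite normrN ger0_norm ?divr_ge0 ?sqr_ge0//.
  have : c ^+ 2 <= 1 by rewrite expr_le1.
  by lra.
have h2 : `|sin (c * y)| <= 1 by rewrite ler_norml sin_geN1 sin_le1.
by rewrite -[leRHS]mulr1 ler_pM.
Qed.

End trigonometric_weights.

(** * The one-dimensional Poincare inequality with constant [pi_p] *)

HB.lock Definition Int1 (R : realType) (p : R) (f : R -> R) : \bar R :=
  (\int[@lebesgue_measure R]_x (`|f x| `^ p)%:E)%E.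

Section poincare.
Context {R : realType} (p : R) (hp : 1 < p).
Local Notation mu := (@lebesgue_measure R).
Local Notation Int1 := (Int1 p).
Local Notation D1 f := ('D_(1%R : R) f).

Let p0 : 0 < p. Proof. exact: lt_trans hp. Qed.

Lemma Int1_ge0 f : (0 <= Int1 f)%E.
Proof. by rewrite Int1.unlock; apply: integral_ge0 => x _; rewrite lee_fin powR_ge0. Qed.

Lemma Lnorm_Int1 f : ('N[mu]_(p%:E)[EFin \o f] = Int1 f `^ p^-1)%E.
Proof. by rewrite Int1.unlock unlock /Lnorm.body. Qed.

Lemma measurable_powR_norm (f : R -> R) : continuous f ->
  measurable_fun [set: measurableTypeR R] (fun x => (`|f x| `^ p)%:E).
Proof.
move=> cf; apply/measurable_EFinP.
have mf : measurable_fun [set: measurableTypeR R] (fun x => `|f x| : measurableTypeR R).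
  by apply: continuous_measurable_fun => x; apply: continuous_comp; [exact: cf|exact: norm_continuous].
exact: (measurableT_comp (measurable_powR p) mf).
Qed.

Lemma Int1Z (c : R) f : continuous f -> Int1 (fun x => c * f x) = ((`|c| `^ p)%:E * Int1 f)%E.
Proof.
move=> cf; rewrite !Int1.unlock -ge0_integralZl ?lee_fin ?powR_ge0//; last exact: measurable_powR_norm.
by apply: eq_integral => x _; rewrite -EFinM normrM powRM.
Qed.

Lemma Int1_scale (s : R) f : s != 0 -> continuous f ->
  Int1 (fun x => f (s * x)) = ((`|s|^-1)%:E * Int1 f)%E.
Proof.
move=> s0 cf; have n0 : 0 < `|s|^-1 by rewrite invr_gt0 normr_gt0.
rewrite !Int1.unlock -(@ge0_integral_image _ (measurableTypeR R) R mu _ _ _ (measurable_affine s 0) n0 (lebesgue_affine 0 s0)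
  (measurable_powR_norm cf)).
  by apply: eq_integral => x _; rewrite /affine_map addr0.
by move=> x; rewrite lee_fin powR_ge0.
Qed.

Lemma itv_smooth_bounded c (f : R -> R) : itv_smooth c f -> exists M : R, forall x, `|f x| <= M.
Proof.
move=> [sf [b [_ hb]]]; have cf := Ck_continuous (sf 0%N).
have [->|[x0 fx0]] : f = (fun=> 0) \/ exists x, f x != 0.
  have [/existsNP[x /eqP fx]|] := pselect (~ forall x, f x = 0); first by right; exists x.
  by move=> /contrapT h; left; apply/funext.
  by exists 0 => x; rewrite normr0.
have b0 : - b <= b by rewrite lerNl -subr_ge0 opprK; have := le_trans (normr_ge0 _) (hb _ fx0); lra.
have cn : {within `[- b, b], continuous (fun x => `|f x|)}.
  by apply: continuous_subspaceT => x; apply: continuous_comp; [exact: cf|exact: norm_continuous].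
have [z _ hz] := EVT_max b0 cn; exists `|f z| => x.
have [->|nz] := eqVneq (f x) 0; first by rewrite normr0.
by apply: hz; rewrite in_itv/= -ler_norml; exact: hb.
Qed.

Lemma itv_smooth_Int1 c (f : R -> R) : itv_smooth c f ->
  exists2 a : R, 0 <= a & Int1 f = a%:E.
Proof.
move=> sf; suff fin : (Int1 f \is a fin_num)%E.
  by exists (fine (Int1 f)); [apply: fine_ge0; exact: Int1_ge0|rewrite fineK].
have [M hM] := itv_smooth_bounded sf; have [/(_ 0%N)/Ck_continuous cf [b [_ hb]]] := sf.
rewrite ge0_fin_numE; last exact: Int1_ge0.
pose I : set R := `[- b, b]%classic.
have mI : measurable (I : set (measurableTypeR R)) by exact: measurable_itv.
have I1 : (Int1 f <= \int[mu]_(x in I) (M `^ p)%:E)%E.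
  rewrite Int1.unlock [leRHS]integral_mkcond; apply: ge0_le_integral => //.
  - exact: measurable_powR_norm.
  - by apply: (measurable_restrictT _ mI).1; exact: measurable_cst.
  move=> x _; rewrite patchE; case: ifPn => [_|].
    by rewrite lee_fin ge0_ler_powR ?nnegrE ?(ltW p0)//; exact: le_trans (hM x).
  have [->|nz] := eqVneq (f x) 0; first by rewrite normr0 powR0 ?gt_eqF.
  move=> /negP; case; rewrite /I inE /mkset in_itv/= -ler_norml; exact: hb.
apply: (le_lt_trans I1); rewrite integral_cst//= lebesgue_measure_itv/=; case: ifPn => _; last by rewrite mule0.
by rewrite -EFinD -EFinM ltry.
Qed.

Lemma itv_smooth_derive c (f : R -> R) : itv_smooth c f -> itv_smooth c (D1 f).
Proof.
move=> [sf [b [bc hb]]]; split => [k|].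
  by have [_ /(_ 1)[_]] := sf k.+1.
exists b; split => // x; apply: contraNT => xb; apply/eqP; move: xb; rewrite -ltNge => xb.
have e : \forall y \near x, f y = 0.
  have : \forall y \near x, b < `|y| 
    by exact: (@norm_continuous _ R x _ (lt_nbhsr xb)).
  apply: filterS => y by_; apply/eqP; apply: contraTT by_ => /hb.
  by rewrite -leNgt.
have -> : D1 f x = D1 (fun=> 0 : R) x by exact: near_eq_derive.
exact: derive_cst.
Qed.

Lemma patch_itv_smooth c (f : R -> R) : (forall x, f x != 0 -> `|x| < c) ->
  f \_ (`](- c), c[%classic : set R) = f.
Proof.
move=> h; apply/funext => x; rewrite patchE; case: ifPn => // /negP; rewrite inE/= in_itv/= -ltr_norml.
by have [->//|/h ->] := eqVneq (f x) 0.
Qed.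

Definition pi_set : set R := [set t : R | exists phi : R -> R,
    [/\ itv_smooth (1 / 2) phi, Int1 phi = 1%E & (Int1 (D1 phi) `^ p^-1 = t%:E)%E]].

Lemma pi_pE : pi_p p = inf pi_set.
Proof.
rewrite /pi_p; congr inf; apply/seteqP; split => t [phi].
  rewrite /unit_interval => -[/itv_smoothP sphi]; have sd := itv_smooth_derive sphi.
  have -> : phi^`()%classic = D1 phi by apply/funext => x; rewrite derive1E.
  have [[_ [b [b2 hb]]] [_ [b' [b2' hb']]]] := (sphi, sd).
  rewrite !patch_itv_smooth; [|by move=> x /hb' h; exact: le_lt_trans h b2'|by move=> x /hb h; exact: le_lt_trans h b2].
  rewrite !Lnorm_Int1 => h1 h2; exists phi; split => //.
  have [a a0 ea] := itv_smooth_Int1 sphi; move: h1; rewrite ea poweR_EFin => -[] h; congr EFin.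
  by rewrite -[a]powRr1// -[X in a `^ X](@mulVf _ p) ?gt_eqF// powRrM h powR1.
move=> [sphi h1 h2]; have sd := itv_smooth_derive sphi.
exists phi; rewrite /unit_interval; split; first by apply/itv_smoothP.
  have [_ [b [b2 hb]]] := sphi; rewrite patch_itv_smooth ?Lnorm_Int1 ?h1.
    by rewrite -[1%E]/((1 : R)%:E) poweR_EFin powR1.
  by move=> x /hb h; exact: le_lt_trans h b2.
have -> : phi^`()%classic = D1 phi by apply/funext => x; rewrite derive1E.
have [_ [b [b2 hb]]] := sd; rewrite patch_itv_smooth ?Lnorm_Int1 ?h2//.
by move=> x /hb h; exact: le_lt_trans h b2.
Qed.

Lemma pi_set_ge0 t : pi_set t -> 0 <= t.
Proof. by move=> [phi [_ _ h]]; rewrite -lee_fin -h poweR_ge0. Qed.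

Lemma pi_p_ge0 : 0 <= pi_p p.
Proof.
rewrite pi_pE; have [->|/set0P n0] := eqVneq pi_set set0; first by rewrite inf0.
by apply: lb_le_inf => // t; exact: pi_set_ge0.
Qed.

Lemma poincare_unit (f : R -> R) : itv_smooth (1 / 2) f ->
  ((pi_p p `^ p)%:E * Int1 f <= Int1 (D1 f))%E.
Proof.
move=> sf; have sd := itv_smooth_derive sf.
have [[sf0 sf1] [sd0 _]] := (sf, sd).
have [a a0 ea] := itv_smooth_Int1 sf; have [b b0 eb] := itv_smooth_Int1 sd.
rewrite ea eb -EFinM lee_fin.
have [->|an0] := eqVneq a 0; first by rewrite mulr0.
have ap : 0 < a by rewrite lt_neqAle eq_sym an0.
(* This factor gives [c * f] unit norm, which makes it a competitor in the infimum; the case [a = 0]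
   has just been removed. *)
pose c := a `^ - p^-1; have c0 : 0 < c by rewrite powR_gt0.
have cp : c `^ p = a^-1 by rewrite -powRrM mulNr mulVf ?gt_eqF// powR_inv1.
have dc x : D1 (fun x => c * f x) x = c * D1 f x.
  by rewrite (_ : (fun x => c * f x) = c *: f)// deriveZ//; have [_ /(_ 1)[]] := sf0 1%N.
have : pi_p p <= (b / a) `^ p^-1.
  rewrite pi_pE; apply: ge_inf; first by exists 0 => t; exact: pi_set_ge0.
  exists (fun x => c * f x); split.
  - split; first by move=> k; apply: CkM; [exact: Ck_cst|exact: sf0].
    have [B [B2 hB]] := sf1; exists B; split => // x; rewrite mulf_eq0 negb_or => /andP[_ /hB].
    by [].
  - rewrite Int1Z; last exact: Ck_continuous (sf0 0%N).
    rewrite ea gtr0_norm// cp -EFinM mulVf//.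
  rewrite (_ : D1 _ = fun x => c * D1 f x); last by apply/funext.
  rewrite Int1Z; last exact: Ck_continuous (sd0 0%N).
  by rewrite eb gtr0_norm// cp -EFinM poweR_EFin mulrC.
move=> h; rewrite -ler_pdivlMr//.
have ba : 0 <= b / a by rewrite divr_ge0.
rewrite -[leRHS]powRr1// -[X in (b / a) `^ X](@mulVf _ p) ?gt_eqF// powRrM.
by rewrite ge0_ler_powR ?nnegrE ?powR_ge0 ?pi_p_ge0 ?(ltW p0).
Qed.

Lemma derive_scale1 (s : R) (f : R -> R) : smooth f ->
  forall x, D1 (fun x => f (s * x)) x = s * D1 f (s * x).
Proof.
move=> sf; have lin (t v y : R) : s * (t *: v + y) = t *: (s * v) + s * y.
  by rewrite mulrDr /GRing.scale/= mulrCA.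
move=> x; rewrite (@derive_comp_affine _ _ _ (fun x : R => s * x) (fun x : R => s * x))//.
by rewrite mulr1 (derive_real s _).2//; have [_ /(_ 1)[]] := sf 1%N.
Qed.

Lemma itv_smooth_scale (s c : R) (f : R -> R) : 0 < s ->
  itv_smooth c f -> itv_smooth (c / s) (fun x => f (s * x)).
Proof.
move=> s0 [sf [b [bc hb]]]; split; first exact: smooth_scale.
exists (b / s); split; first by rewrite ltr_pM2r// invr_gt0.
by move=> x /hb; rewrite normrM gtr0_norm// ler_pdivlMr// mulrC.
Qed.

Lemma poincare_itv (a : R) (f : R -> R) : 0 < a -> itv_smooth a f ->
  (((pi_p p / (2 * a)) `^ p)%:E * Int1 f <= Int1 (D1 f))%E.
Proof.
move=> a0 sf; have sd := itv_smooth_derive sf.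
have s0 : 0 < 2 * a by lra.
(* The function [x |-> f (2 * a * x)] lives on the unit interval. Its derivative gains the factor
   [2 * a], while the Jacobian is the same on both sides of the inequality. *)
have sg := itv_smooth_scale s0 sf.
rewrite (_ : a / (2 * a) = 1 / 2) in sg; last by field; rewrite gt_eqF.
have := poincare_unit sg.
rewrite (_ : D1 _ = fun x => (2 * a) * D1 f (2 * a * x)); last first.
  by apply/funext => x; rewrite (derive_scale1 _ sf.1).
have cf := Ck_continuous (sf.1 0%N); have cd := Ck_continuous (sd.1 0%N).
rewrite (Int1Z (2 * a) (f := fun x => D1 f (2 * a * x))); last first.
  have cl : continuous (fun x : R => 2 * a * x) by move=> x; apply: cvgM; [exact: cvg_cst|exact: cvg_id].
  by move=> x; exact: (@continuous_comp _ _ _ (fun x : R => 2 * a * x) (D1 f) x (cl x) (cd _)).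
have sn : 2 * a != 0 by rewrite gt_eqF.
rewrite (Int1_scale sn cf) (Int1_scale sn cd).
have [b b0 eb] := itv_smooth_Int1 sf; have [c c0 ec] := itv_smooth_Int1 sd.
rewrite eb ec -!EFinM !lee_fin.
rewrite gtr0_norm// [leLHS]mulrCA [leRHS]mulrCA ler_pM2l ?invr_gt0// => h.
rewrite powRM ?pi_p_ge0 ?invr_ge0 ?(ltW s0)// -mulrA mulrCA.
rewrite -powR_inv1 ?(ltW s0)// -powRrM mulN1r powRN ler_pdivrMl ?powR_gt0//.
Qed.

End poincare.

(** * Smooth steps and cutoffs *)

Section smooth_step.
Context {R : realType}.
Implicit Types (x y : R).

(** The powers of [x^-1] are included so that the linear span of the family is closed under
    differentiation; smoothness then follows by induction for all [n] at once. *)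
Definition flat (n : nat) x : R := if 0 < x then x ^- n * expR (- x^-1) else 0.

Lemma flat_ge0 n x : 0 <= flat n x.
Proof. by rewrite /flat; case: ifPn => // x0; rewrite mulr_ge0 ?expR_ge0// invr_ge0 exprn_ge0// ltW. Qed.

(** This is exp(y) >= y^(n+1) / (n+1)! at y = 1/x. Since [h^-1 * flat n h = flat n.+1 h] for
    [h > 0], the linear bound at rank [n.+1] gives the zero derivative of [flat n] at the origin. *)
Lemma flat_le n x : 0 <= x -> flat n x <= n.+1`!%:R * x.
Proof.
rewrite /flat => x0; case: ifPn => [xp|_]; last by rewrite mulr_ge0.
have xi : 0 <= x^-1 by rewrite invr_ge0.
have f0 : 0 < n.+1`!%:R :> R by rewrite ltr0n fact_gt0.
have := expR_ge1Dxn n xi => h.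
have {h} : x^-1 ^+ n.+1 / n.+1`!%:R <= expR x^-1 by apply: le_trans h; rewrite lerDr.
rewrite ler_pdivrMr// => h; rewrite expRN ler_pdivrMr ?expR_gt0// -exprVn.
have -> : x^-1 ^+ n = x * x^-1 ^+ n.+1 by rewrite exprS mulrA mulfV ?mul1r// gt_eqF.
by rewrite mulrC [leRHS]mulrAC ler_pM2r// mulrC.
Qed.

Lemma is_derive_flat n x :
  is_derive x (1 : R) (flat n) (- n%:R * flat n.+1 x + flat n.+2 x).
Proof.
have [xp|xn|<-] := ltgtP 0 x.
- have xn0 : x != 0 by rewrite gt_eqF.
  have e : \forall y \near x, y^-1 ^+ n * expR (- y^-1) = flat n y.
    have : \forall y \near x, 0 < y by exact: lt_nbhsr.
    by apply: filterS => y y0; rewrite /flat y0 exprVn.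
  have dV := @is_deriveV _ _ x 1 1 xn0 (is_derive_id x (1 : R)).
  have dN : is_derive x (1 : R) (fun y => - y^-1) (- (- x ^- 2)%:A) by exact: is_deriveN.
  have dE := @is_derive1_comp R expR (fun y => - y^-1) x _ _ (is_derive_expR (- x^-1)) dN.
  have := is_deriveX n dV; rewrite exprfctE => dX.
  have dM := is_deriveM dX dE.
  apply: (near_eq_is_derive e); apply: is_derive_eq dM _; rewrite /flat xp /GRing.scale/= -!exprVn.
  case: n {e dX} => [|n]; first by rewrite !expr0; ring.
  by move: (x^-1) (expR _) (n.+1%:R) => a E N; rewrite /= !exprS; ring.
- have xle : (0 < x) = false by apply/negbTE; rewrite -leNgt ltW.
  have e : \forall y \near x, 0 = flat n y.
    have : \forall y \near x, y < 0 by exact: lt_nbhsl.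
    by apply: filterS => y y0; rewrite /flat ltNge (ltW y0).
  rewrite /flat xle mulr0 addr0.
  exact: (near_eq_is_derive e).
have f0 m : flat m 0 = 0 by rewrite /flat ltxx.
rewrite !f0 mulr0 addr0.
have L : h^-1 *: ((flat n \o shift 0) (h *: (1 : R)) - flat n 0) @[h --> (0 : R)^'] --> (0 : R).
  apply/cvgrPdist_le => e e0.
  have C0 : 0 < n.+2`!%:R :> R by rewrite ltr0n fact_gt0.
  have ed : 0 < e / n.+2`!%:R by rewrite divr_gt0.
  have N : \forall h \near (0 : R)^', `|h| <= e / n.+2`!%:R.
    by apply: dnbhs0_le.
  near=> h; rewrite sub0r normrN f0 subr0 /= addr0 /GRing.scale/= mulr1.
  have [hp|hn|<-] := ltgtP 0 h.
  - have -> : h^-1 * flat n h = flat n.+1 h by rewrite /flat hp exprS invfM mulrA.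
    rewrite ger0_norm ?flat_ge0//; apply: (le_trans (flat_le _ (ltW hp))).
    rewrite mulrC -ler_pdivlMr// -[h]ger0_norm ?(ltW hp)//.
    by near: h.
  - by rewrite /flat ltNge (ltW hn)/= mulr0 normr0 ltW.
  - by rewrite f0 mulr0 normr0 ltW.
split; first by apply/cvg_ex; exists 0.
exact: cvg_lim L.
Unshelve. all: by end_near. Qed.

Lemma smooth_flat n : smooth (flat n).
Proof.
move=> k; elim: k n => [|k ih] n.
  split => // x; apply: differentiable_continuous; apply/derivable1_diffP.
  by have [] := is_derive_flat n x.
apply: Ck_derive1 (is_derive_flat n) _.
by apply: CkD; [apply: CkM; [exact: Ck_cst|exact: ih]|exact: ih].
Qed.

Lemma Ck_inv {V : normedModType R} k (f : V -> R) :
  (forall x : V, f x != 0) -> Ck k f -> Ck k (fun x : V => (f x)^-1).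
Proof.
move=> f0; elim: k => [|k ih] Cf.
  by split => // x; apply: cvgV => //; exact: (Ck_continuous Cf).
have [cf Df] := Cf; split; first by move=> x; apply: cvgV => //; exact: cf.
move=> v; have [d c] := Df v; split => [x|]; first exact: derivableV.
have Ci := ih (CkW Cf).
apply: eq_Ck (CkM (Ck_cst k (-1)) (CkM (CkM Ci Ci) c)) => x.
by rewrite deriveV// mulN1r /GRing.scale/= expr2 invfM mulNr.
Qed.

Definition step x : R := flat 0 x / (flat 0 x + flat 0 (1 - x)).

Lemma flat0_gt0 x : 0 < x -> 0 < flat 0 x.
Proof. by rewrite /flat => ->; rewrite expr0 invr1 mul1r expR_gt0. Qed.

Lemma flat_le0 n x : x <= 0 -> flat n x = 0.
Proof. by rewrite /flat ltNge => ->. Qed.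

Let step_den x : 0 < flat 0 x + flat 0 (1 - x).
Proof.
have [x0|x0] := ltP 0 x; first by rewrite ltr_pwDl ?flat_ge0 ?flat0_gt0.
by rewrite ltr_wpDl ?flat_ge0// flat0_gt0; lra.
Qed.

Lemma smooth_step : smooth step.
Proof.
move=> k; have C1 := smooth_flat 0 k.
have C2 : Ck k (fun x => flat 0 (1 - x)).
  apply: (@Ck_comp_affine _ _ _ (fun x => 1 - x) (fun x => - x)) C1.
    by move=> x; apply: cvgB; [exact: cvg_cst|exact: cvg_id].
  by move=> t v x; rewrite opprD addrCA scalerN.
by apply: CkM => //; apply: Ck_inv; [move=> x; rewrite gt_eqF|exact: CkD].
Qed.

Lemma step_le0 x : x <= 0 -> step x = 0.
Proof. by move=> x0; rewrite /step flat_le0// mul0r. Qed.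

Lemma step_ge1 x : 1 <= x -> step x = 1.
Proof.
move=> x1; rewrite /step [flat 0 (1 - x)]flat_le0 ?subr_le0// addr0 mulfV// gt_eqF// flat0_gt0//.
exact: lt_le_trans x1.
Qed.

Lemma step01 x : 0 <= step x <= 1.
Proof.
rewrite /step divr_ge0 ?flat_ge0 ?(ltW (step_den x))//=.
by rewrite ler_pdivrMr// mul1r lerDl flat_ge0.
Qed.

End smooth_step.

Section plateau.
Context {R : realType}.
Implicit Types (a b y : R).
Local Notation D1 f := ('D_(1%R : R) f).

Lemma derive_near_cst {V : normedModType R} (f : V -> R) (c : R) (x v : V) :
  (\forall y \near x, f y = c) -> 'D_v f x = 0.
Proof.
move=> e; have -> : 'D_v f x = 'D_v (fun=> c) x by exact: near_eq_derive.
exact: derive_cst.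
Qed.

Lemma derive_step_le : exists2 M : R, 0 < M & forall y, `|D1 step y| <= M.
Proof.
have cd : continuous (D1 (@step R)) by have [_ /(_ 1)[_ []]] := @smooth_step R 1%N.
have cn : {within `[0 : R, 1], continuous (fun x => `|D1 step x|)}.
  apply: continuous_subspaceT => x.
  exact: (@continuous_comp _ _ _ (D1 step) (fun z : R => `|z|) x (cd x) (@norm_continuous _ R _)).
have [z _ hz] := EVT_max (@ler01 R) cn.
exists (`|D1 step z| + 1) => [|y]; first by rewrite ltr_wpDl.
have z0 : 0 <= `|D1 step z| + 1 by rewrite addr_ge0.
have [y0|y0] := ltP y 0.
  rewrite (@derive_near_cst _ _ 0) ?normr0//.
  have : \forall t \near y, t < 0 by exact: lt_nbhsl.
  by apply: filterS => t t0; rewrite step_le0// ltW.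
have [y1|y1] := ltP 1 y.
  rewrite (@derive_near_cst _ _ 1) ?normr0//.
  have : \forall t \near y, 1 < t by exact: lt_nbhsr.
  by apply: filterS => t t0; rewrite step_ge1// ltW.
by apply: (le_trans (hz y _)); rewrite ?lerDl// in_itv/= y0.
Qed.

(** A rising and a falling step, each of width [d]. The slope is at most a constant over [d],
    whatever [a] and [b] are, even when the two transitions overlap. *)
Definition plateau a b (d : R) y : R := step (d^-1 * (y - a)) * step (d^-1 * (b - y)).

Section bounds.
Context (a b d : R) (d0 : 0 < d).

Let smooth_affine_step (s h : R) : smooth (fun y => step (s * y + h)).
Proof.
move=> k; apply: (@Ck_comp_affine _ _ _ (fun y => s * y + h) (fun y => s * y)).
- by move=> y; apply: cvgD; [apply: cvgM; [exact: cvg_cst|exact: cvg_id]|exact: cvg_cst].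
- by move=> t v y; rewrite mulrDr -addrA /GRing.scale/= mulrCA.
- exact: smooth_step.
Qed.

Let derive_affine_step (s h y : R) : derivable (fun y => step (s * y + h)) y 1 /\
  D1 (fun y => step (s * y + h)) y = s * D1 step (s * y + h).
Proof.
split; first by have [_ /(_ 1)[]] := smooth_affine_step s h 1%N.
rewrite (@derive_comp_affine _ _ _ (fun y => s * y + h) (fun y => s * y)).
  by rewrite mulr1 (derive_real s _).2//; have [_ /(_ 1)[]] := @smooth_step R 1%N.
by move=> t v z; rewrite mulrDr -addrA /GRing.scale/= mulrCA.
Qed.

Let plateauE : plateau a b d =
  fun y => step (d^-1 * y + - (d^-1 * a)) * step (- d^-1 * y + d^-1 * b).
Proof.
apply/funext => y; rewrite /plateau; congr (step _ * step _); ring.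
Qed.

Lemma smooth_plateau : smooth (plateau a b d).
Proof. by rewrite plateauE => k; apply: CkM; exact: smooth_affine_step. Qed.

Lemma plateau01 y : 0 <= plateau a b d y <= 1.
Proof.
have /andP[h1 h2] := step01 (d^-1 * (y - a)); have /andP[h3 h4] := step01 (d^-1 * (b - y)).
by rewrite /plateau mulr_ge0//= -[leRHS]mulr1 ler_pM.
Qed.

Lemma derive_plateau_le (M : R) y : (forall z, `|D1 step z| <= M) ->
  `|D1 (plateau a b d) y| <= 2 * M / d.
Proof.
move=> hM; have di : 0 < d^-1 by rewrite invr_gt0.
have M0 : 0 <= M := le_trans (normr_ge0 _) (hM 0).
have [e1 D1'] := derive_affine_step d^-1 (- (d^-1 * a)) y.
have [e2 D2'] := derive_affine_step (- d^-1) (d^-1 * b) y.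
have s1 z : `|step z : R| <= 1 by have /andP[z0 z1] := step01 z; rewrite ger0_norm.
rewrite plateauE (derive_mul e1 e2) D1' D2'.
rewrite (_ : 2 * M / d = 1 * (d^-1 * M) + 1 * (d^-1 * M)); last by ring.
have bd u v s : `|s| = d^-1 -> `|u| <= 1 -> `|v| <= M -> `|u * (s * v)| <= 1 * (d^-1 * M).
  move=> hs hu hv; rewrite !normrM hs; apply: ler_pM => //; first exact: mulr_ge0 (ltW di) (normr_ge0 _).
  by apply: ler_wpM2l; [exact: ltW|].
apply: (le_trans (ler_normD _ _)); apply: lerD; apply: bd; rewrite ?normrN ?(gtr0_norm di)//.
Qed.

Lemma plateau_out y : y <= a \/ b <= y -> plateau a b d y = 0.
Proof.
have di : 0 <= d^-1 by rewrite invr_ge0 ltW.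
by move=> [h|h]; rewrite /plateau; [rewrite step_le0 ?mul0r//|rewrite mulrC step_le0 ?mul0r//];
   rewrite mulr_ge0_le0// subr_le0.
Qed.

Lemma plateau_in y : a + d <= y <= b - d -> plateau a b d y = 1.
Proof.
move=> /andP[h1 h2]; rewrite /plateau !step_ge1 ?mulr1//.
  by rewrite ler_pdivlMl// mulr1; lra.
by rewrite ler_pdivlMl// mulr1; lra.
Qed.

Lemma derive_plateau_out y : y < a \/ b < y -> D1 (plateau a b d) y = 0.
Proof.
move=> h; apply: (derive_near_cst (c := 0)); case: h => h.
  have : \forall t \near y, t < a by exact: lt_nbhsl.
  by apply: filterS => t /ltW ta; rewrite plateau_out//; left.
have : \forall t \near y, b < t by exact: lt_nbhsr.
by apply: filterS => t /ltW ta; rewrite plateau_out//; right.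
Qed.

Lemma derive_plateau_in y : a + d < y < b - d -> D1 (plateau a b d) y = 0.
Proof.
move=> /andP[h1 h2]; apply: (derive_near_cst (c := 1)).
have n1 : \forall t \near y, a + d < t by exact: lt_nbhsr.
have n2 : \forall t \near y, t < b - d by exact: lt_nbhsl.
by apply: filterS2 n1 n2 => t /ltW ta /ltW tb; rewrite plateau_in// ta.
Qed.

End bounds.
End plateau.

(** * Fields in L^p and the space W^{1,p}_0 of the strip *)

Section mes_lemmas.
Context {R : realType}.
Implicit Types (f g : R * R -> R) (a b : R * R -> R * R).

Lemma mes_cst (c : R) : mes (fun=> c).
Proof. exact: measurable_cst. Qed.

Lemma mesD f g : mes f -> mes g -> mes (fun x => f x + g x).
Proof. exact: measurable_funD. Qed.

Lemma mesM f g : mes f -> mes g -> mes (fun x => f x * g x).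
Proof. exact: measurable_funM. Qed.

Lemma mesB f g : mes f -> mes g -> mes (fun x => f x - g x).
Proof. exact: measurable_funB. Qed.

Lemma mesN f : mes f -> mes (fun x => - f x).
Proof. by move=> mf; have := mesB (mes_cst 0) mf; under eq_fun do rewrite sub0r. Qed.

Lemma mes_powR (s : R) f : mes f -> mes (fun x => f x `^ s).
Proof. by move=> mf; apply: (measurableT_comp (measurable_powR s) mf). Qed.

Definition mesv a := mes (fun x => (a x).1) /\ mes (fun x => (a x).2).

Lemma mes_dot a b : mesv a -> mesv b -> mes (fun x => dot (a x) (b x)).
Proof. by move=> [a1 a2] [b1 b2]; apply: mesD; exact: mesM. Qed.

Lemma mes_enorm a : mesv a -> mes (fun x => enorm (a x)).
Proof.
move=> ma; rewrite (_ : (fun x => _) = fun x => (dot (a x) (a x)) `^ 2^-1).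
  by apply: mes_powR; exact: mes_dot.
by apply/funext => x; rewrite powR12_sqrt// dot_ge0.
Qed.

Lemma mesvD a b : mesv a -> mesv b -> mesv (fun x => a x + b x).
Proof. by move=> [a1 a2] [b1 b2]; split; exact: mesD. Qed.

Lemma mesvZ f a : mes f -> mesv a -> mesv (fun x => f x *: a x).
Proof. by move=> mf [a1 a2]; split; exact: mesM. Qed.

Lemma mesv_pfield p a : mesv a -> mesv (fun x => pfield p (a x)).
Proof. by move=> ma; apply: mesvZ => //; apply: mes_powR; exact: mes_enorm. Qed.

Lemma mes_shift (k : R * R) f : mes f -> mes (fun x => f (x + k)).
Proof.
move=> mf; have := measurableT_comp mf (@measurable_affine2 R (1, 1) k).
have -> : f \o affine2 (1, 1) k = (fun x => f (x + k)) => //.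
by apply/funext => x /=; rewrite /affine2 /affine_map /= !mul1r.
Qed.

End mes_lemmas.

(** The p-th power of the norm is kept without taking the root: it is additive over disjoint
    supports, and the convexity inequalities apply to it directly. *)
HB.lock Definition Lpint (R : realType) (p : R) (a : R * R -> R * R) : R :=
  Int (fun x => enorm (a x) `^ p).

(** On gradients this is the functional of the p-Laplacian, on fields [scalar_field u] that of
    |u|^(p-2) u; each estimate thus serves both. *)
HB.lock Definition pairing (R : realType) (p : R) (a b : R * R -> R * R) : R :=
  Int (fun x => dot (pfield p (a x)) (b x)).

(** A majorant of the absolute value of [pairing] in which the two fields enter through their moduli
    only, so that it inherits the pointwise bounds [young] and [pfield_continuity]. *)
HB.lock Definition npairing (R : realType) (p : R) (a b : R * R -> R * R) : R :=
  Int (fun x => enorm (a x) `^ (p - 1) * enorm (b x)).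

Section Lp_fields.
Context {R : realType} (p : R) (hp : 1 < p).
Implicit Types (f g : R * R -> R) (a b c : R * R -> R * R).
Local Notation V := (pfield p).

Let p0 : 0 < p. Proof. exact: lt_trans hp. Qed.
Let p0' : 0 <= p. Proof. exact: ltW. Qed.
Let p10 : 0 < p - 1. Proof. by rewrite subr_gt0. Qed.

Definition Lpv a := mesv a /\ pint (fun x => enorm (a x) `^ p).
Local Notation Lpint := (Lpint p).
Local Notation pairing := (pairing p).
Local Notation npairing := (npairing p).

Lemma mes_enormp a (s : R) : mesv a -> mes (fun x => enorm (a x) `^ s).
Proof. by move=> ma; apply: mes_powR; exact: mes_enorm. Qed.

Lemma Lpint_ge0 a : 0 <= Lpint a.
Proof. by rewrite Lpint.unlock; apply: Int_ge0 => x; exact: powR_ge0. Qed.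

Lemma Lpv_le a b (k : R) : mesv a -> Lpv b -> 0 <= k -> (forall x, enorm (a x) <= k * enorm (b x)) ->
  Lpv a /\ Lpint a <= k `^ p * Lpint b.
Proof.
move=> ma [mb pb] k0 ab.
have le x : enorm (a x) `^ p <= k `^ p * enorm (b x) `^ p.
  by rewrite -powRM ?enorm_ge0// ge0_ler_powR ?nnegrE ?mulr_ge0 ?enorm_ge0.
have pk := pintZ (k `^ p) pb.
have pa : pint (fun x => enorm (a x) `^ p).
  by apply: (pint_le (mes_enormp p ma) _ pk) => x; rewrite ger0_norm ?powR_ge0.
by split => //; rewrite !Lpint.unlock -IntZ//; exact: le_Int.
Qed.

Lemma LpvZ (f : R * R -> R) a (k : R) : mes f -> Lpv a -> (forall x, `|f x| <= k) ->
  Lpv (fun x => f x *: a x) /\ Lpint (fun x => f x *: a x) <= k `^ p * Lpint a.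
Proof.
move=> mf La fk; apply: Lpv_le => //; first by apply: mesvZ => //; case: La.
  by rewrite (le_trans _ (fk 0)).
by move=> x; rewrite enormZ ler_wpM2r ?enorm_ge0.
Qed.

Lemma LpvZc (k : R) a : Lpv a -> Lpv (fun x => k *: a x).
Proof. by move=> La; apply: (LpvZ (k := `|k|) (mes_cst k) La _).1. Qed.

Lemma LpintZc (k : R) a : Lpv a -> Lpint (fun x => k *: a x) = `|k| `^ p * Lpint a.
Proof.
move=> [_ pa]; rewrite !Lpint.unlock -IntZ//; congr Int; apply/funext => x.
by rewrite enormZ powRM ?enorm_ge0.
Qed.

Lemma LpvD_le (r : R) a b : 0 < r -> Lpv a -> Lpv b ->
  Lpv (fun x => a x + b x) /\
  Lpint (fun x => a x + b x) <= (1 + r) `^ p * Lpint a + (1 + r^-1) `^ p * Lpint b.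
Proof.
move=> r0 [ma pa] [mb pb]; have mab := mesvD ma mb.
have pk := pintD (pintZ ((1 + r) `^ p) pa) (pintZ ((1 + r^-1) `^ p) pb).
have pab : pint (fun x => enorm (a x + b x) `^ p).
  apply: (pint_le (mes_enormp p mab) _ pk) => x; rewrite ger0_norm ?powR_ge0//.
  exact: enorm_powRD.
split => //; rewrite !Lpint.unlock -!IntZ// -IntD//; try exact: pintZ.
by apply: le_Int => // x; exact: enorm_powRD.
Qed.

Lemma LpvD a b : Lpv a -> Lpv b -> Lpv (fun x => a x + b x).
Proof. by move=> La Lb; case: (LpvD_le ltr01 La Lb). Qed.

Lemma LpvN a : Lpv a -> Lpv (fun x => - a x).
Proof. by move=> /(LpvZc (-1)); under eq_fun do rewrite scaleN1r. Qed.

Lemma LpintN a : Lpint (fun x => - a x) = Lpint a.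
Proof. by rewrite !Lpint.unlock; congr Int; apply/funext => x; rewrite enormN. Qed.

Lemma LpvB a b : Lpv a -> Lpv b -> Lpv (fun x => a x - b x).
Proof. by move=> La Lb; exact: (LpvD La (LpvN Lb)). Qed.

Lemma LpintD_le2 a b : Lpv a -> Lpv b ->
  Lpint (fun x => a x + b x) <= 2 `^ p * (Lpint a + Lpint b).
Proof.
by move=> La Lb; have [_] := LpvD_le ltr01 La Lb; rewrite invr1 -mulrDr.
Qed.

Lemma Lpv_shift (k : R * R) a : Lpv a ->
  Lpv (fun x => a (x + k)) /\ Lpint (fun x => a (x + k)) = Lpint a.
Proof.
move=> [[m1 m2] pa]; have [ps es] := Int_shift k pa.
split; last by rewrite !Lpint.unlock; exact: es.
split; last exact: ps.
by split; [exact: (mes_shift k m1)|exact: (mes_shift k m2)].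
Qed.

Lemma Lpv_sum n (F : 'I_n -> R * R -> R * R) :
  (forall i, Lpv (F i)) -> Lpv (fun x => \sum_i F i x).
Proof.
elim: n F => [|n ih] F LF.
  rewrite (_ : (fun x => _) = fun=> 0); last by apply/funext => x; rewrite big_ord0.
  split; first by split; exact: mes_cst.
  by rewrite enorm0 powR0 ?gt_eqF//; exact: pint0.
rewrite (_ : (fun x => _) = (fun x => F ord0 x + \sum_(i < n) F (lift ord0 i) x)).
  by apply: LpvD => //; exact: ih.
by apply/funext => x; rewrite big_ord_recl.
Qed.

Lemma Lpint_sum n (F : 'I_n -> R * R -> R * R) : (forall i, Lpv (F i)) ->
  Lpint (fun x => \sum_i F i x) <= n%:R `^ (p - 1) * \sum_i Lpint (F i).
Proof.
move=> LF; have pF : forall i, pint (fun x => enorm (F i x) `^ p) by move=> i; case: (LF i).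
rewrite !Lpint.unlock -Int_sum// -IntZ; last exact: pint_sum.
apply: le_Int; [by case: (Lpv_sum LF)|by apply: pintZ; exact: pint_sum|].
by move=> x; exact: enorm_powR_sum.
Qed.

Lemma Lpv_box a (M B : R) : mesv a -> (forall x, enorm (a x) <= M * box B x) -> Lpv a.
Proof.
move=> ma aM; split => //; apply: (@pint_bounded _ _ (`|M| `^ p) B).
  exact: mes_enormp.
move=> x; rewrite ger0_norm ?powR_ge0//.
have M0 : 0 <= M * box B x by rewrite (le_trans _ (aM x)) ?enorm_ge0.
rewrite (@le_trans _ _ ((`|M| * box B x) `^ p))//.
  rewrite ge0_ler_powR ?nnegrE ?mulr_ge0 ?enorm_ge0 ?box_ge0//.
  by rewrite (le_trans (aM x))// ler_wpM2r ?box_ge0 ?ler_norm.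
rewrite /box; case: (_ && _); rewrite ?mulr1//= !mulr0 powR0 ?gt_eqF//.
Qed.

Lemma npairing_le (k : R) a b : 0 < k -> Lpv a -> Lpv b ->
  pint (fun x => enorm (a x) `^ (p - 1) * enorm (b x)) /\
  npairing a b <= k * Lpint a + k `^ (1 - p) * Lpint b.
Proof.
move=> k0 [ma pa] [mb pb].
have pk := pintD (pintZ k pa) (pintZ (k `^ (1 - p)) pb).
have le x : enorm (a x) `^ (p - 1) * enorm (b x) <=
    k * enorm (a x) `^ p + k `^ (1 - p) * enorm (b x) `^ p.
  by apply: young => //; exact: enorm_ge0.
have pab : pint (fun x => enorm (a x) `^ (p - 1) * enorm (b x)).
  apply: (pint_le _ _ pk).
    by apply: mesM; [exact: mes_enormp|exact: mes_enorm].
  by move=> x; rewrite ger0_norm// mulr_ge0 ?powR_ge0 ?enorm_ge0.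
split => //; rewrite npairing.unlock !Lpint.unlock -!IntZ// -IntD//; try exact: pintZ.
exact: le_Int.
Qed.

Lemma pint_npairing a b : Lpv a -> Lpv b ->
  pint (fun x => enorm (a x) `^ (p - 1) * enorm (b x)).
Proof. by move=> La Lb; case: (npairing_le ltr01 La Lb). Qed.

Lemma pint_pairing a b : Lpv a -> Lpv b -> pint (fun x => dot (V (a x)) (b x)).
Proof.
move=> La Lb; apply: (pint_le _ _ (pint_npairing La Lb)).
  by apply: mes_dot; [apply: mesv_pfield; case: La|case: Lb].
by move=> x; rewrite (le_trans (dot_le_enorm _ _))// enorm_pfield.
Qed.

Lemma norm_pairing_le a b : Lpv a -> Lpv b -> `|pairing a b| <= npairing a b.
Proof.
move=> La Lb; rewrite pairing.unlock npairing.unlock.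
apply: norm_Int_le; [exact: pint_pairing|exact: pint_npairing|].
by move=> x; rewrite (le_trans (dot_le_enorm _ _))// enorm_pfield.
Qed.

Lemma pairing_young (k : R) a b : 0 < k -> Lpv a -> Lpv b ->
  `|pairing a b| <= k * Lpint a + k `^ (1 - p) * Lpint b.
Proof.
move=> k0 La Lb; rewrite (le_trans (norm_pairing_le La Lb))//.
by case: (npairing_le k0 La Lb).
Qed.

Lemma pairingD a b c : Lpv a -> Lpv b -> Lpv c ->
  pairing a (fun x => b x + c x) = pairing a b + pairing a c.
Proof.
move=> La Lb Lc; rewrite !pairing.unlock -IntD; try exact: pint_pairing.
by congr Int; apply/funext => x; rewrite dotDr.
Qed.

Lemma pairingZ (k : R) a b : Lpv a -> Lpv b ->
  pairing a (fun x => k *: b x) = k * pairing a b.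
Proof.
move=> La Lb; rewrite !pairing.unlock -IntZ; last exact: pint_pairing.
by congr Int; apply/funext => x; rewrite dotZr.
Qed.

Lemma pairingB a b c : Lpv a -> Lpv b -> Lpv c ->
  pairing a (fun x => b x - c x) = pairing a b - pairing a c.
Proof.
move=> La Lb Lc; rewrite !pairing.unlock -IntB; try exact: pint_pairing.
by congr Int; apply/funext => x; rewrite dotBr.
Qed.

Lemma pairing_self a : pairing a a = Lpint a.
Proof. by rewrite pairing.unlock Lpint.unlock; congr Int; apply/funext => x; rewrite dot_pfield. Qed.

Lemma Lpint_convex a b : Lpv a -> Lpv b ->
  Lpint a + p * pairing a (fun x => b x - a x) <= Lpint b.
Proof.
move=> La Lb; have pP := pint_pairing La (LpvB Lb La).
rewrite pairing.unlock !Lpint.unlock -IntZ// -IntD; [|by case: La|exact: pintZ].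
apply: le_Int; [by apply: pintD; [case: La|exact: pintZ]|by case: Lb|].
by move=> x; exact: enorm_powR_convex.
Qed.

(** [pfield_continuity] is integrated. The constant [C] is chosen before the three fields, which
    makes the first-order estimates uniform over test functions. *)
Lemma pairing_continuity (d : R) : 0 < d -> exists2 C : R, 0 <= C & forall a c b,
  Lpv a -> Lpv c -> Lpv b ->
  `|pairing (fun x => a x + c x) b - pairing a b| <= d * npairing a b + C * npairing c b.
Proof.
move=> d0; have [C C0 hC] := pfield_continuity hp d0; exists C => // a c b La Lc Lb.
have Lac := LpvD La Lc.
rewrite !pairing.unlock -IntB; try exact: pint_pairing.
rewrite !npairing.unlock -!IntZ -?IntD; try (by apply: pintZ; exact: pint_npairing); try exact: pint_npairing.
apply: norm_Int_le.
- by apply: pintB; exact: pint_pairing.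
- by apply: pintD; apply: pintZ; exact: pint_npairing.
move=> x; rewrite -dotBl (le_trans (dot_le_enorm _ _))// !mulrA -mulrDl.
by rewrite ler_wpM2r ?enorm_ge0.
Qed.

End Lp_fields.

Definition scalar_field (R : realType) (f : R * R -> R) (x : R * R) : R * R := (f x, 0).

Section strip_bridge.
Context {R : realType} (alpha p : R) (hp : 1 < p).
Local Notation plane := (measurableTypeR R * measurableTypeR R)%type.
Local Notation Omega := (strip alpha).
Local Notation sc := scalar_field.
Implicit Types (f u : R * R -> R) (g : R * R -> R * R).

Let p0 : 0 < p. Proof. exact: lt_trans hp. Qed.

Definition on_strip f : R * R -> R := f \_ Omega.
Definition on_stripv g x : R * R := (on_strip (fun x => (g x).1) x, on_strip (fun x => (g x).2) x).

Lemma mem_strip (x : R * R) : (x \in Omega) = (`|x.1| < alpha).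
Proof.
apply/idP/idP.
  by rewrite inE => -[/= + _]; rewrite in_itv/= ltr_norml.
by move=> h; rewrite inE; split => //=; rewrite in_itv/= -ltr_norml.
Qed.

Lemma on_stripE f x : on_strip f x = if `|x.1| < alpha then f x else 0.
Proof. by rewrite /on_strip patchE mem_strip. Qed.

Lemma on_strip_comp (h : R -> R -> R) f u x : h 0 0 = 0 ->
  on_strip (fun x => h (f x) (u x)) x = h (on_strip f x) (on_strip u x).
Proof. by rewrite !on_stripE; case: ifP => // _ ->. Qed.

Lemma strip_smooth_supp f x : strip_smooth alpha f -> alpha <= `|x.1| -> f x = 0.
Proof.
move=> [_ [b [B [ba fb]]]] ax; apply/eqP/negPn/negP => /fb[h _].
by move: ax; rewrite leNgt (le_lt_trans h ba).
Qed.

Lemma on_strip_smooth f : strip_smooth alpha f -> on_strip f = f.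
Proof.
move=> sf; apply/funext => x; rewrite on_stripE; case: ltP => // ax.
by rewrite (strip_smooth_supp sf).
Qed.

Lemma on_stripv_grad f : strip_smooth alpha f -> on_stripv (grad f) = grad f.
Proof.
by move=> sf; apply/funext => x; rewrite /on_stripv/= !on_strip_smooth//;
  exact: strip_smooth_derive.
Qed.

Lemma enorm_sc f x : enorm (sc f x) = `|f x|.
Proof. by rewrite enorm_fst. Qed.

Lemma Lpv_sc f : Lpv p (sc f) <-> mes f /\ pint (fun x => `|f x| `^ p).
Proof.
rewrite /Lpv (_ : (fun x => enorm _ `^ p) = fun x => `|f x| `^ p).
  by split=> [[[]]|[]] // *; do !split => //; exact: mes_cst.
by apply/funext => x; rewrite enorm_sc.
Qed.

Lemma Lpint_sc f : Lpint p (sc f) = Int (fun x => `|f x| `^ p).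
Proof. by rewrite Lpint.unlock; congr Int; apply/funext => x; rewrite enorm_sc. Qed.

Lemma Lnorm_sc f : Lpv p (sc f) ->
  ('N[@leb2 R]_(p%:E)[EFin \o f] = ((Lpint p (sc f)) `^ p^-1)%:E)%E.
Proof.
move=> /Lpv_sc[_ pf]; rewrite unlock /Lnorm.body -poweR_EFin Lpint_sc -EFin_Int; last exact: pf.
by [].
Qed.

Lemma inLpP f : inLp Omega p f <-> Lpv p (sc (on_strip f)).
Proof.
split.
  move=> h; apply/Lpv_sc; split.
    by move: h; rewrite /inLp inE => /andP[/[!inE]/=].
  by have := Lfun_integrable (ltW hp) h; rewrite pintE.
move=> L; have := Lnorm_sc L; case/Lpv_sc : L => mf pf e.
rewrite /inLp inE; apply/andP; split; rewrite inE//=.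
by rewrite /finite_norm -/(on_strip f) e ltry.
Qed.

Lemma Lp_norm_strip f : inLp Omega p f ->
  Lp_norm Omega p f = (Lpint p (sc (on_strip f)) `^ p^-1)%:E.
Proof. by move=> /inLpP/Lnorm_sc. Qed.

Lemma Rintegral_strip f : \int[@leb2 R]_(x in Omega) f x = Int (on_strip f).
Proof. by rewrite Rintegral_mkcond IntE. Qed.

Lemma energy_strip g : Lpv p (on_stripv g) -> energy Omega p g = (Lpint p (on_stripv g))%:E.
Proof.
move=> [_ pg]; rewrite Lpint.unlock -(EFin_Int pg) /energy integral_mkcond.
apply: eq_integral => x _; rewrite patchE /on_stripv/= !on_stripE.
have -> : (x \in Omega) = (`|x.1| < alpha) := mem_strip x.
case: ifPn => _; first by case: (g x).
by rewrite enorm_fst normr0 powR0 ?gt_eqF.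
Qed.

Lemma power_strip f : inLp Omega p f ->
  (\int[@leb2 R]_(x in Omega) (`|f x| `^ p)%:E = (Lpint p (sc (on_strip f)))%:E)%E.
Proof.
move=> /inLpP/Lpv_sc[_ pf]; rewrite Lpint_sc -(EFin_Int pf) integral_mkcond.
apply: eq_integral => x _; rewrite patchE /on_strip patchE.
by case: ifPn => //; rewrite normr0 powR0 ?gt_eqF.
Qed.

Lemma W1p_norm_strip u g : inLp Omega p u -> Lpv p (on_stripv g) ->
  W1p_norm Omega p u g =
  ((Lpint p (sc (on_strip u)) + Lpint p (on_stripv g)) `^ p^-1)%:E.
Proof.
by move=> Lu Lg; rewrite /W1p_norm power_strip// energy_strip// -EFinD poweR_EFin.
Qed.

Lemma inLpv g : inLp Omega p (fun x => (g x).1) -> inLp Omega p (fun x => (g x).2) ->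
  Lpv p (on_stripv g).
Proof.
move=> /inLpP L1 /inLpP L2.
have m1 : mes (on_strip (fun x => (g x).1)) by case/Lpv_sc : L1.
have m2 : mes (on_strip (fun x => (g x).2)) by case/Lpv_sc : L2.
have L2' : Lpv p (fun x => (0, on_strip (fun x => (g x).2) x)).
  have [_ pg] := L2; split; first by split => //; exact: mes_cst.
  rewrite (_ : (fun x => _) = fun x => enorm (sc (on_strip (fun x => (g x).2)) x) `^ p)//.
  by apply/funext => x; rewrite enorm_sc enorm_snd.
have := LpvD hp L1 L2'; rewrite /sc /on_stripv.
by under eq_fun do rewrite /GRing.add/= /add_pair/= addr0 add0r.
Qed.

Lemma strip_smooth_grad_bounded f : strip_smooth alpha f ->
  exists M B : R, 0 <= M /\ forall x, `|f x| <= M * box B x /\ enorm (grad f x) <= M * box B x.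
Proof.
move=> sf.
have [M0 [B0 [M00 f0]]] := strip_smooth_bounded sf.
have [M1 [B1 [M10 f1]]] := strip_smooth_bounded (strip_smooth_derive ((1, 0) : R * R) sf).
have [M2 [B2 [M20 f2]]] := strip_smooth_bounded (strip_smooth_derive ((0, 1) : R * R) sf).
exists (M0 + (M1 + M2)), (Num.max B0 (Num.max B1 B2)).
have le (M B B' : R) x : 0 <= M -> B <= B' -> M * box B x <= M * box B' x.
  by move=> M'0 BB; rewrite ler_wpM2l// le_box.
have bx x : 0 <= box (Num.max B0 (Num.max B1 B2)) x by exact: box_ge0.
split=> [|x]; first by rewrite !addr_ge0.
split.
  rewrite (le_trans (f0 x))// (le_trans (le _ _ _ x M00 (_ : B0 <= Num.max B0 (Num.max B1 B2))))//.
    by rewrite le_max lexx.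
  by rewrite ler_wpM2r// lerDl addr_ge0.
rewrite (le_trans (ler_enorm_sum _))// !mulrDl ler_wpDl ?mulr_ge0// lerD//.
  by rewrite (le_trans (f1 x))// le// !le_max lexx orbT.
by rewrite (le_trans (f2 x))// le// !le_max lexx !orbT.
Qed.

Lemma strip_smooth_Lpv f : strip_smooth alpha f -> Lpv p (sc f) /\ Lpv p (grad f).
Proof.
move=> sf; have [M [B [M0 fM]]] := strip_smooth_grad_bounded sf.
split; apply: (Lpv_box hp (M := M) (B := B)).
- by split; [exact: strip_smooth_mes sf|exact: mes_cst].
- by move=> x; rewrite enorm_sc; case: (fM x).
- by split; apply: (@strip_smooth_mes _ alpha); exact: strip_smooth_derive.
- by move=> x; case: (fM x).
Qed.

Lemma strip_smoothM f u : strip_smooth alpha f -> smooth u ->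
  strip_smooth alpha (fun x => f x * u x).
Proof.
move=> [sf [b [B [ba fb]]]] su; split; first by move=> k; apply: CkM.
exists b, B; split => // x h; apply: fb; apply: contra_neq h => ->.
by rewrite mul0r.
Qed.

Lemma strip_smooth_by_parts f u e : strip_smooth alpha f -> strip_smooth alpha u ->
  Int (fun x => f x * 'D_e u x) = - Int (fun x => 'D_e f x * u x).
Proof.
move=> sf su; apply/eqP; rewrite -subr_eq0 opprK; apply/eqP.
have df x : derivable f x e by have [_ /(_ e)[]] := sf.1 1%N.
have du x : derivable u x e by have [_ /(_ e)[]] := su.1 1%N.
rewrite -IntD.
- rewrite -(Int_derive e (strip_smoothM sf su.1)); congr Int; apply/funext => x.
  by rewrite deriveM// /GRing.scale/= [X in _ + X]mulrC.
- by apply: strip_smooth_pint; apply: strip_smoothM => //; apply: (strip_smooth_derive e su).1.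
- by apply: strip_smooth_pint; apply: strip_smoothM; [exact: strip_smooth_derive|exact: su.1].
Qed.

End strip_bridge.

Section coordinates.
Context {R : realType}.
Implicit Types (x y : R * R) (f u : R * R -> R).
Local Notation sc := scalar_field.

Lemma fstD x y : (x + y).1 = x.1 + y.1. Proof. by []. Qed.
Lemma sndD x y : (x + y).2 = x.2 + y.2. Proof. by []. Qed.
Lemma fstN x : (- x).1 = - x.1. Proof. by []. Qed.
Lemma sndN x : (- x).2 = - x.2. Proof. by []. Qed.
Lemma fstZ (k : R) x : (k *: x).1 = k * x.1. Proof. by []. Qed.
Lemma sndZ (k : R) x : (k *: x).2 = k * x.2. Proof. by []. Qed.
Definition coordE := (fstD, sndD, fstN, sndN, fstZ, sndZ).

Lemma scB f u : (fun x => sc f x - sc u x) = sc (fun x => f x - u x).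
Proof.
by apply/funext => x; rewrite /sc; apply: injective_projections => //=; rewrite subrr.
Qed.

Lemma scD f u : (fun x => sc f x + sc u x) = sc (fun x => f x + u x).
Proof.
by apply/funext => x; rewrite /sc; apply: injective_projections => //=; rewrite addr0.
Qed.

Lemma scZ (k : R * R -> R) u : (fun x => k x *: sc u x) = sc (fun x => k x * u x).
Proof.
by apply/funext => x; rewrite /sc scaler_pair /= mulr0.
Qed.

End coordinates.

(* Conversion must not unfold the ring operations: comparing two distinct
   integrands would otherwise take exponential time. *)
Opaque Algebra.add Algebra.opp GRing.mul GRing.scale.

Section closure.
Context {R : realType} (alpha p : R) (hp : 1 < p).
Local Notation Omega := (strip alpha).
Local Notation sc := scalar_field.
Local Notation N := (Lpint p).
Implicit Types (f u w : R * R -> R) (g : R * R -> R * R).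

Let p0 : 0 < p. Proof. exact: lt_trans hp. Qed.
Let p10 : 0 < p - 1. Proof. by rewrite subr_gt0. Qed.

(** The closure of the graph of the gradient, for functions extended by zero and with p-th powers
    instead of norms. Stability under differences, vertical shifts and multiplication by bounded
    weights is checked on the approximants. *)
Definition in_closure w g := [/\ Lpv p (sc w), Lpv p g &
  forall e : R, 0 < e -> exists phi, [/\ strip_smooth alpha phi,
    N (fun x => sc w x - sc phi x) < e & N (fun x => g x - grad phi x) < e]].

Lemma smooth_in_closure phi : strip_smooth alpha phi -> in_closure phi (grad phi).
Proof.
move=> sphi; have [L1 L2] := strip_smooth_Lpv hp sphi; split => // e e0.
exists phi; have z (a : R * R -> R * R) : N (fun x => a x - a x) = 0.
  rewrite Lpint.unlock (_ : (fun x => _) = fun=> 0) ?Int0//.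
  by apply/funext => x; rewrite subrr enorm0 powR0// gt_eqF.
by split; rewrite ?z.
Qed.

Lemma W01p_in_closure (u : W01p Omega p) :
  in_closure (on_strip alpha u) (on_stripv alpha (W01p_grad u)).
Proof.
case: u => u g [Lu Lg1 Lg2 ibp] cl /=.
have Lsu : Lpv p (sc (on_strip alpha u)) by apply/(inLpP alpha hp).
have Lg := inLpv hp Lg1 Lg2.
split => // e e0.
(* The norm of W^{1,p} is the p-th root of the sum of the two integrals, so accuracy [e] for the
   integrals asks for accuracy [e^(1/p)] in norm. *)
have eq : 0 < e `^ p^-1 by rewrite powR_gt0.
have [phi /strip_smoothP sphi] := cl _ eq.
have [Lp1 Lp2] := strip_smooth_Lpv hp sphi.
have e1 : on_strip alpha (fun x => u x - phi x) = (fun x => on_strip alpha u x - phi x).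
  apply/funext => x.
  by rewrite (on_strip_comp alpha u phi x (h := fun s t => s - t)) ?subrr// (on_strip_smooth sphi).
have e2 : on_stripv alpha (fun x => g x - grad phi x) = (fun x => on_stripv alpha g x - grad phi x).
  apply/funext => x; rewrite -[in RHS](on_stripv_grad sphi) /on_stripv.
  apply: injective_projections => /=.
    by rewrite (on_strip_comp alpha (fun x => (g x).1) (fun x => (grad phi x).1) x (h := fun s t => s - t)) ?subrr.
  by rewrite (on_strip_comp alpha (fun x => (g x).2) (fun x => (grad phi x).2) x (h := fun s t => s - t)) ?subrr.
have LD : Lpv p (sc (on_strip alpha (fun x => u x - phi x))).
  by rewrite e1 -scB; exact: LpvB.
have LG : Lpv p (on_stripv alpha (fun x => g x - grad phi x)) by rewrite e2; exact: LpvB.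
rewrite (W1p_norm_strip hp)//; last by apply/(inLpP alpha hp).
rewrite e1 e2 -scB lte_fin => H.
have S0 : 0 <= N (fun x => sc (on_strip alpha u) x - sc phi x) +
    N (fun x => on_stripv alpha g x - grad phi x) by rewrite addr_ge0 ?Lpint_ge0.
have {}H : N (fun x => sc (on_strip alpha u) x - sc phi x) +
    N (fun x => on_stripv alpha g x - grad phi x) < e.
  rewrite ltNge; apply/negP => h; move: H; rewrite ltNge => /negP; apply.
  by rewrite ge0_ler_powR ?nnegrE ?invr_ge0// ltW.
exists phi; split; [exact: sphi| |]; apply: le_lt_trans H.
  by rewrite lerDl; exact: Lpint_ge0.
by rewrite lerDr; exact: Lpint_ge0.
Qed.

Lemma strip_by_parts phi psi e : strip_smooth alpha phi -> strip_smooth alpha psi ->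
  \int[@leb2 R]_(x in Omega) (phi x * 'D_e psi x) =
  - \int[@leb2 R]_(x in Omega) ('D_e phi x * psi x).
Proof.
move=> sphi spsi; have d1 := strip_smooth_derive e sphi; have d2 := strip_smooth_derive e spsi.
rewrite !Rintegral_strip (on_strip_smooth (strip_smoothM sphi d2.1)).
rewrite (on_strip_smooth (strip_smoothM d1 spsi.1)).
exact: strip_smooth_by_parts sphi spsi.
Qed.

(** A test function is its own approximant, and its classical gradient is a weak gradient by
    [strip_by_parts]. *)
Lemma W01p_of_smooth phi : strip_smooth alpha phi ->
  exists2 w : W01p Omega p, W01p_fun w = phi & W01p_grad w = grad phi.
Proof.
move=> sphi; have [L1 L2] := strip_smooth_Lpv hp sphi.
have s1 := strip_smooth_derive ((1, 0) : R * R) sphi.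
have s2 := strip_smooth_derive ((0, 1) : R * R) sphi.
have h : inW1p Omega p phi (grad phi).
  split.
  - by apply/(inLpP alpha hp); rewrite on_strip_smooth.
  - have := (strip_smooth_Lpv hp s1).1; rewrite -[X in sc X](on_strip_smooth s1).
    by move=> L; apply/(inLpP alpha hp); exact: L.
  - have := (strip_smooth_Lpv hp s2).1; rewrite -[X in sc X](on_strip_smooth s2).
    by move=> L; apply/(inLpP alpha hp); exact: L.
  - by move=> psi /strip_smoothP spsi; split; exact: strip_by_parts.
unshelve eexists (@MkW01p R Omega p phi (grad phi) h _) => //.
move=> e e0; exists phi; first exact/strip_smoothP.
have z1 : (fun x => phi x - phi x) = (fun=> 0) by apply/funext => x; rewrite subrr.
have z2 : (fun x => grad phi x - grad phi x) = (fun=> 0) by apply/funext => x; rewrite subrr.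
have o1 : on_strip alpha (fun=> 0) = (fun=> 0).
  by apply/funext => x; rewrite on_stripE; case: ifP.
have o2 : on_stripv alpha (fun=> 0) = (fun=> 0).
  by apply/funext => x; rewrite /on_stripv /= o1.
have z : N (fun=> 0) = 0.
  by rewrite Lpint.unlock enorm0 powR0 ?Int0// gt_eqF.
have Lz : Lpv p (fun=> (0 : R * R)).
  by split; [split; exact: mes_cst|rewrite enorm0 powR0 ?gt_eqF//; exact: pint0].
rewrite z1 z2 (W1p_norm_strip hp) ?o1 ?o2//; last by apply/(inLpP alpha hp); rewrite o1.
have -> : sc (fun=> 0) = (fun=> (0 : R * R)) by [].
by rewrite z addr0 powR0 ?lte_fin// invr_neq0// gt_eqF.
Qed.

Lemma plaplacianE (u v : W01p Omega p) : plaplacian u v =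
  pairing p (on_stripv alpha (W01p_grad u)) (on_stripv alpha (W01p_grad v)).
Proof.
rewrite /plaplacian Rintegral_strip pairing.unlock; congr Int; apply/funext => x.
rewrite !on_stripE /on_stripv !on_stripE; case: ifP => // _.
by rewrite /dot/= !mulr0 addr0.
Qed.

Lemma dot_pfield_sc (s t : R) : dot (pfield p (s, 0)) (t, 0) = `|s| `^ (p - 2) * s * t.
Proof. by rewrite pfield_fst /dot/= mulr0 addr0. Qed.

Lemma power_functionalE (u v : W01p Omega p) : power_functional u v =
  pairing p (sc (on_strip alpha u)) (sc (on_strip alpha v)).
Proof.
rewrite /power_functional Rintegral_strip pairing.unlock; congr Int; apply/funext => x.
rewrite dot_pfield_sc !on_stripE; case: ifP => // _.
by rewrite !mulr0.
Qed.

(* Take [e = k^p]. *)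
Lemma ler_young_small (A B D : R) :
  (forall k e : R, 0 < k -> 0 < e -> D <= k * A + k `^ (1 - p) * (B * e)) -> D <= 0.
Proof.
move=> H; apply: (@ler_small _ (A + B)) => h h0 h1.
have := H h (h `^ p) h0 (powR_gt0 _ h0).
rewrite mulrCA -powRD; last by rewrite (gt_eqF h0) implybT.
by rewrite subrK powRr1 ?(ltW h0)// (mulrC h) -mulrDl.
Qed.

(** Replacing [w] by an approximant changes both sides by pairings with a small field. Young's
    inequality with parameter [t] bounds them by [t] times a constant plus a [t]-dependent multiple
    of the arbitrarily small error, which is the situation of [ler_young_small]. *)
Lemma weak_equation_closure (lambda : R) u g w k :
  Lpv p (sc u) -> Lpv p g ->
  (forall phi, strip_smooth alpha phi ->
     pairing p g (grad phi) = lambda * pairing p (sc u) (sc phi)) ->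
  in_closure w k -> pairing p g k = lambda * pairing p (sc u) (sc w).
Proof.
move=> Lu Lg H [Lw Lk cl]; apply/eqP; rewrite -subr_eq0 -normr_le0.
apply: (@ler_young_small (N g + `|lambda| * N (sc u)) (1 + `|lambda|)) => t e t0 e0.
have [phi [sphi h1 h2]] := cl e e0.
have [Lp1 Lp2] := strip_smooth_Lpv hp sphi.
have -> : pairing p g k - lambda * pairing p (sc u) (sc w) =
   pairing p g (fun x => k x - grad phi x) -
   lambda * pairing p (sc u) (fun x => sc w x - sc phi x).
  by rewrite !pairingB// H//; ring.
rewrite (le_trans (ler_normB _ _))// normrM.
have := pairing_young hp t0 Lg (LpvB hp Lk Lp2).
have := pairing_young hp t0 Lu (LpvB hp Lw Lp1).
have tp : 0 <= t `^ (1 - p) by exact: powR_ge0.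
have := ler_wpM2l tp (ltW h1); have := ler_wpM2l tp (ltW h2).
set a1 := t `^ (1 - p) * _; set a2 := t `^ (1 - p) * e; set a3 := t `^ (1 - p) * _.
move=> h3 h4 h5 h6.
have := ler_wpM2l (normr_ge0 lambda) (le_trans h5 (lerD (lexx _) h4)).
rewrite -/a2 [t `^ (1 - p) * _](_ : _ = a2 + `|lambda| * a2); last by rewrite /a2; ring.
lra.
Qed.

End closure.

(** * Increments in x_2 of elements of the closure *)

Section difference_quotients.
Context {R : realType} (alpha p : R) (hp : 1 < p).
Local Notation sc := scalar_field.
Local Notation N := (Lpint p).
Local Notation e2 := ((0, 1) : R * R).
Implicit Types (f u w phi psi : R * R -> R) (g k : R * R -> R * R).

Let p0 : 0 < p. Proof. exact: lt_trans hp. Qed.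

Lemma powR_small (q K e : R) : 0 < q -> 0 <= K -> 0 < e ->
  exists2 r : R, 0 < r & forall t : R, 0 <= t -> t <= r -> t `^ q * K <= e.
Proof.
move=> q0 K0 e0; have K1 : 0 < K + 1 by rewrite ltr_wpDl.
have eK : 0 < e / (K + 1) by rewrite divr_gt0.
have qq : q^-1 * q = 1 by rewrite mulVf// gt_eqF.
exists ((e / (K + 1)) `^ q^-1); first exact: powR_gt0.
move=> t t0 tr; rewrite (@le_trans _ _ (e / (K + 1) * K))//.
  rewrite ler_wpM2r//.
  have -> : e / (K + 1) = (e / (K + 1)) `^ q^-1 `^ q by rewrite -powRrM qq powRr1// ltW.
  by rewrite ge0_ler_powR ?nnegrE ?(ltW q0) ?powR_ge0.
by rewrite mulrAC ler_pdivrMr// ler_wpM2l ?(ltW e0)// lerDl.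
Qed.

Lemma ler_eps (A B D : R) : (forall e : R, 0 < e -> D <= A + B * e) -> D <= A.
Proof.
move=> H; rewrite -subr_le0; apply: (@ler_small _ B) => h h0 _.
by rewrite lerBlDl H.
Qed.

Definition incr (h : R) w x := w (x + h *: e2) - w x.

Lemma N_snd g : Lpv p g -> Lpv p (sc (fun x => (g x).2)) /\ N (sc (fun x => (g x).2)) <= N g.
Proof.
move=> Lg; have [mg _] := Lg.
have [] := @Lpv_le _ p hp (sc (fun x => (g x).2)) g 1 _ Lg ler01.
- by split; [exact: mg.2|exact: mes_cst].
- by move=> x; rewrite enorm_sc mul1r ler_snd_enorm.
by move=> L1; rewrite powR1 mul1r.
Qed.

Lemma Lpv_incr h w : Lpv p (sc w) ->
  Lpv p (sc (incr h w)) /\ N (sc (incr h w)) <= 2 `^ p * (2 * N (sc w)).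
Proof.
move=> Lw; have [Ls Ns] := Lpv_shift (h *: e2) Lw.
have -> : sc (incr h w) = (fun x => sc w (x + h *: e2) - sc w x).
  by rewrite -scB.
split; first exact: LpvB.
rewrite (le_trans (LpintD_le2 hp Ls (LpvN hp Lw)))// LpintN Ns.
by rewrite ler_wpM2l ?powR_ge0// mulr_natl mulr2n.
Qed.

Lemma incr_telescope n h w x : \sum_(i < n) incr h w (x + (i%:R * h) *: e2) = incr (n%:R * h) w x.
Proof.
elim: n => [|n ih]; first by rewrite big_ord0 /incr mul0r scale0r addr0 subrr.
rewrite big_ord_recr /= ih /incr.
have -> : x + (n%:R * h) *: e2 + h *: e2 = x + (n.+1%:R * h) *: e2.
  by rewrite -addrA -scalerDl -natr1 mulrDl mul1r.
by ring.
Qed.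

Lemma sc_sum n (F : 'I_n -> R * R -> R) x : \sum_i sc (F i) x = sc (fun y => \sum_i F i y) x.
Proof.
elim: n F => [|n ih] F; first by rewrite /sc !big_ord0.
rewrite big_ord_recl ih /sc big_ord_recl.
by apply: injective_projections; rewrite !coordE //= addr0.
Qed.

(** The increment over [H] is a sum of [n] translated increments over [H / n], so Jensen's
    inequality gives the factor [n^p]. Each small increment is [h] times the derivative up to
    [O(h^2)], and [n^p h^(2 p)] tends to 0. The factor [2^p] comes from separating these two
    terms. *)
Lemma smooth_incr_le phi H : strip_smooth alpha phi ->
  N (sc (incr H phi)) <= 2 `^ p * (`|H| `^ p * N (sc (fun x => (grad phi x).2))).
Proof.
move=> sphi; have [L1 L2] := strip_smooth_Lpv hp sphi.
have [L3 _] := N_snd L2.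
have [M [B [M0 hM]]] := strip_smooth_increments e2 sphi.
have Lb : Lpv p (sc (box B)).
  apply/Lpv_sc; split; first exact: pint_mes (pint_box B).
  rewrite (_ : (fun x => _) = box B); first exact: pint_box.
  apply/funext => x; rewrite ger0_norm ?box_ge0// /box; case: (_ && _); rewrite ?powR1//.
  by rewrite powR0 ?gt_eqF.
apply: (@ler_eps _ (2 `^ p)) => e e0.
have [r r0 hr] := powR_small p0 (Lpint_ge0 p (sc (box B))) e0.
(* Large enough for [|H / n| <= 1], where the second-order bound holds, and for
   [n M h^2 = M H^2 / n <= r], which makes the accumulated remainder at most [e]. *)
pose n := (Num.bound (`|H| + M * H ^+ 2 / r)).+1.
have n0 : 0 < n%:R :> R by rewrite ltr0n.
have q1 : 0 <= M * H ^+ 2 / r by rewrite divr_ge0 ?(ltW r0)// mulr_ge0 ?sqr_ge0.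
have hn : `|H| + M * H ^+ 2 / r <= n%:R.
  have : 0 <= `|H| + M * H ^+ 2 / r.
    exact: addr_ge0.
  move=> /archi_boundP h; rewrite (le_trans (ltW h))//.
  by rewrite ler_nat.
have Hn : `|H| <= n%:R by rewrite (le_trans _ hn)// lerDl.
have Mn : M * H ^+ 2 / n%:R <= r.
  rewrite ler_pdivrMr// -ler_pdivrMl// mulrC (le_trans _ hn)//.
  by rewrite lerDr.
pose h := H / n%:R.
have nh : n%:R * h = H by rewrite /h; field; rewrite gt_eqF.
have h1 : `|h| <= 1 by rewrite /h normrM normfV (gtr0_norm n0) ler_pdivrMr// mul1r.
have [Li _] := Lpv_incr h L1.
have LF (i : 'I_n) := Lpv_shift ((i%:R * h) *: e2) Li.
have -> : sc (incr H phi) = (fun x => \sum_(i < n) sc (incr h phi) (x + (i%:R * h) *: e2)).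
  apply/funext => x.
  rewrite (sc_sum (fun (i : 'I_n) y => incr h phi (y + (i%:R * h) *: e2))).
  by rewrite /sc incr_telescope nh.
rewrite (le_trans (Lpint_sum hp (fun i => (LF i).1)))//.
under eq_bigr do rewrite (LF _).2.
rewrite sumr_const card_ord -[X in _ * X <= _]mulr_natl [leLHS]mulrA -(powRp hp (ltW n0)).
have Mh : 0 <= M * h ^+ 2 by rewrite mulr_ge0// sqr_ge0.
pose r2 x := phi (x + h *: e2) - phi x - h * (grad phi x).2.
have mr2 : mes r2.
  apply: mesB; last by apply: mesM; [exact: mes_cst|case: L2 => -[]].
  by case/Lpv_sc : Li.
have [Lr2 Nr2] : Lpv p (sc r2) /\ N (sc r2) <= (M * h ^+ 2) `^ p * N (sc (box B)).
  apply: (@Lpv_le _ p hp (sc r2) (sc (box B)) (M * h ^+ 2)) => //.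
  - by split; [exact: mr2|exact: mes_cst].
  by move=> x; rewrite !enorm_sc (ger0_norm (box_ge0 _ _)); exact: (hM h x h1).2.
have Lh := LpvZc hp h L3.
have e1 : sc (incr h phi) = (fun x => h *: sc (fun x => (grad phi x).2) x + sc r2 x).
  apply/funext => x; rewrite /sc /incr /r2.
  by apply: injective_projections; rewrite !coordE /= ?mulr0 ?addr0//; ring.
have := LpintD_le2 hp Lh Lr2; rewrite -e1 LpintZc// => H1.
rewrite (le_trans (ler_wpM2l (powR_ge0 _ _) H1))// mulrCA -mulrDr ler_wpM2l ?powR_ge0//.
rewrite mulrDr lerD//.
  by rewrite mulrA -powRM ?(ltW n0)// -{1}(gtr0_norm n0) -normrM nh.
rewrite (le_trans (ler_wpM2l (powR_ge0 _ _) Nr2))// mulrA -(powRM _ (ltW n0) Mh).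
apply: hr; first exact: mulr_ge0 (ltW n0) Mh.
rewrite (le_trans _ Mn)// le_eqVlt; apply/orP; left; apply/eqP.
by rewrite /h; field; rewrite gt_eqF.
Qed.

Lemma strip_smoothB phi psi : strip_smooth alpha phi -> strip_smooth alpha psi ->
  strip_smooth alpha (fun x => phi x - psi x).
Proof.
move=> [s1 [b1 [B1 [a1 h1]]]] [s2 [b2 [B2 [a2 h2]]]]; split.
  move=> k; apply: eq_Ck (CkD (s1 k) (CkM (Ck_cst k (-1)) (s2 k))) => x.
  by rewrite mulN1r.
exists (Num.max b1 b2), (Num.max B1 B2); split; first by rewrite gt_max a1.
move=> x; have [->|n1] := eqVneq (phi x) 0.
  by rewrite sub0r oppr_eq0 => /h2[? ?]; rewrite !le_max; split; apply/orP; right.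
by have [? ?] := h1 x n1; rewrite !le_max; split; apply/orP; left.
Qed.

Lemma strip_smooth_derivable phi x v : strip_smooth alpha phi -> derivable phi x v.
Proof. by move=> [/(_ 1%N)[_ /(_ v)[]]]. Qed.

Lemma grad_sub phi psi x : strip_smooth alpha phi -> strip_smooth alpha psi ->
  grad (fun x => phi x - psi x) x = grad phi x - grad psi x.
Proof.
move=> s1 s2; rewrite /grad; apply: injective_projections; rewrite !coordE /=;
  by apply: deriveB; exact: strip_smooth_derivable.
Qed.

Lemma shift_continuous (k : R * R) : continuous (fun x : R * R => x + k).
Proof. by move=> x; apply: cvgD; [exact: cvg_id|exact: cvg_cst]. Qed.

Lemma grad_shift phi (k : R * R) x : grad (fun x => phi (x + k)) x = grad phi (x + k).
Proof.
have lL (t : R) v y : t *: v + y + k = t *: v + (y + k) by rewrite addrA.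
by rewrite /grad !(derive_comp_affine phi _ x lL).
Qed.

Lemma strip_smooth_shift phi (k : R * R) : k.1 = 0 -> strip_smooth alpha phi ->
  strip_smooth alpha (fun x => phi (x + k)).
Proof.
move=> k0 [s [b [B [ba h]]]]; split.
  have lL (t : R) v y : t *: v + y + k = t *: v + (y + k) by rewrite addrA.
  by move=> n; apply: (Ck_comp_affine (@shift_continuous k) lL).
exists b, (B + `|k.2|); split => // x /h[]; rewrite !coordE k0 addr0 => ? h2; split => //.
rewrite -(addrK k.2 x.2) (le_trans (ler_normB _ _))//.
by rewrite lerD2r.
Qed.

Lemma grad_mul phi th x : strip_smooth alpha phi -> smooth th ->
  grad (fun x => phi x * th x) x = th x *: grad phi x + phi x *: grad th x.
Proof.
move=> s1 s2; have dth v : derivable th x v by have [_ /(_ v)[]] := s2 1%N.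
rewrite /grad; apply: injective_projections; rewrite !coordE /=;
  by rewrite derive_mul 1?addrC//; exact: strip_smooth_derivable.
Qed.

Lemma in_closureB w g u k : in_closure alpha p w g -> in_closure alpha p u k ->
  in_closure alpha p (fun x => w x - u x) (fun x => g x - k x).
Proof.
move=> [Lw Lg cw] [Lu Lk cu]; split; [by rewrite -scB; exact: LpvB|exact: LpvB|].
move=> e e0.
have c0 : 0 < 2 `^ p * 2 :> R by rewrite mulr_gt0 ?powR_gt0.
have d0 : 0 < e / (2 `^ p * 2) by rewrite divr_gt0.
have de : e / 2 `^ p = e / (2 `^ p * 2) + e / (2 `^ p * 2).
  by field; rewrite gt_eqF ?powR_gt0.
have [phi [s1 h1 h2]] := cw _ d0; have [psi [s2 h3 h4]] := cu _ d0.
have [P1 P2] := strip_smooth_Lpv hp s1; have [P3 P4] := strip_smooth_Lpv hp s2.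
exists (fun x => phi x - psi x); split; first exact: strip_smoothB.
- have -> : (fun x => sc (fun x => w x - u x) x - sc (fun x => phi x - psi x) x) =
    (fun x => (sc w x - sc phi x) + - (sc u x - sc psi x)).
    by apply/funext => x; apply: injective_projections; rewrite /sc !coordE /= ?coordE; ring.
  apply: (le_lt_trans (LpintD_le2 hp (LpvB hp Lw P1) (LpvN hp (LpvB hp Lu P3)))).
  rewrite LpintN mulrC -ltr_pdivlMr ?powR_gt0//.
  by rewrite de ltrD.
- have -> : (fun x => (g x - k x) - grad (fun x => phi x - psi x) x) =
    (fun x => (g x - grad phi x) + - (k x - grad psi x)).
    by apply/funext => x; rewrite grad_sub// !opprD !addrA -!addrA; congr (_ + _); rewrite addrCA.
  apply: (le_lt_trans (LpintD_le2 hp (LpvB hp Lg P2) (LpvN hp (LpvB hp Lk P4)))).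
  rewrite LpintN mulrC -ltr_pdivlMr ?powR_gt0//.
  by rewrite de ltrD.
Qed.

Lemma in_closure_shift w g (k : R * R) : k.1 = 0 -> in_closure alpha p w g ->
  in_closure alpha p (fun x => w (x + k)) (fun x => g (x + k)).
Proof.
move=> k0 [Lw Lg cw]; split; [exact: (Lpv_shift k Lw).1|exact: (Lpv_shift k Lg).1|].
move=> e e0; have [phi [s1 h1 h2]] := cw e e0.
have [P1 P2] := strip_smooth_Lpv hp s1.
exists (fun x => phi (x + k)); split; first exact: strip_smooth_shift.
- by rewrite (Lpv_shift k (LpvB hp Lw P1)).2.
- have -> : (fun x => g (x + k) - grad (fun x => phi (x + k)) x) =
     (fun x => g (x + k) - grad phi (x + k)).
    by apply/funext => x; rewrite grad_shift.
  by rewrite (Lpv_shift k (LpvB hp Lg P2)).2.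
Qed.

Lemma in_closure_mul w g th (K : R) : smooth th ->
  (forall x, `|th x| <= K) -> (forall x, enorm (grad th x) <= K) ->
  in_closure alpha p w g ->
  in_closure alpha p (fun x => w x * th x) (fun x => th x *: g x + w x *: grad th x).
Proof.
move=> sth thK gK [Lw Lg cw].
have mth : mes th := mes_continuous (Ck_continuous (sth 0%N)).
have mgth : mesv (grad th).
  have cth v : continuous ('D_v th) by have [_ /(_ v)[_ []]] := sth 1%N.
  by split; apply: mes_continuous; exact: cth.
have K0 : 0 <= K by rewrite (le_trans _ (thK 0)).
have L1 f : Lpv p (sc f) -> Lpv p (sc (fun x => f x * th x)) /\
    N (sc (fun x => f x * th x)) <= K `^ p * N (sc f).
  move=> Lf; have -> : sc (fun x => f x * th x) = (fun x => th x *: sc f x).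
    by rewrite scZ; under [in RHS]eq_fun do rewrite mulrC.
  exact: LpvZ.
have L2 f : Lpv p (sc f) -> Lpv p (fun x => f x *: grad th x) /\
    N (fun x => f x *: grad th x) <= K `^ p * N (sc f).
  move=> Lf; apply: Lpv_le => //.
    by apply: mesvZ => //; case/Lpv_sc : Lf.
  by move=> x; rewrite enormZ enorm_sc mulrC ler_wpM2r.
have L3 k : Lpv p k -> Lpv p (fun x => th x *: k x) /\
    N (fun x => th x *: k x) <= K `^ p * N k by move=> Lk; exact: LpvZ.
split; [exact: (L1 _ Lw).1|by apply: LpvD; [exact: hp|exact: (L3 _ Lg).1|exact: (L2 _ Lw).1]|].
move=> e e0.
have C0 : 0 <= K `^ p * (1 + 2 `^ p * 2) by rewrite mulr_ge0 ?powR_ge0// addr_ge0// mulr_ge0// powR_ge0.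
(* Covers both errors: [K^p d] for the function and [2^p K^p (d + d)] for its gradient. *)
pose d := e / (K `^ p * (1 + 2 `^ p * 2) + 1).
have d0 : 0 < d by rewrite divr_gt0// ltr_wpDl.
have de : K `^ p * (1 + 2 `^ p * 2) * d < e.
  by rewrite /d mulrA ltr_pdivrMr ?ltr_wpDl// mulrC ltr_pM2l// ltrDl.
have [phi [s1 h1 h2]] := cw d d0.
have [P1 P2] := strip_smooth_Lpv hp s1.
have Kp : 0 <= K `^ p := powR_ge0 _ _.
have T2 : 0 <= 2 `^ p :> R := powR_ge0 _ _.
have LD := LpvB hp Lw P1; have LG := LpvB hp Lg P2; rewrite scB in LD.
rewrite scB in h1.
exists (fun x => phi x * th x); split; first exact: strip_smoothM.
- have -> : (fun x => sc (fun x => w x * th x) x - sc (fun x => phi x * th x) x) =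
     sc (fun x => (w x - phi x) * th x).
    by rewrite scB; congr sc; apply/funext => x; rewrite mulrBl.
  rewrite (le_lt_trans (L1 _ LD).2)// (le_lt_trans _ de)//.
  rewrite -mulrA ler_wpM2l// mulrDl mul1r ler_wpDr// ?(ltW h1)//.
  exact: mulr_ge0 (mulr_ge0 T2 (ler0n _ 2)) (ltW d0).
- have -> : (fun x => (th x *: g x + w x *: grad th x) - grad (fun x => phi x * th x) x) =
     (fun x => th x *: (g x - grad phi x) + (w x - phi x) *: grad th x).
    apply/funext => x; rewrite (grad_mul x s1 sth).
    by apply: injective_projections; rewrite !coordE; ring.
  rewrite (le_lt_trans (LpintD_le2 hp (L3 _ LG).1 (L2 _ LD).1))//.
  have := lerD (L3 _ LG).2 (L2 _ LD).2; rewrite -mulrDr => h3.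
  rewrite (le_lt_trans (ler_wpM2l T2 h3))// (le_lt_trans _ de)// mulrCA -mulrA ler_wpM2l//.
  have : 2 `^ p * (N (fun x => g x - grad phi x) + N (sc (fun x => w x - phi x))) <= 2 `^ p * (d + d).
    by rewrite ler_wpM2l// ltW// ltrD.
  move=> /le_trans; apply.
  have : 0 < d by []. nra.
Qed.

Lemma in_closure_incr_le w g (h : R) : in_closure alpha p w g ->
  N (sc (incr h w)) <= 8 `^ p * (`|h| `^ p * N (sc (fun x => (g x).2))).
Proof.
move=> [Lw Lg cw]; apply: (@ler_eps _ (8 `^ p * `|h| `^ p + 2 `^ p * (2 `^ p * 2))) => e e0.
have [phi [s1 h1 h2]] := cw e e0; have [P1 P2] := strip_smooth_Lpv hp s1.
have T2 : 0 <= 2 `^ p :> R := powR_ge0 _ _.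
have LD := LpvB hp Lw P1; rewrite scB in LD h1.
have [Li1 _] := Lpv_incr h P1; have [Li2 Ni2] := Lpv_incr h LD.
have -> : sc (incr h w) = (fun x => sc (incr h phi) x + sc (incr h (fun x => w x - phi x)) x).
  by rewrite scD; congr sc; apply/funext => x; rewrite /incr; ring.
rewrite (le_trans (LpintD_le2 hp Li1 Li2))//.
have [L3 N3] := N_snd (LpvB hp Lg P2).
have [L4 _] := N_snd Lg; have [L5 _] := N_snd P2.
have e1 : sc (fun x => (grad phi x).2) = (fun x => sc (fun x => (g x).2) x + - sc (fun x => (g x - grad phi x).2) x).
  by apply/funext => x; apply: injective_projections; rewrite /sc !coordE /= ?coordE; ring.
have N5 := LpintD_le2 hp L4 (LpvN hp L3); rewrite -e1 LpintN in N5.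
have N6 := smooth_incr_le h s1.
have hpw : 0 <= `|h| `^ p := powR_ge0 _ _.
(* One factor [2^p] splits off the approximant, one comes from [smooth_incr_le], and one is lost in
   passing back from [grad phi] to [g]. *)
have -> : 8 `^ p = 2 `^ p * (2 `^ p * 2 `^ p) :> R.
  by rewrite -!powRM ?mulr_ge0//; congr (_ `^ _); ring.
rewrite [leRHS](_ : _ = 2 `^ p * (2 `^ p * (`|h| `^ p * (2 `^ p * (N (sc (fun x => (g x).2)) + e))) +
   2 `^ p * (2 * e))); last by ring.
rewrite ler_wpM2l// lerD//.
  rewrite (le_trans N6)// ler_wpM2l// ler_wpM2l// (le_trans N5)// ler_wpM2l// lerD2l.
  exact: le_trans N3 (ltW h2).
by rewrite (le_trans Ni2)// ler_wpM2l// ler_wpM2l// ltW.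
Qed.

(** The upper limit of [X h], as [h] tends to 0 through both signs, is at most 0. The condition is
    one-sided because it is applied to nonnegative error terms. *)
Definition vanish (X : R -> R) := forall e : R, 0 < e ->
  exists2 r : R, 0 < r & forall h : R, 0 < `|h| -> `|h| < r -> X h <= e.

Lemma vanish_le X Y : (forall h, X h <= Y h) -> vanish Y -> vanish X.
Proof.
move=> XY vY e e0; have [r r0 H] := vY e e0; exists r => // h h0 hr.
exact: le_trans (XY h) (H h h0 hr).
Qed.

Lemma vanishD X Y : vanish X -> vanish Y -> vanish (fun h => X h + Y h).
Proof.
move=> vX vY e e0; have e2 : 0 < e / 2 by rewrite divr_gt0.
have [r r0 H] := vX _ e2; have [s s0 G] := vY _ e2.
exists (Num.min r s); first by rewrite lt_min r0.
move=> h h0; rewrite lt_min => /andP[hr hs].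
by have := lerD (H h h0 hr) (G h h0 hs); rewrite -splitr.
Qed.

Lemma vanishZ (k : R) X : 0 <= k -> vanish X -> vanish (fun h => k * X h).
Proof.
move=> k0 vX e e0; have k1 : 0 < k + 1 by rewrite ltr_wpDl.
have ek : 0 < e / (k + 1) by rewrite divr_gt0.
have [r r0 H] := vX _ ek; exists r => // h h0 hr.
rewrite (le_trans (ler_wpM2l k0 (H h h0 hr)))// mulrA ler_pdivrMr// mulrC ler_wpM2l ?(ltW e0)//.
by rewrite lerDl.
Qed.

Lemma vanish_near X Y : (forall h, 0 < `|h| -> `|h| <= 1 -> X h <= Y h) -> vanish Y -> vanish X.
Proof.
move=> XY vY e e0; have [r r0 H] := vY e e0; exists (Num.min r 1).
  by rewrite lt_min r0 ltr01.
move=> h h0; rewrite lt_min => /andP[hr h1].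
exact: le_trans (XY h h0 (ltW h1)) (H h h0 hr).
Qed.

Lemma vanish_powR (q : R) : 0 < q -> vanish (fun h => `|h| `^ q).
Proof.
move=> q0 e e0; have [r r0 H] := powR_small q0 ler01 e0.
by exists r => // h _ hr; have := H _ (normr_ge0 h) (ltW hr); rewrite mulr1.
Qed.

(** The scheme of a density argument: [d] measures the distance to a smooth approximant, and [Z] is
    the error for this approximant, small once [d] is fixed. *)
Lemma vanish_split X (K : R) :
  (forall d : R, 0 < d -> exists2 Z, vanish Z &
     forall h : R, 0 < `|h| -> `|h| <= 1 -> X h <= K * d + Z h) -> vanish X.
Proof.
move=> XZ e e0; have e2 : 0 < e / 2 by rewrite divr_gt0.
have K1 : 0 < `|K| + 1 by rewrite ltr_wpDl.
pose d := e / 2 / (`|K| + 1); have d0 : 0 < d by rewrite divr_gt0.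
have [Z vZ hZ] := XZ d d0; have [r r0 H] := vZ _ e2.
exists (Num.min r 1); first by rewrite lt_min r0 ltr01.
move=> h h0; rewrite lt_min => /andP[hr h1].
rewrite (le_trans (hZ h h0 (ltW h1)))// [leRHS]splitr lerD ?H//.
rewrite (@le_trans _ _ ((`|K| + 1) * d))//.
  by rewrite ler_wpM2r ?(ltW d0)// (le_trans (ler_norm K))// lerDl.
by rewrite /d mulrC divfK// gt_eqF.
Qed.

Lemma smooth_incr_bounds phi : strip_smooth alpha phi -> exists2 K : R, 0 <= K &
  forall h, `|h| <= 1 ->
    N (sc (fun x => incr h phi x - h * (grad phi x).2)) <= `|h| `^ p * (`|h| `^ p * K) /\
    N (fun x => grad phi (x + h *: e2) - grad phi x) <= `|h| `^ p * K.
Proof.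
move=> sphi.
have [M0 [B0 [M00 h0]]] := strip_smooth_increments e2 sphi.
have [M1 [B1 [M10 h1]]] := strip_smooth_increments e2 (strip_smooth_derive ((1, 0) : R * R) sphi).
have [M2 [B2 [M20 h2]]] := strip_smooth_increments e2 (strip_smooth_derive e2 sphi).
pose B := Num.max B0 (Num.max B1 B2); pose M := M0 + (M1 + M2).
have M'0 : 0 <= M by rewrite !addr_ge0.
have bB x : 0 <= box B x := box_ge0 _ _.
have b0 x : box B0 x <= box B x by rewrite le_box// le_max lexx.
have b1 x : box B1 x <= box B x by rewrite le_box// !le_max lexx orbT.
have b2 x : box B2 x <= box B x by rewrite le_box// !le_max lexx !orbT.
have Lb : Lpv p (sc (box B)).
  apply: (Lpv_box hp (M := 1) (B := B)); first by split; [exact: pint_mes (pint_box B)|exact: mes_cst].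
  by move=> x; rewrite enorm_sc mul1r ger0_norm.
have [L1 L2] := strip_smooth_Lpv hp sphi.
exists (M `^ p * N (sc (box B))); first by rewrite mulr_ge0 ?powR_ge0 ?Lpint_ge0.
move=> h hh; have hM : 0 <= M * `|h| by rewrite mulr_ge0.
split.
  have hM2 : 0 <= `|h| * (M * `|h|) by rewrite mulr_ge0.
  rewrite (_ : _ * (_ * _) = (`|h| * (M * `|h|)) `^ p * N (sc (box B))); last first.
    by rewrite !powRM//; ring.
  have [Li _] := Lpv_incr h L1.
  have [||//] := @Lpv_le _ p hp (sc (fun x => incr h phi x - h * (grad phi x).2)) (sc (box B)) (`|h| * (M * `|h|)) _ Lb hM2.
    split; last exact: mes_cst.
    apply: mesB; first by case/Lpv_sc : Li.
    by apply: mesM; [exact: mes_cst|case: L2 => -[]].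
  move=> x; rewrite !enorm_sc (ger0_norm (bB x)) (le_trans (h0 h x hh).2)//.
  have -> : `|h| * (M * `|h|) = M * h ^+ 2 by rewrite mulrCA -expr2 real_normK ?num_real.
  apply: ler_pM; [|exact: box_ge0| |exact: b0].
    by apply: mulr_ge0 => //; exact: sqr_ge0.
  apply: ler_wpM2r; first exact: sqr_ge0.
  by rewrite lerDl addr_ge0.
rewrite [leRHS]mulrCA [leRHS]mulrA -powRM//.
have [||//] := @Lpv_le _ p hp (fun x => grad phi (x + h *: e2) - grad phi x) (sc (box B)) (M * `|h|) _ Lb hM.
  by case: (LpvB hp (Lpv_shift (h *: e2) L2).1 L2).
move=> x; rewrite enorm_sc (ger0_norm (bB x)) (le_trans (ler_enorm_sum _))// !coordE /M.
have Ph (A : R) : 0 <= A -> 0 <= A * `|h| by move=> A0; exact: mulr_ge0.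
rewrite !mulrDl -[leLHS]add0r; apply: lerD; first exact: mulr_ge0 (Ph _ M00) (bB x).
apply: lerD.
  by apply: (le_trans (h1 h x hh).1); apply: ler_wpM2l => //; exact: Ph.
by apply: (le_trans (h2 h x hh).1); apply: ler_wpM2l => //; exact: Ph.
Qed.

(** Continuity of translations in L^p, by density: the gradient of a fixed approximant moves by
    [O(h)], and the translate of the remainder is as small as the remainder. *)
Lemma in_closure_grad_shift w g : in_closure alpha p w g ->
  vanish (fun h => N (fun x => g (x + h *: e2) - g x)).
Proof.
move=> [Lw Lg cw]; have T2 : 0 <= 2 `^ p :> R := powR_ge0 _ _.
apply: (@vanish_split _ (2 `^ p * (2 `^ p * 2))) => d d0.
have [phi [s1 _ h2]] := cw d d0; have [_ P2] := strip_smooth_Lpv hp s1.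
have [K K0 hK] := smooth_incr_bounds s1.
exists (fun h => 2 `^ p * K * `|h| `^ p).
  by apply: vanishZ; [rewrite mulr_ge0|exact: vanish_powR].
move=> h h0 h1.
have LD := LpvB hp Lg P2; have [LDs NDs] := Lpv_shift (h *: e2) LD.
have [LPs _] := Lpv_shift (h *: e2) P2.
have -> : (fun x => g (x + h *: e2) - g x) =
   (fun x => ((g (x + h *: e2) - grad phi (x + h *: e2)) + - (g x - grad phi x)) +
      (grad phi (x + h *: e2) - grad phi x)).
  by apply/funext => x; apply: injective_projections; rewrite !coordE; ring.
have LE := LpvD hp LDs (LpvN hp LD); have LF := LpvB hp LPs P2.
apply: (le_trans (LpintD_le2 hp LE LF)); rewrite mulrDr; apply: lerD.
  rewrite -[leRHS]mulrA; apply: (ler_wpM2l T2).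
  apply: (le_trans (LpintD_le2 hp LDs (LpvN hp LD))); rewrite LpintN NDs.
  have h2' := ltW h2; rewrite -[leRHS]mulrA; apply: (ler_wpM2l T2).
  by rewrite mulr_natl mulr2n; apply: lerD.
rewrite -[leRHS]mulrA; apply: (ler_wpM2l T2); rewrite mulrC; exact: (hK h h1).2.
Qed.

(** The difference quotients in x_2 converge in L^p to the second component of the gradient. For a
    smooth approximant the error is of order [h]; for the remainder [in_closure_incr_le] bounds the
    quotients uniformly in [h]. *)
Lemma in_closure_incr_linear w g : in_closure alpha p w g ->
  vanish (fun h => N (sc (fun x => incr h w x - h * (g x).2)) / `|h| `^ p).
Proof.
move=> cwg; have [Lw Lg cw] := cwg; have T2 : 0 <= 2 `^ p :> R := powR_ge0 _ _.
apply: (@vanish_split _ (2 `^ p * (2 `^ p * (8 `^ p + 1)))) => d d0.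
have [phi [s1 _ h2]] := cw d d0; have [P1 P2] := strip_smooth_Lpv hp s1.
have [K K0 hK] := smooth_incr_bounds s1.
exists (fun h => 2 `^ p * K * `|h| `^ p).
  by apply: vanishZ; [rewrite mulr_ge0|exact: vanish_powR].
move=> h h0 h1; have hp0 : 0 < `|h| `^ p by rewrite powR_gt0.
rewrite ler_pdivrMr//.
have cD := in_closureB cwg (smooth_in_closure hp s1).
have [LDw LDg _] := cD.
have [L3 N3] := N_snd LDg.
have N4 := in_closure_incr_le h cD.
have [Li _] := Lpv_incr h LDw.
have [Lj _] := Lpv_incr h P1; have [Lk _] := N_snd P2.
have LF : Lpv p (sc (fun x => incr h phi x - h * (grad phi x).2)).
  by rewrite -scB -scZ; apply: (LpvB hp Lj); exact: LpvZc.
have LG : Lpv p (sc (fun x => - h * (g x - grad phi x).2)).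
  by rewrite -(scZ (fun=> - h)); exact: (LpvZc hp (- h) L3).
have NG : N (sc (fun x => - h * (g x - grad phi x).2)) <= `|h| `^ p * d.
  rewrite -(scZ (fun=> - h)) (LpintZc _ L3) normrN; apply: ler_wpM2l; first exact: powR_ge0.
  exact: le_trans N3 (ltW h2).
have e0 : sc (fun x => incr h w x - h * (g x).2) = (fun x =>
    (sc (incr h (fun x => w x - phi x)) x + sc (fun x => - h * (g x - grad phi x).2) x) +
     sc (fun x => incr h phi x - h * (grad phi x).2) x).
  by apply/funext => x; apply: injective_projections; rewrite /sc /incr !coordE /=; ring.
rewrite e0 (le_trans (LpintD_le2 hp (LpvD hp Li LG) LF))//.
have H1 := LpintD_le2 hp Li LG.
have H2 : N (sc (incr h (fun x => w x - phi x))) <= `|h| `^ p * (8 `^ p * d).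
  rewrite (le_trans N4)// mulrCA ler_wpM2l ?(ltW hp0)// ler_wpM2l ?powR_ge0//.
  exact: le_trans N3 (ltW h2).
have H3 := le_trans H1 (ler_wpM2l T2 (lerD H2 NG)).
rewrite (le_trans (ler_wpM2l T2 (lerD H3 (hK h h1).1)))//.
by rewrite le_eqVlt; apply/orP; left; apply/eqP; ring.
Qed.

End difference_quotients.

(** * Absence of eigenvalues *)

Section inner_variation.
Context {R : realType} (alpha p : R) (hp : 1 < p).
Local Notation sc := scalar_field.
Local Notation N := (Lpint p).
Local Notation e2 := ((0, 1) : R * R).
Local Notation dual := (pairing p).
Local Notation ndual := (npairing p).
Implicit Types (f u w phi psi : R * R -> R) (g k : R * R -> R * R).

Let p0 : 0 < p. Proof. exact: lt_trans hp. Qed.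
Let p10 : 0 < p - 1. Proof. by rewrite subr_gt0. Qed.

Lemma powR1p (t : R) : 0 < t -> t `^ (1 - p) * t `^ p = t.
Proof.
move=> t0; rewrite -powRD; last by rewrite (gt_eqF t0) implybT.
by rewrite subrK powRr1// ltW.
Qed.

(** Young's parameter [d * h] is matched to the size [h] of [b]: since [h^(1 - p) * h^p = h], both
    terms carry the factor [h]. *)
Lemma npair_scaled (a b : R * R -> R * R) (d h K : R) : 0 < d -> 0 < h ->
  Lpv p a -> Lpv p b -> N b <= K * h `^ p ->
  ndual a b <= h * (d * N a + d `^ (1 - p) * K).
Proof.
move=> d0 h0 La Lb Nb; have dh : 0 < d * h by rewrite mulr_gt0.
have [_ H] := npairing_le hp dh La Lb; apply: (le_trans H).
have Nb' := ler_wpM2l (powR_ge0 (d * h) (1 - p)) Nb.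
apply: (le_trans (lerD (lexx _) Nb')).
rewrite powRM ?(ltW d0) ?(ltW h0)//.
rewrite (_ : d `^ (1 - p) * h `^ (1 - p) * (K * h `^ p) =
   d `^ (1 - p) * K * (h `^ (1 - p) * h `^ p)); last by ring.
by rewrite powR1p// le_eqVlt; apply/orP; left; apply/eqP; ring.
Qed.

(** The term with the arbitrary factor [d] is of order [h] by the size of [b h], while the other one
    is controlled by the vanishing [c h]; the change is therefore o(h). *)
Lemma pairing_perturb (a : R * R -> R * R) (c b : R -> R * R -> R * R) (K : R) :
  Lpv p a -> (forall h, Lpv p (c h)) -> (forall h, Lpv p (b h)) -> 0 <= K ->
  (forall h, N (b h) <= K * `|h| `^ p) -> vanish (fun h => N (c h)) ->
  vanish (fun h => `|dual (fun x => a x + c h x) (b h) - dual a (b h)| / `|h|).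
Proof.
move=> La Lc Lb K0 Nb vc; apply: (@vanish_split _ _ (N a + K + 1)) => d d0.
have [C C0 hC] := pairing_continuity hp d0.
have CK : 0 <= C * K by rewrite mulr_ge0.
have [r r0 hr] := powR_small p10 CK d0.
(* A large [k] makes [k^(1 - p)] small because [p > 1], which absorbs the part free of [c h] into
   [d]; the other part multiplies the vanishing [N (c h)]. *)
pose k := r^-1; have k0 : 0 < k by rewrite invr_gt0.
have kd : C * (k `^ (1 - p) * K) <= d.
  have := hr r (ltW r0) (lexx _).
  have -> : k `^ (1 - p) = r `^ (p - 1).
    by rewrite /k -powR_inv1 ?(ltW r0)// -powRrM mulN1r opprB.
  by rewrite mulrCA.
exists (fun h => C * k * N (c h)).
  by apply: vanishZ => //; rewrite mulr_ge0// ltW.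
move=> h h0 h1; rewrite ler_pdivrMr//.
apply: (le_trans (hC a (c h) (b h) La (Lc h) (Lb h))).
have n1 := npair_scaled ltr01 h0 La (Lb h) (Nb h).
have n2 := npair_scaled k0 h0 (Lc h) (Lb h) (Nb h).
have n1' := ler_wpM2l (ltW d0) n1; have n2' := ler_wpM2l C0 n2.
apply: (le_trans (lerD n1' n2')).
rewrite powR1 !mul1r.
have kh := ler_wpM2l (ltW h0) kd.
rewrite [leLHS](_ : _ = `|h| * (d * (N a + K)) + `|h| * (C * k * N (c h)) +
   `|h| * (C * (k `^ (1 - p) * K))); last by ring.
rewrite [leRHS](_ : _ = `|h| * (d * (N a + K)) + `|h| * (C * k * N (c h)) + `|h| * d); last by ring.
by rewrite lerD2l.
Qed.

Lemma pairing_vanish (a : R * R -> R * R) (b : R -> R * R -> R * R) :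
  Lpv p a -> (forall h, Lpv p (b h)) -> vanish (fun h => N (b h) / `|h| `^ p) ->
  vanish (fun h => `|dual a (b h)| / `|h|).
Proof.
move=> La Lb vb; apply: (@vanish_split _ _ (N a)) => d d0.
exists (fun h => d `^ (1 - p) * (N (b h) / `|h| `^ p)).
  by apply: vanishZ => //; exact: powR_ge0.
move=> h h0 h1; rewrite ler_pdivrMr//.
have hp0 : 0 < `|h| `^ p by exact: powR_gt0.
apply: (le_trans (norm_pairing_le hp La (Lb h))).
have Nb : N (b h) <= N (b h) / `|h| `^ p * `|h| `^ p by rewrite divfK// gt_eqF.
apply: (le_trans (npair_scaled d0 h0 La (Lb h) Nb)).
by rewrite mulrC (mulrC d).
Qed.

Lemma pintM_bounded (th f : R * R -> R) (K : R) : mes th -> (forall x, `|th x| <= K) ->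
  pint f -> pint (fun x => th x * f x).
Proof.
move=> mth thK pf; apply: (pint_le _ _ (pintZ K (pint_norm pf))).
  by apply: mesM => //; exact: pint_mes.
by move=> x; rewrite normrM ler_wpM2r.
Qed.

Lemma derive_snd (f : R -> R) v (x : R * R) : 'D_v (fun x : R * R => f x.2) x = 'D_(v.2) f x.2.
Proof. exact: (derive_comp_affine f (l := snd) (L := snd)). Qed.

Lemma smooth_snd (f : R -> R) : smooth f -> smooth (fun x : R * R => f x.2).
Proof. by move=> sf k; apply: (Ck_comp_affine (L := snd)) => //; exact: snd_continuous. Qed.

Lemma smooth_derive1 (f : R -> R) : smooth f -> smooth ('D_1 f).
Proof. by move=> sf k; have [_ /(_ 1)[]] := sf k.+1. Qed.

Context (lambda : R) (U : R * R -> R) (G : R * R -> R * R) (l0 : 0 <= lambda)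
  (cUG : in_closure alpha p U G)
  (weak : forall phi, strip_smooth alpha phi ->
    dual G (grad phi) = lambda * dual (sc U) (sc phi)).

Context (f : R -> R) (K : R) (sf : smooth f) (f01 : forall y, 0 <= f y <= 1) (K1 : 1 <= K)
  (fK : forall y, `|'D_1 f y| <= K) (ffK : forall y, `|'D_1 ('D_1 f) y| <= K).

Let th (x : R * R) := f x.2.
Let th' (x : R * R) := 'D_1 f x.2.
Let LU : Lpv p (sc U). Proof. by case: cUG. Qed.
Let LG : Lpv p G. Proof. by case: cUG. Qed.
Let K0 : 0 <= K. Proof. exact: le_trans K1. Qed.
Let sth : smooth th. Proof. exact: smooth_snd. Qed.
Let sth' : smooth th'. Proof. exact: (smooth_snd (smooth_derive1 sf)). Qed.
Let mth : mes th. Proof. exact: mes_continuous (Ck_continuous (sth 0%N)). Qed.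
Let mth' : mes th'. Proof. exact: mes_continuous (Ck_continuous (sth' 0%N)). Qed.
Let thK x : `|th x| <= K.
Proof. by have /andP[h0 h1] := f01 x.2; rewrite /th ger0_norm// (le_trans h1). Qed.

Let gradth x : grad th x = (0, th' x).
Proof. by rewrite /grad !derive_snd /= derive0. Qed.

Let gradthK x : enorm (grad th x) <= K.
Proof. by rewrite gradth enorm_snd fK. Qed.

Let mgradth : mesv (grad th).
Proof.
split; first by under eq_fun do rewrite gradth; exact: mes_cst.
by under eq_fun do rewrite gradth; exact: mth'.
Qed.

(** [b1 h] is the test function of the overview and [c2 h] its gradient; [b2 h] is the part of that
    gradient in which the weight is differentiated. *)
Let D h := incr h U.
Let dG h x := G (x + h *: e2) - G x.
Let b1 h := sc (fun x => D h x * th x).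
Let b2 h x := D h x *: grad th x.
Let c2 h x := th x *: dG h x + b2 h x.

Let cD h : in_closure alpha p (D h) (dG h).
Proof. by apply: in_closureB => //; apply: in_closure_shift => //; rewrite !coordE mulr0. Qed.

Let cDth h : in_closure alpha p (fun x => D h x * th x) (c2 h).
Proof. exact: in_closure_mul. Qed.

Let LD h : Lpv p (sc (D h)). Proof. by case: (cD h). Qed.
Let LdG h : Lpv p (dG h). Proof. by case: (cD h). Qed.
Let Lb1 h : Lpv p (b1 h). Proof. by case: (cDth h). Qed.
Let Lc2 h : Lpv p (c2 h). Proof. by case: (cDth h). Qed.
Let KD := 8 `^ p * N (sc (fun x => (G x).2)).
Let ND h : N (sc (D h)) <= KD * `|h| `^ p.
Proof. by rewrite /KD mulrAC -mulrA; exact: (in_closure_incr_le hp h cUG). Qed.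

Let Lb2 h : Lpv p (b2 h) /\ N (b2 h) <= K `^ p * N (sc (D h)).
Proof.
apply: Lpv_le => //; first by apply: mesvZ => //; case/Lpv_sc : (LD h).
by move=> x; rewrite enormZ enorm_sc mulrC ler_wpM2r.
Qed.

Let Nb1 h : N (b1 h) <= K `^ p * N (sc (D h)).
Proof.
have -> : b1 h = (fun x => th x *: sc (D h) x).
  by rewrite /b1 scZ; under eq_fun do rewrite mulrC.
by apply: (LpvZ hp mth (LD h) thK).2.
Qed.

Let pG : pint (fun x => enorm (G x) `^ p). Proof. by case: LG. Qed.
Let pU : pint (fun x => enorm (sc U x) `^ p). Proof. by case: LU. Qed.

(** The translation is moved from [q], which is merely integrable, to the smooth weight, which can
    be expanded in [h]. *)
Let Int_th_shift (q : R * R -> R) h : pint q ->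
  pint (fun x => th x * q (x + h *: e2)) /\
  Int (fun x => th x * q (x + h *: e2)) = Int (fun x => th (x + (- h) *: e2) * q x).
Proof.
move=> pq.
have pt : pint (fun x => th (x + (- h) *: e2) * q x).
  by apply: (pintM_bounded _ _ pq); [exact: mes_shift|move=> x; exact: thK].
have [] := Int_shift (h *: e2) pt.
have -> : (fun x => th (x + h *: e2 + (- h) *: e2) * q (x + h *: e2)) =
   (fun x => th x * q (x + h *: e2)).
  by apply/funext => x; rewrite -addrA -scalerDl subrr scale0r addr0.
by [].
Qed.

(** The first-order part of [b2 h], in which the increment of [U] is replaced by [h] times the
    second component of [G]. *)
Let B3 h := fun x => h *: ((0, th' x * (G x).2) : R * R).
Let LthG : Lpv p (fun x => (0, th' x * (G x).2) : R * R).
Proof.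
apply: (@Lpv_le _ p hp _ G K _ LG K0 _).1.
  by split; [exact: mes_cst|apply: mesM => //; case: LG => -[]].
move=> x; rewrite enorm_snd normrM; apply: ler_pM => //; first exact: fK.
exact: ler_snd_enorm.
Qed.

Let E1 := Int (fun x => th' x * (lambda * enorm (sc U x) `^ p - enorm (G x) `^ p)).
Let E2 := dual G (fun x => (0, th' x * (G x).2)).

(** The field [a = G + th (G(x + h e_2) - G)] is a pointwise convex combination of [G] and its
    translate, which bounds [N a]. Since [a] differs from [A = G + c2 h] by [b2 h], the tangent
    inequality at [A] compares [N A] with [N a], and the one at [G] brings in the pairing with
    [c2 h]. *)
Let convexity_G h :
  p * dual G (c2 h) <= Int (fun x => th (x + (- h) *: e2) * enorm (G x) `^ p)
    - Int (fun x => th x * enorm (G x) `^ p) + p * dual (fun x => G x + c2 h x) (b2 h).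
Proof.
pose A x := G x + c2 h x; pose a x := G x + th x *: dG h x.
have LA : Lpv p A := LpvD hp LG (Lc2 h).
have La : Lpv p a := LpvD hp LG (LpvZ hp mth (LdG h) thK).1.
have S1 := Lpint_convex hp LG LA.
have S2 := Lpint_convex hp LA La.
have eA : (fun x => A x - G x) = c2 h.
  by apply/funext => x; rewrite /A addrAC subrr add0r.
have ea : (fun x => a x - A x) = (fun x => (-1) *: b2 h x).
  by apply/funext => x; apply: injective_projections; rewrite /a /A /c2 !coordE; ring.
rewrite eA in S1; rewrite ea (pairingZ hp _ LA (Lb2 h).1) in S2.
have [p1 i1] := Int_th_shift h pG.
have p2 := pintM_bounded mth thK pG.
have S3 : N a <= N G - Int (fun x => th x * enorm (G x) `^ p)
    + Int (fun x => th x * enorm (G (x + h *: e2)) `^ p).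
  have pB := pintB pG p2; rewrite Lpint.unlock -(IntB pG p2) -(IntD pB p1).
  apply: le_Int; [exact: La.2|exact: (pintD pB p1)|move=> x].
  apply: (le_trans (enorm_powR_comb hp (G x) (G (x + h *: e2)) (f01 x.2))).
  by rewrite mulrBl mul1r.
rewrite i1 in S3.
by lra.
Qed.

(** The tangent inequality is taken at the translated value and weighted by [th >= 0]. It bounds
    from the opposite side than [convexity_G], so that the weak equation can link the two. *)
Let convexity_U h :
  Int (fun x => th (x + (- h) *: e2) * enorm (sc U x) `^ p)
    - Int (fun x => th x * enorm (sc U x) `^ p) <=
  p * dual (fun x => sc U x + sc (D h) x) (b1 h).
Proof.
have [p1 i1] := Int_th_shift h pU.
have p2 := pintM_bounded mth thK pU.
rewrite -i1 -(IntB p1 p2) pairing.unlock.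
have LUD := LpvD hp LU (LD h).
have pp := pint_pairing hp LUD (Lb1 h).
rewrite -(IntZ p pp); apply: le_Int; [exact: (pintB p1 p2)|exact: (pintZ p pp)|move=> x].
have -> : sc U x + sc (D h) x = sc U (x + h *: e2).
  by apply: injective_projections; rewrite /sc !coordE /= /D /incr; ring.
have := enorm_powR_convex hp (sc U (x + h *: e2)) (sc U x).
have -> : sc U x - sc U (x + h *: e2) = (-1) *: sc (D h) x.
  by apply: injective_projections; rewrite /sc !coordE /= /D /incr; ring.
have -> : b1 h x = th x *: sc (D h) x.
  by rewrite /b1 /sc; apply: injective_projections; rewrite !coordE /=; ring.
rewrite !dotZr => H; rewrite -mulrBr mulrCA.
have /andP[t0 _] := f01 x.2.
apply: ler_wpM2l => //; rewrite lerBlDr -lerBlDl.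
by move: H; rewrite mulN1r mulrN.
Qed.

Let th_increment h x : `|th (x + (- h) *: e2) - th x + h * th' x| <= K * h ^+ 2.
Proof.
have Df y : 'D_e2 th y = th' y := derive_snd f e2 y.
have DDf y : `|'D_e2 ('D_e2 th) y| <= K.
  have -> : 'D_e2 th = th' by apply/funext => z; exact: Df.
  by have -> : 'D_e2 th' y = 'D_1 ('D_1 f) y.2 := derive_snd ('D_1 f) e2 y.
have := second_increment_le (sth 2%N) DDf x (- h).
by rewrite (Df x) mulNr opprK sqrrN.
Qed.

Let weighted_increment (q : R * R -> R) h : pint q -> (forall x, 0 <= q x) ->
  `|Int (fun x => th (x + (- h) *: e2) * q x) - Int (fun x => th x * q x)
    + h * Int (fun x => th' x * q x)| <= K * h ^+ 2 * Int q.
Proof.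
move=> pq q0.
have p1 : pint (fun x => th (x + (- h) *: e2) * q x).
  by apply: (pintM_bounded _ _ pq); [exact: mes_shift|move=> x; exact: thK].
have p2 := pintM_bounded mth thK pq.
have p3 : pint (fun x => th' x * q x) by apply: (pintM_bounded mth' (K := K)) => // x; exact: fK.
have p12 := pintB p1 p2; have p3h := pintZ h p3.
rewrite -(IntB p1 p2) -(IntZ h p3) -(IntD p12 p3h) -(IntZ _ pq).
apply: norm_Int_le; [exact: pintD|exact: pintZ|move=> x].
rewrite mulrA -mulrBl -mulrDl normrM (ger0_norm (q0 x)); apply: ler_wpM2r => //.
Qed.

Let err1 h := `|dual (fun x => sc U x + sc (D h) x) (b1 h) - dual (sc U) (b1 h)|.
Let err2 h := `|dual (fun x => G x + c2 h x) (b2 h) - dual G (b2 h)|.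
Let err3 h := `|dual G (fun x => b2 h x - B3 h x)|.

(** The weak equation identifies the pairing of [G] with [c2 h] and [lambda] times that of [U] with
    [b1 h]. [convexity_G] and [lambda >= 0] times [convexity_U] are chained through it, and the
    weights are then expanded to first order. *)
Let variation_ineq h :
  0 <= h * (E1 + p * E2) + (lambda * p * err1 h + p * err2 h + p * err3 h
    + K * h ^+ 2 * (lambda * N (sc U) + N G)).
Proof.
have eq := weak_equation_closure hp LU LG weak (cDth h).
have HG := convexity_G h; have HU := ler_wpM2l l0 (convexity_U h).
have WG := weighted_increment h pG (fun x => powR_ge0 _ _).
have WU := weighted_increment h pU (fun x => powR_ge0 _ _).
have p1 : pint (fun x => th' x * enorm (G x) `^ p).
  by apply: (pintM_bounded mth' (K := K)) => // x; exact: fK.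
have p2 : pint (fun x => th' x * enorm (sc U x) `^ p).
  by apply: (pintM_bounded mth' (K := K)) => // x; exact: fK.
have e1 : E1 = lambda * Int (fun x => th' x * enorm (sc U x) `^ p) - Int (fun x => th' x * enorm (G x) `^ p).
  rewrite /E1 -IntZ// -IntB//; last exact: pintZ.
  by congr Int; apply/funext => x; ring.
have e3 : dual G (b2 h) = h * E2 + dual G (fun x => b2 h x - B3 h x).
  rewrite (pairingB hp LG (Lb2 h).1 (LpvZc hp h LthG)) (pairingZ hp _ LG LthG).
  by rewrite /E2; ring.
have lp0 : 0 <= lambda * p by rewrite mulr_ge0// ltW.
have m1 := ler_wpM2l lp0 (ler_norm (dual (fun x => sc U x + sc (D h) x) (b1 h) - dual (sc U) (b1 h))).
rewrite -/(err1 h) in m1.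
have m2 := ler_wpM2l (ltW p0) (ler_norm (dual (fun x => G x + c2 h x) (b2 h) - dual G (b2 h))).
rewrite -/(err2 h) in m2.
have m3 := ler_wpM2l (ltW p0) (ler_norm (dual G (fun x => b2 h x - B3 h x))).
rewrite -/(err3 h) in m3.
have NGE : N G = Int (fun x => enorm (G x) `^ p) by rewrite Lpint.unlock.
have NUE : N (sc U) = Int (fun x => enorm (sc U x) `^ p) by rewrite Lpint.unlock.
rewrite -NGE in WG; rewrite -NUE in WU.
move: WG; rewrite ler_norml => /andP[_ WG].
move: WU; rewrite ler_norml => /andP[WU _].
have {}WU := ler_wpM2l l0 WU.
have eqp : p * dual G (c2 h) = p * (lambda * dual (sc U) (b1 h)) by rewrite eq.
rewrite eqp e3 in HG m2 *.
rewrite e1.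
clear eq eqp e1 e3 NGE NUE p1 p2.
move: HG HU WG WU m1 m2 m3.
generalize (dual (sc U) (b1 h)) (dual (fun x => sc U x + sc (D h) x) (b1 h))
  (dual (fun x => G x + c2 h x) (b2 h)) (dual G (fun x => b2 h x - B3 h x))
  (Int (fun x => th (x + (- h) *: e2) * enorm (G x) `^ p))
  (Int (fun x => th (x + (- h) *: e2) * enorm (sc U x) `^ p))
  (Int (fun x => th x * enorm (G x) `^ p)) (Int (fun x => th x * enorm (sc U x) `^ p))
  (Int (fun x => th' x * enorm (G x) `^ p)) (Int (fun x => th' x * enorm (sc U x) `^ p))
  (err1 h) (err2 h) (err3 h) E2 (N (sc U)) (N G).
move=> *; lra.
Qed.

Let vanish_sq : vanish (fun h => K * h ^+ 2 * (lambda * N (sc U) + N G) / `|h|).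
Proof.
have C0 : 0 <= K * (lambda * N (sc U) + N G).
  by rewrite mulr_ge0// addr_ge0 ?mulr_ge0 ?Lpint_ge0.
apply: (@vanish_near _ _ (fun h => K * (lambda * N (sc U) + N G) * `|h| `^ 1)); last first.
  by apply: vanishZ => //; exact: vanish_powR.
move=> h h0 _; rewrite powRr1// ler_pdivrMr// le_eqVlt; apply/orP; left; apply/eqP.
rewrite -[h ^+ 2]real_normK ?num_real//.
ring.
Qed.

Let KD0 : 0 <= KD. Proof. by rewrite mulr_ge0 ?powR_ge0 ?Lpint_ge0. Qed.

Let Nb_bound (b : R -> R * R -> R * R) : (forall h, N (b h) <= K `^ p * N (sc (D h))) ->
  forall h, N (b h) <= K `^ p * KD * `|h| `^ p.
Proof.
move=> H h; apply: (le_trans (H h)); rewrite -mulrA; apply: ler_wpM2l; [exact: powR_ge0|exact: ND].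
Qed.

Let vanish_ND (C : R) : 0 <= C -> vanish (fun h => C * N (sc (D h))).
Proof.
move=> C0; apply: vanishZ => //; apply: (vanish_le ND); apply: vanishZ => //.
exact: vanish_powR.
Qed.

Let vanish_c2 : vanish (fun h => N (c2 h)).
Proof.
have T2 : 0 <= 2 `^ p :> R := powR_ge0 _ _.
apply: (@vanish_le _ _ (fun h => 2 `^ p * (K `^ p * N (dG h) + K `^ p * N (sc (D h))))).
  move=> h; have [L1 N1] := LpvZ hp mth (LdG h) thK; have [L2 N2] := Lb2 h.
  apply: (le_trans (LpintD_le2 hp L1 L2)); apply: ler_wpM2l => //.
  exact: lerD.
apply: vanishZ => //; apply: vanishD; last exact: vanish_ND (powR_ge0 _ _).
apply: vanishZ; first exact: powR_ge0.
exact: (in_closure_grad_shift hp cUG).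
Qed.

Let vanish_err3 : vanish (fun h => err3 h / `|h|).
Proof.
apply: (pairing_vanish LG (fun h => LpvB hp (Lb2 h).1 (LpvZc hp h LthG))).
have KV : 0 <= K `^ p := powR_ge0 _ _.
apply: (@vanish_near _ _ (fun h => K `^ p * (N (sc (fun x => D h x - h * (G x).2)) / `|h| `^ p))); last first.
  by apply: vanishZ => //; exact: (in_closure_incr_linear hp cUG).
move=> h h0 _; rewrite mulrA ler_pM2r ?invr_gt0 ?powR_gt0//.
have LGs := (N_snd hp LG).1.
have LF : Lpv p (sc (fun x => D h x - h * (G x).2)).
  by rewrite -scB -(scZ (fun=> h)); exact: (LpvB hp (LD h) (LpvZc hp h LGs)).
have -> : (fun x => b2 h x - B3 h x) = (fun x => th' x *: ((0, D h x - h * (G x).2) : R * R)).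
  apply/funext => x; rewrite /b2 /B3 gradth; apply: injective_projections; rewrite !coordE /=; ring.
apply: (@Lpv_le _ p hp _ _ K _ LF K0 _).2.
  apply: mesvZ => //; split; first exact: mes_cst.
  by case/Lpv_sc : LF.
move=> x; rewrite enormZ enorm_snd enorm_sc; apply: ler_wpM2r => //; exact: fK.
Qed.

Lemma inner_variation : E1 + p * E2 = 0.
Proof.
have KV : 0 <= K `^ p := powR_ge0 _ _.
have KKD : 0 <= K `^ p * KD by rewrite mulr_ge0.
have v1 : vanish (fun h => err1 h / `|h|).
  apply: (@pairing_perturb _ _ b1 (K `^ p * KD)) => //; first exact: Nb_bound.
  by have := vanish_ND ler01; under eq_fun do rewrite mul1r.
have v2 : vanish (fun h => err2 h / `|h|).
  exact: (pairing_perturb LG Lc2 (fun h => (Lb2 h).1) KKD (Nb_bound (fun h => (Lb2 h).2)) vanish_c2).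
have lp0 : 0 <= lambda * p by rewrite mulr_ge0// ltW.
pose err h := lambda * p * (err1 h / `|h|) + p * (err2 h / `|h|) + p * (err3 h / `|h|)
  + K * h ^+ 2 * (lambda * N (sc U) + N G) / `|h|.
have verr : vanish err.
  apply: vanishD => //; apply: vanishD; [apply: vanishD|]; apply: vanishZ => //; exact: ltW.
apply/eqP; rewrite -normr_le0; apply/ler_addgt0Pr => e e0; rewrite add0r.
have [r r0 H] := verr e e0.
(* Division by [|h|] leaves the sign of [h] in front of the bracket; [r / 2] and [- (r / 2)] bound
   it from both sides. *)
have key h : `|h| = r / 2 -> - (h / `|h|) * (E1 + p * E2) <= e.
  move=> hr; have hp0 : 0 < `|h| by rewrite hr divr_gt0.
  apply: (le_trans _ (H h hp0 _)); last by rewrite hr; lra.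
  have := variation_ineq h; rewrite -(ler_pM2r (_ : 0 < `|h|^-1)) ?invr_gt0// mul0r.
  rewrite /err mulNr => V; rewrite -subr_ge0; apply: (le_trans V).
  rewrite le_eqVlt; apply/orP; left; apply/eqP; ring.
have r2 : 0 < r / 2 by rewrite divr_gt0.
have r22 : r / 2 / (r / 2) = 1 by rewrite divff ?gt_eqF.
have n2 : `|- (r / 2)| = r / 2 by rewrite normrN gtr0_norm.
have k1 := key (r / 2) (gtr0_norm r2); rewrite (gtr0_norm r2) r22 in k1.
have k2 := key (- (r / 2)) n2; rewrite n2 [- (r / 2) / _]mulNr r22 in k2.
by rewrite ler_norml; apply/andP; split; lra.
Qed.

End inner_variation.

Section eigen.
Context {R : realType}.

(** Dominated convergence along the frequencies 1/(n+1), with majorant [|q|]: the cosines tend to 1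
    pointwise. *)
Lemma Int_cos_limit (q : R * R -> R) : pint q ->
  (forall n : nat, Int (fun x => cos (n.+1%:R^-1 * x.2) * q x) = 0) -> Int q = 0.
Proof.
move=> pq H; have Iq : (@leb2 R).-integrable setT (EFin \o q) by rewrite -pintE.
pose c (n : nat) : R := n.+1%:R^-1.
pose F n x := (cos (c n * x.2) * q x)%:E.
have mcos n : mes (fun x : R * R => cos (c n * x.2)).
  apply: mes_continuous => x; apply: continuous_comp; last exact: continuous_cos.
  by apply: cvgM; [exact: cvg_cst|exact: snd_continuous].
have mF n : measurable_fun setT (F n).
  by apply/measurable_EFinP; apply: mesM => //; exact: pint_mes.
have mq : measurable_fun setT (EFin \o q) by apply/measurable_EFinP; exact: pint_mes.
have cvgF : {ae @leb2 R, forall x, [set: measurableTypeR R * measurableTypeR R] x -> F n x @[n --> \oo] --> (EFin \o q) x}.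
  apply/aeW => x _; apply: cvg_EFin; first by near=> n.
  rewrite -[X in _ --> X]mul1r -cos0; apply: cvgM; last exact: cvg_cst.
  apply: continuous_cvg; first exact: continuous_cos.
  rewrite -[X in _ --> X](mul0r x.2); apply: cvgM; last exact: cvg_cst.
  exact: cvg_harmonic.
have dom : {ae @leb2 R, forall x n, [set: measurableTypeR R * measurableTypeR R] x -> (`|F n x| <= `|q x|%:E)%E}.
  apply/aeW => x n _; rewrite /F /= lee_fin normrM.
  by rewrite ler_piMl// ler_norml cos_geN1 cos_le1.
have Iq' : (@leb2 R).-integrable setT (fun x => `|q x|%:E).
  by have := pint_norm pq; rewrite pintE.
have [_ _ L] := @dominated_convergence _ _ _ (@leb2 R) setT measurableT F (EFin \o q) (fun x => `|q x|%:E)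
  mF mq cvgF Iq' dom.
have Z n : (\int[@leb2 R]_x F n x = 0)%E.
  rewrite /F EFin_Int ?H//; apply: (pintM_bounded (mcos n) (K := 1)) => // x.
  by rewrite ler_norml cos_geN1 cos_le1.
have L0 : (\int[@leb2 R]_x F n x)%E @[n --> \oo] --> 0%E.
  by under eq_fun do rewrite Z; exact: cvg_cst.
have eI : (\int[@leb2 R]_x (EFin \o q) x = (Int q)%:E)%E := EFin_Int pq.
rewrite eI in L.
by apply: EFin_inj; exact: (cvg_unique _ L L0).
Unshelve. all: by end_near. Qed.

Context (alpha p : R) (hp : 1 < p).
Local Notation sc := scalar_field.
Local Notation N := (Lpint p).
Local Notation e2 := ((0, 1) : R * R).
Local Notation dual := (pairing p).

Let p0 : 0 < p. Proof. exact: lt_trans hp. Qed.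

(** Pointwise |G_2|^p <= k |G|^p + k^-2 |G|^(p-2) G_2^2 for 0 < k <= 1, according to whether |G_2|
    <= k |G| or not. This handles p < 2 and p >= 2 alike, and [k] then tends to 0. *)
Lemma Lpint_snd_le (G : R * R -> R * R) : Lpv p G ->
  Int (fun x => dot (pfield p (G x)) (0, (G x).2)) = 0 -> N (sc (fun x => (G x).2)) = 0.
Proof.
move=> LG I0; apply/eqP; rewrite eq_le Lpint_ge0 andbT.
have LG2 : Lpv p (fun x => (0, (G x).2) : R * R).
  apply: (@Lpv_le _ p hp _ G 1 _ LG ler01 _).1.
    by split; [exact: mes_cst|case: LG => -[]].
  by move=> x; rewrite enorm_snd mul1r ler_snd_enorm.
have pd := pint_pairing hp LG LG2.
apply: (@ler_small _ (N G)) => k k0 k1; rewrite mulrC.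
have k2 : 0 < k ^- 2 by rewrite invr_gt0 exprn_gt0.
rewrite -[leRHS]addr0 -(mulr0 (k ^- 2)) -I0 Lpint.unlock.
have pG := pintZ k LG.2; have pV := pintZ (k ^- 2) pd.
rewrite -(IntZ k LG.2) -(IntZ (k ^- 2) pd) -(IntD pG pV).
apply: le_Int; [by have [[]] := N_snd hp LG|exact: pintD|move=> x].
rewrite enorm_sc /pfield dotZl /dot /= mulr0 add0r.
set A := enorm (G x); have A0 : 0 <= A := enorm_ge0 _; set t := (G x).2.
have Ap : A `^ p = A `^ (p - 2) * A ^+ 2 by rewrite (powRp hp A0) (powRp1 hp A0) expr2 mulrA.
have q0 : 0 <= A `^ (p - 2) * (t * t) by rewrite mulr_ge0 ?powR_ge0// -expr2 sqr_ge0.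
have [h|h] := leP `|t| (k * A).
  rewrite -[leLHS]addr0; apply: lerD; last by rewrite mulr_ge0// ltW.
  apply: (@le_trans _ _ ((k * A) `^ p)).
    by rewrite ge0_ler_powR ?nnegrE ?mulr_ge0 ?(ltW k0) ?(ltW p0).
  rewrite powRM ?(ltW k0)//; apply: ler_wpM2r; first exact: powR_ge0.
  by apply: ge1r_powR; [rewrite k0|exact: ltW].
rewrite -[leLHS]add0r; apply: lerD; first by rewrite mulr_ge0 ?powR_ge0 ?(ltW k0).
apply: (@le_trans _ _ (A `^ p)).
  by rewrite ge0_ler_powR ?nnegrE ?(ltW p0)//; exact: ler_snd_enorm.
rewrite Ap [leRHS]mulrCA; apply: ler_wpM2l; first exact: powR_ge0.
rewrite mulrC ler_pdivlMr ?exprn_gt0// -expr2 -[t ^+ 2]real_normK ?num_real//.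
rewrite -exprMn mulrC; apply: lerXn2r; rewrite ?nnegrE ?mulr_ge0 ?(ltW k0)//.
exact: ltW.
Qed.

(** By [in_closure_incr_le] all increments of [U] in x_2 are null. An approximant shifted off its
    own support has an increment at least as large as itself; being close to an increment of [U], it
    must be small. *)
Lemma in_closure_snd0 (U : R * R -> R) (G : R * R -> R * R) :
  in_closure alpha p U G -> N (sc (fun x => (G x).2)) = 0 -> N (sc U) = 0.
Proof.
move=> cUG G0; have [LU LG cl] := cUG.
have T2 : 0 <= 2 `^ p :> R := powR_ge0 _ _.
apply/eqP; rewrite eq_le Lpint_ge0 andbT.
apply: (@ler_eps _ _ (2 `^ p * (2 `^ p * (2 `^ p * 2) + 1))) => e e0; rewrite add0r.
have [phi [s1 h1 _]] := cl e e0; have [P1 _] := strip_smooth_Lpv hp s1.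
have [b [B [_ hB]]] := s1.2.
(* Exceeds the height [2 * |B|] of the support of [phi], so that [phi] and its translate are never
   both nonzero. *)
pose h := 2 * `|B| + 1.
have LD := LpvB hp LU P1; rewrite scB in LD h1.
have [Li1 _] := Lpv_incr hp h LU; have [Li2 N2] := Lpv_incr hp h LD.
have [Li3 _] := Lpv_incr hp h P1.
have NU : N (sc (incr h U)) = 0.
  by apply/eqP; rewrite eq_le Lpint_ge0 andbT (le_trans (in_closure_incr_le hp h cUG))// G0 !mulr0.
have Nphi : N (sc phi) <= N (sc (incr h phi)).
  rewrite Lpint.unlock; apply: le_Int; [by case: P1|by case: Li3|move=> x].
  rewrite !enorm_sc ge0_ler_powR ?nnegrE ?(ltW p0)//.
  have [->|nz] := eqVneq (phi x) 0; first by rewrite normr0.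
  have [_ xB] := hB x nz.
  have -> : incr h phi x = - phi x; last by rewrite normrN.
  rewrite /incr; have -> : phi (x + h *: e2) = 0; last by rewrite sub0r.
  apply/eqP/negPn/negP => /hB[_]; rewrite !coordE mulr1 => xh.
  have BB := ler_norm B; have xl : - `|x.2| <= x.2 by rewrite lerNl ler_normr orbC lexx.
  have := le_trans (ler_norm _) xh; rewrite /h; lra.
have e1 : sc (incr h phi) = (fun x => sc (incr h U) x + - sc (incr h (fun x => U x - phi x)) x).
  by apply/funext => x; apply: injective_projections; rewrite /sc /incr !coordE /=; ring.
have N3 := LpintD_le2 hp Li1 (LpvN hp Li2); rewrite -e1 LpintN NU add0r in N3.
have e2' : sc U = (fun x => sc phi x + sc (fun x => U x - phi x) x).
  by apply/funext => x; apply: injective_projections; rewrite /sc !coordE /=; ring.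
rewrite e2'; apply: (le_trans (LpintD_le2 hp P1 LD)); rewrite -mulrA; apply: ler_wpM2l => //.
rewrite mulrDl mul1r; apply: lerD; last exact: ltW.
apply: (le_trans (le_trans Nphi N3)); rewrite -mulrA; apply: ler_wpM2l => //.
apply: (le_trans N2); rewrite -mulrA; apply: ler_wpM2l => //.
by apply: ler_wpM2l => //; exact: ltW.
Qed.

Lemma Lpint_eq0_ae (U : R * R -> R) (Q : R * R -> Prop) :
  (forall x, U x = 0 -> Q x) -> Lpv p (sc U) -> N (sc U) = 0 ->
  {ae @leb2 R, forall x, Q x}.
Proof.
move=> UQ /Lpv_sc[mU pU]; rewrite Lpint_sc => I0.
have mF : measurable_fun [set: measurableTypeR R * measurableTypeR R] (fun x => (`|U x| `^ p)%:E).
  by apply/measurable_EFinP; exact: pint_mes pU.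
have [H _] := ae_eq_integral_abs (@leb2 R) measurableT mF.
have /H : (\int[@leb2 R]_x `|(`|U x| `^ p)%:E| = 0)%E.
  rewrite (_ : (fun x => _) = (fun x => (`|U x| `^ p)%:E)); first by rewrite EFin_Int// I0.
  by apply/funext => x; rewrite abse_EFin ger0_norm ?powR_ge0.
apply: filterS => x /(_ I) [] /powR_eq0_eq0/eqP.
by rewrite normr_eq0 => /eqP/UQ.
Qed.

Lemma eigen_empty : eigen_spectrum (strip alpha) p = set0.
Proof.
apply/seteqP; split => // lambda [u nz equ]; apply: nz.
have cUG := W01p_in_closure hp u.
set U := on_strip alpha u in cUG; set G := on_stripv alpha _ in cUG.
have [LU LG _] := cUG.
have weak phi : strip_smooth alpha phi -> dual G (grad phi) = lambda * dual (sc U) (sc phi).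
  move=> sphi; have [w wf wg] := W01p_of_smooth hp sphi.
  have := equ w; rewrite plaplacianE power_functionalE wf wg.
  by rewrite (on_stripv_grad sphi) (on_strip_smooth sphi).
(* The equation tested with [u] itself. *)
have EN : N G = lambda * N (sc U).
  by have := weak_equation_closure hp LU LG weak cUG; rewrite !pairing_self.
suff NU : N (sc U) = 0.
  apply: (Lpint_eq0_ae _ LU NU) => x; rewrite /U on_stripE => + Ox.
  by move: Ox => [/= + _]; rewrite in_itv/= -ltr_norml => ->.
have [//|NU0] := eqVneq (N (sc U)) 0; exfalso.
have NUp : 0 < N (sc U) by rewrite lt_neqAle eq_sym NU0 Lpint_ge0.
(* The sign of [lambda], required by the convexity argument, follows from [EN] when [u] is not
   null. *)
have l0 : 0 <= lambda by rewrite -(pmulr_lge0 _ NUp) -EN Lpint_ge0.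
move: NU0; apply/negP; rewrite negbK; apply/eqP.
apply: (in_closure_snd0 cUG); apply: (Lpint_snd_le LG).
have LG2 : Lpv p (fun x => (0, (G x).2) : R * R).
  apply: (@Lpv_le _ p hp _ G 1 _ LG ler01 _).1.
    by split; [exact: mes_cst|case: LG => -[]].
  by move=> x; rewrite enorm_snd mul1r ler_snd_enorm.
have pd := pint_pairing hp LG LG2.
(* The integrand of the inner variation without its weight: its integrals against low-frequency
   cosines vanish, hence so does its integral. There [EN] cancels the first bracket and leaves the
   |G|^(p-2) G_2^2 term. *)
pose q x := (lambda * enorm (sc U x) `^ p - enorm (G x) `^ p)
  + p * dot (pfield p (G x)) (0, (G x).2).
have pq1 := pintB (pintZ lambda LU.2) LG.2.
have pq : pint q := pintD pq1 (pintZ p pd).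
have : Int q = 0.
  apply: Int_cos_limit => // n; pose c : R := n.+1%:R^-1.
  have c0 : 0 < c by rewrite invr_gt0 ltr0n.
  have c1 : 0 <= c <= 1 by rewrite (ltW c0) invf_le1 ?ltr0n// ler1n.
  have := inner_variation hp l0 cUG weak (smooth_wave c) (wave01 c) (lexx 1)
    (fun y => derive_wave_le y c1) (fun y => derive2_wave_le y c1).
  rewrite pairing.unlock.
  have mc : mes (fun x : R * R => cos (c * x.2)).
    apply: mes_continuous => x; apply: continuous_comp; last exact: continuous_cos.
    by apply: cvgM; [exact: cvg_cst|exact: snd_continuous].
  have bc (x : R * R) : `|cos (c * x.2)| <= 1 by rewrite ler_norml cos_geN1 cos_le1.
  have -> : (fun x => 'D_1 (wave c) x.2 * (lambda * enorm (sc U x) `^ p - enorm (G x) `^ p)) =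
     (fun x => c / 2 * (cos (c * x.2) * (lambda * enorm (sc U x) `^ p - enorm (G x) `^ p))).
    by apply/funext => x; rewrite derive_wave mulrA.
  have -> : (fun x => dot (pfield p (G x)) (0, 'D_1 (wave c) x.2 * (G x).2)) =
     (fun x => c / 2 * (cos (c * x.2) * dot (pfield p (G x)) (0, (G x).2))).
    by apply/funext => x; rewrite derive_wave /dot /=; ring.
  have p1 := pintM_bounded mc bc pq1; have p2 := pintM_bounded mc bc pd.
  rewrite (IntZ _ p1) (IntZ _ p2) mulrCA -mulrDr => /eqP.
  rewrite mulf_eq0 gt_eqF ?divr_gt0//= => /eqP <-.
  rewrite -(IntZ p p2) -IntD//; last exact: pintZ.
  by congr Int; apply/funext => x; rewrite /q; ring.
rewrite /q IntD//; [|exact: pintZ]; rewrite IntB//; [|exact: pintZ LU.2|exact: LG.2].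
rewrite (IntZ lambda LU.2) (IntZ p pd).
move: EN; rewrite Lpint.unlock => ->; rewrite subrr add0r => /eqP.
by rewrite mulf_eq0 gt_eqF//= => /eqP.
Qed.

End eigen.

(** * Lower bound for the essential spectrum *)

Section strip_poincare.
Context {R : realType} (alpha p : R) (a0 : 0 < alpha) (hp : 1 < p).
Local Notation mu := (@lebesgue_measure R).
Local Notation sc := scalar_field.
Local Notation N := (Lpint p).
Local Notation D1 f := ('D_(1%R : R) f).

Let p0 : 0 < p. Proof. exact: lt_trans hp. Qed.

Lemma slice_itv_smooth (phi : R * R -> R) (y : R) : strip_smooth alpha phi ->
  itv_smooth alpha (fun x => phi (x, y)) /\
  forall x, D1 (fun x => phi (x, y)) x = (grad phi (x, y)).1.
Proof.
move=> [sphi [b [B [ba hb]]]].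
have lin (t v x : R) : (t *: v + x, y) = t *: ((v, 0) : R * R) + (x, y).
  by apply: injective_projections; rewrite !coordE //= mulr0 add0r.
split; last first.
  by move=> x; rewrite (@derive_comp_affine _ _ _ (fun x : R => (x, y)) (fun v : R => (v, 0))).
split => [k|].
  apply: (@Ck_comp_affine _ _ _ (fun x : R => (x, y)) (fun v : R => (v, 0))) => //.
  move=> x; apply/cvg_ballP => e e0; near=> z; split => /=; last exact: ballxx.
  by near: z; exists e.
by exists b; split => // x /hb[].
Unshelve. all: by end_near. Qed.

(** Tonelli's theorem; the slice integrals [Int1] are extended reals, so that the formula makes
    sense for every slice. *)
Lemma Lpint_slices (f : R * R -> R) : Lpv p (sc f) ->
  ((N (sc f))%:E = \int[mu]_y Int1 p (fun x => f (x, y)))%E /\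
  measurable_fun [set: measurableTypeR R] (fun y => Int1 p (fun x => f (x, y))).
Proof.
move=> L; have [mf pf] := (Lpv_sc p f).1 L; rewrite Int1.unlock.
pose F (z : measurableTypeR R * measurableTypeR R) := (`|f z| `^ p)%:E.
have mF : measurable_fun setT F by apply/measurable_EFinP; exact: pint_mes.
have F0 z : (0 <= F z)%E by rewrite lee_fin powR_ge0.
rewrite Lpint_sc -(EFin_Int pf); split.
  exact: (@fubini_tonelli2 _ _ _ _ R mu mu F mF F0).
exact: (@measurable_fun_fubini_tonelli_G _ _ _ _ R mu F mF F0).
Qed.

Lemma ler_Lpint_slices (l : R) (f g : R * R -> R) : 0 <= l -> Lpv p (sc f) -> Lpv p (sc g) ->
  (forall y, l%:E * Int1 p (fun x => f (x, y)) <= Int1 p (fun x => g (x, y)))%E ->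
  l * N (sc f) <= N (sc g).
Proof.
move=> l0 Lf Lg H; have [ef mf] := Lpint_slices Lf; have [eg mg] := Lpint_slices Lg.
have F0 y : (0 <= Int1 p (fun x => f (x, y)))%E by exact: Int1_ge0.
have l0' : (0 <= l%:E)%E by rewrite lee_fin.
rewrite -lee_fin EFinM ef eg -(ge0_integralZl _ measurableT mf (fun y _ => F0 y) l0').
apply: ge0_le_integral => [|y _|||y _].
- exact: measurableT.
- exact: mule_ge0 l0' (F0 y).
- exact: measurable_funeM.
- exact: mg.
- exact: H.
Qed.

Lemma N_fst (G : R * R -> R * R) : Lpv p G ->
  Lpv p (sc (fun x => (G x).1)) /\ N (sc (fun x => (G x).1)) <= N G.
Proof.
move=> LG; have L : Lpv p (sc (fun x => (G x).1)).
  apply: (@Lpv_le _ p hp _ G 1 _ LG ler01 _).1.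
    by split; [case: LG => -[]|exact: mes_cst].
  by move=> x; rewrite enorm_fst mul1r ler_fst_enorm.
split => //; rewrite Lpint.unlock; apply: le_Int; [by case: L|by case: LG|move=> x].
rewrite enorm_sc; apply: ge0_ler_powR; rewrite ?nnegrE ?(ltW p0) ?enorm_ge0 ?normr_ge0//.
exact: ler_fst_enorm.
Qed.

Lemma strip_poincare (phi : R * R -> R) : strip_smooth alpha phi ->
  (pi_p p / (2 * alpha)) `^ p * N (sc phi) <= N (grad phi).
Proof.
move=> sphi; have [L1 L2] := strip_smooth_Lpv hp sphi.
have [L3 le3] := N_fst L2; apply: le_trans le3.
apply: (ler_Lpint_slices _ L1 L3); first exact: powR_ge0.
move=> y; have [s1 d1] := slice_itv_smooth y sphi.
have -> : (fun x => (grad phi (x, y)).1) = D1 (fun x => phi (x, y)).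
  by apply/funext => x; rewrite d1.
exact: poincare_itv.
Qed.

(** The square accounts for two passages between an element of the closure and its approximant, one
    for the function and one for the gradient. Both factors tend to 1 with [r]. *)
Lemma ler_1powR2 (A B : R) : (forall r, 0 < r -> A <= ((1 + r) `^ p) ^+ 2 * B) ->
  0 <= B -> A <= B.
Proof.
move=> H B0; apply: (@ler_eps _ _ B) => e e0.
have e1 : 1 < 1 + e by rewrite ltrDl.
have q0 : 0 < (2 * p)^-1 by rewrite invr_gt0 mulr_gt0.
(* The solution of [((1 + r)^p)^2 = 1 + e]. *)
pose r := (1 + e) `^ (2 * p)^-1 - 1.
have r0 : 0 < r.
  have := gt0_ltr_powR q0 _ _ e1; rewrite powR1 subr_gt0; apply; rewrite nnegrE ?ler01//.
  exact: ltW (lt_trans ltr01 e1).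
have := H r r0; rewrite /r addrC subrK -powRrM -powR_mulrn ?powR_ge0// -powRrM.
have -> : (2 * p)^-1 * p * 2%:R = 1 by field; rewrite gt_eqF.
by rewrite powRr1 ?(ltW (lt_trans ltr01 e1))// mulrDl mul1r [e * B]mulrC.
Qed.

Lemma in_closure_poincare w g : in_closure alpha p w g ->
  (pi_p p / (2 * alpha)) `^ p * N (sc w) <= N g.
Proof.
set l := (_ `^ p); have l0 : 0 <= l := powR_ge0 _ _.
move=> [Lw Lg cl].
have step r : 0 < r -> l * N (sc w) <= ((1 + r) `^ p) ^+ 2 * N g.
  move=> r0; have r1 : 0 < r^-1 by rewrite invr_gt0.
  have A0 : 0 <= (1 + r) `^ p := powR_ge0 _ _.
  have B0 : 0 <= (1 + r^-1) `^ p := powR_ge0 _ _.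
  apply: (@ler_eps _ _ ((1 + r) `^ p * (1 + r^-1) `^ p + l * (1 + r^-1) `^ p)) => e e0.
  have [phi [s1 h1 h2]] := cl e e0; have [P1 P2] := strip_smooth_Lpv hp s1.
  have LD := LpvB hp Lw P1; have LG := LpvB hp Lg P2.
  have [_ K1] := LpvD_le hp r0 P1 LD; have [_ K2] := LpvD_le hp r0 Lg (LpvN hp LG).
  have e1 : (fun x => sc phi x + (sc w x - sc phi x)) = sc w.
    by apply/funext => x; rewrite addrC subrK.
  have e2 : (fun x => g x + - (g x - grad phi x)) = grad phi.
    by apply/funext => x; rewrite opprB addrC subrK.
  rewrite e1 in K1; rewrite e2 LpintN in K2.
  have h1' := ltW h1; have h2' := ltW h2.
  have {}K2 := le_trans K2 (lerD (lexx _) (ler_wpM2l B0 h2')).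
  have {}K1 := le_trans K1 (lerD (lexx _) (ler_wpM2l B0 h1')).
  have Q := ler_wpM2l A0 (le_trans (strip_poincare s1) K2).
  have Q' := ler_wpM2l l0 K1.
  apply: (le_trans Q'); rewrite -/l in Q; move: Q; rewrite expr2; lra.
by apply: (ler_1powR2 step); exact: Lpint_ge0.
Qed.

End strip_poincare.

Section ess_lower_bound.
Context {R : realType} (alpha p : R) (a0 : 0 < alpha) (hp : 1 < p).
Local Notation sc := scalar_field.
Local Notation N := (Lpint p).

Lemma ess_lower_bound (lambda : R) : ess_spectrum (strip alpha) p lambda ->
  (pi_p p / (2 * alpha)) `^ p <= lambda.
Proof.
move=> [u [u1 ulim _] _].
have p0 : 0 < p := lt_trans ltr01 hp.
rewrite -lee_fin; apply: cvge_ge ulim; apply: nearW => n.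
have cu := W01p_in_closure hp (u n); have [Lu Lg _] := cu.
rewrite energy_strip// lee_fin.
have := u1 n; rewrite Lp_norm_strip//; last by case: (W01p_inW1p (u n)).
move=> [] e1; have N1 : N (sc (on_strip alpha (u n))) = 1.
  have N0 := Lpint_ge0 p (sc (on_strip alpha (u n))).
  by rewrite -[LHS]powRr1// -[X in _ `^ X](@mulVf _ p) ?gt_eqF// powRrM e1 powR1.
by have := in_closure_poincare a0 hp cu; rewrite N1 mulr1.
Qed.

End ess_lower_bound.

(** * Singular Palais-Smale sequences *)

Section criticality.
Context {R : realType} (alpha p : R) (hp : 1 < p).
Local Notation sc := scalar_field.
Local Notation N := (Lpint p).
Local Notation e2 := ((0, 1) : R * R).
Local Notation smooth_in := (strip_smooth alpha).

Let p0 : 0 < p. Proof. exact: lt_trans hp. Qed.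
Let p10 : 0 < p - 1. Proof. by rewrite subr_gt0. Qed.

Lemma strip_smoothZ (t : R) phi : smooth_in phi -> smooth_in (fun x => t * phi x).
Proof.
move=> s; rewrite (_ : (fun x => _) = (fun x => phi x * (fun=> t) x)).
  by apply: strip_smoothM => // k; exact: Ck_cst.
by apply/funext => x; rewrite mulrC.
Qed.

Lemma strip_smoothN phi : smooth_in phi -> smooth_in (fun x => - phi x).
Proof. by move=> /(strip_smoothZ (-1)); under eq_fun do rewrite mulN1r. Qed.

Lemma strip_smoothD phi psi : smooth_in phi -> smooth_in psi ->
  smooth_in (fun x => phi x + psi x).
Proof.
move=> s1 /strip_smoothN s2; have := strip_smoothB s1 s2.
by under eq_fun do rewrite opprK.
Qed.

Lemma gradZ (t : R) phi x : smooth_in phi -> grad (fun x => t * phi x) x = t *: grad phi x.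
Proof.
move=> s; have st : smooth (fun _ : R * R => t) by move=> k; exact: Ck_cst.
rewrite (_ : (fun x => t * phi x) = (fun x => phi x * t)).
  rewrite (grad_mul x s st) /grad !derive_cst.
  by apply: injective_projections; rewrite !coordE /= mulr0 addr0.
by apply/funext => y; rewrite mulrC.
Qed.

Lemma gradD phi psi x : smooth_in phi -> smooth_in psi ->
  grad (fun x => phi x + psi x) x = grad phi x + grad psi x.
Proof.
move=> s1 s2; have sn := strip_smoothZ (-1) s2.
rewrite (_ : (fun x => phi x + psi x) = (fun x => phi x - (-1) * psi x)).
  by rewrite (grad_sub x s1 sn) gradZ// scaleN1r opprK.
by apply/funext => y; rewrite mulN1r opprK.
Qed.

Definition residual (lambda : R) u phi :=
  pairing p (grad u) (grad phi) - lambda * pairing p (sc u) (sc phi).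

Lemma residualZ lambda (t : R) u phi : smooth_in u -> smooth_in phi ->
  residual lambda u (fun x => t * phi x) = t * residual lambda u phi.
Proof.
move=> s1 s2; have [U1 U2] := strip_smooth_Lpv hp s1; have [P1 P2] := strip_smooth_Lpv hp s2.
rewrite /residual (_ : grad (fun x => t * phi x) = fun x => t *: grad phi x).
  by rewrite -(scZ (fun=> t)) !pairingZ// mulrBr mulrCA.
by apply/funext => x; rewrite gradZ.
Qed.

Lemma residualD lambda u phi psi : smooth_in u -> smooth_in phi -> smooth_in psi ->
  residual lambda u (fun x => phi x + psi x) = residual lambda u phi + residual lambda u psi.
Proof.
move=> s1 s2 s3; have [U1 U2] := strip_smooth_Lpv hp s1.
have [P1 P2] := strip_smooth_Lpv hp s2; have [Q1 Q2] := strip_smooth_Lpv hp s3.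
rewrite /residual (_ : grad (fun x => phi x + psi x) = fun x => grad phi x + grad psi x).
  by rewrite -scD !pairingD//; ring.
by apply/funext => x; rewrite gradD.
Qed.

Lemma pairing_le a b : Lpv p a -> Lpv p b -> `|pairing p a b| <= N a + N b.
Proof. by move=> La Lb; have := pairing_young hp ltr01 La Lb; rewrite powR1 !mul1r. Qed.

Lemma residual_le lambda u phi : smooth_in u -> smooth_in phi ->
  `|residual lambda u phi| <=
  (N (grad u) + N (grad phi)) + `|lambda| * (N (sc u) + N (sc phi)).
Proof.
move=> s1 s2; have [U1 U2] := strip_smooth_Lpv hp s1; have [P1 P2] := strip_smooth_Lpv hp s2.
rewrite (le_trans (ler_normB _ _))// lerD ?pairing_le// normrM ler_wpM2l// pairing_le//.
Qed.

(** The margin [d] leaves room for a cutoff equal to 1 on the support, and allows a function to be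
    moved into a strictly shorter cell. *)
Definition cell_smooth (L : R) g := smooth_in g /\
  exists2 d : R, 0 < d & forall x, g x != 0 -> d <= x.2 <= L - d.

Lemma cell_smoothZ L (t : R) g : cell_smooth L g -> cell_smooth L (fun x => t * g x).
Proof.
move=> [s [d d0 h]]; split; first exact: strip_smoothZ.
by exists d => // x; rewrite mulf_eq0 negb_or => /andP[_ /h].
Qed.

Lemma cell_smoothD L g w : cell_smooth L g -> cell_smooth L w ->
  cell_smooth L (fun x => g x + w x).
Proof.
move=> [s1 [d1 d10 h1]] [s2 [d2 d20 h2]]; split; first exact: strip_smoothD.
exists (Num.min d1 d2) => [|x nz]; first by rewrite lt_min d10.
have [m1 m2] : Num.min d1 d2 <= d1 /\ Num.min d1 d2 <= d2 by rewrite !ge_min !lexx orbT.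
have [g0|/h1] := eqVneq (g x) 0; last by lra.
by move: nz; rewrite g0 add0r => /h2; lra.
Qed.

(* Testing minimality with g + t w and using convexity twice, the first-order
   term is at least - eta / (p t) up to an error that is small with t, uniformly in w. *)
Lemma almost_critical (L lambda K eps : R) : 0 <= lambda -> 0 <= K -> 0 < eps ->
  (forall g, cell_smooth L g -> lambda * N (sc g) <= N (grad g)) ->
  exists2 eta : R, 0 < eta & forall g, cell_smooth L g -> N (sc g) = 1 ->
    N (grad g) <= lambda + eta -> forall w, cell_smooth L w -> N (grad w) <= K ->
    `|residual lambda g w| <= eps.
Proof.
move=> l0 K0 eps0 H.
have M0 : 0 < 3 * (lambda + 1 + K) by rewrite mulr_gt0//; lra.
(* The error [eps] is shared by three terms: the two of [pairing_continuity], controlled by [d] and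
   by the step [t], and the lack of minimality [eta / (p * t)]. *)
pose d := eps / (3 * (lambda + 1 + K)); have d0 : 0 < d by rewrite divr_gt0.
have [C C0 hC] := pairing_continuity hp d0.
have e3 : 0 < eps / 3 by rewrite divr_gt0.
have [t t0 ht] := powR_small p10 (mulr_ge0 (mulr_ge0 C0 (ler0n _ 2)) K0) e3.
have pt0 : 0 < p * t by rewrite mulr_gt0.
pose eta := Num.min 1 (p * t * (eps / 3)).
have eta0 : 0 < eta by rewrite lt_min ltr01/= mulr_gt0.
have [eta1 eta2] : eta <= 1 /\ eta <= p * t * (eps / 3) by rewrite !ge_min !lexx orbT.
exists eta => // g cg g1 ge.
(* Applying the lower bound to [- w] gives the upper one. *)
suff half w : cell_smooth L w -> N (grad w) <= K -> - eps <= residual lambda g w.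
  move=> w cw wK; rewrite ler_norml half//= -lerN2.
  have cnw := cell_smoothZ (-1) cw; have := half _ cnw.
  rewrite residualZ ?mulN1r; [|by case: cg|by case: cw]; apply.
  rewrite (_ : grad (fun x => -1 * w x) = (fun x => - grad w x)) ?LpintN//.
  by apply/funext => x; rewrite gradZ ?scaleN1r//; case: cw.
move=> cw wK; have sg := cg.1; have sw := cw.1.
have [G1 G2] := strip_smooth_Lpv hp sg; have [W1 W2] := strip_smooth_Lpv hp sw.
have ctw := cell_smoothZ t cw; have cv := cell_smoothD cg ctw.
pose v x := g x + t * w x; have [V1 V2] := strip_smooth_Lpv hp cv.1.
have Jv := H _ cv.
have gv : grad v = fun x => grad g x + t *: grad w x.
  by apply/funext => x; rewrite /v gradD ?gradZ//; exact: ctw.1.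
have E1 := Lpint_convex hp V2 G2.
have E2 := Lpint_convex hp G1 V1.
rewrite (_ : (fun x => grad g x - grad v x) = (fun x => (- t) *: grad w x)) in E1; last first.
  by apply/funext => x; rewrite gv opprD addNKr scaleNr.
rewrite (_ : (fun x => sc v x - sc g x) = (fun x => t *: sc w x)) in E2; last first.
  by apply/funext => x; apply: injective_projections; rewrite /sc /v !coordE /=; ring.
rewrite pairingZ// in E1; rewrite pairingZ// in E2.
have LT := LpvZc hp t W2.
have E3 := hC _ _ _ G2 LT W2.
rewrite -gv in E3.
have n1 : npairing p (grad g) (grad w) <= lambda + 1 + K.
  by have [_ ] := npairing_le hp ltr01 G2 W2; rewrite powR1 !mul1r; lra.
have n2 : npairing p (fun x => t *: grad w x) (grad w) <= t `^ (p - 1) * 2 * K.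
  have ti : 0 < t^-1 by rewrite invr_gt0.
  have [_ h] := npairing_le hp ti LT W2; apply: (le_trans h).
  rewrite LpintZc// gtr0_norm// -powR_inv1 ?(ltW t0)// -powRrM mulN1r opprB.
  rewrite mulrA -powRD; last by rewrite (gt_eqF t0) implybT.
  rewrite [- 1 + p]addrC -mulrDr -mulrA; apply: ler_wpM2l; first exact: powR_ge0.
  by lra.
have h1 := ler_wpM2l (ltW d0) n1; have h2 := ler_wpM2l C0 n2.
have dK : d * (lambda + 1 + K) = eps / 3.
  by rewrite /d; field; lra.
have hT := ht t (ltW t0) (lexx _).
have E4 : pairing p (grad v) (grad w) <= pairing p (grad g) (grad w) + eps / 3 + eps / 3.
  have := le_trans (ler_norm _) E3; move: hT h1 h2; rewrite dK; lra.
have E5 := ler_wpM2l l0 E2.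
have E6 := ler_wpM2l (ltW pt0) E4.
rewrite -(ler_pM2l pt0) /residual.
move: Jv E1 E5 E6; rewrite g1 -/v; nra.
Qed.

End criticality.

(** * Cutting off near the edges of a cell *)

Section cell_boundary.
Context {R : realType} (alpha p : R) (hp : 1 < p).
Local Notation sc := scalar_field.
Local Notation N := (Lpint p).
Local Notation e2 := ((0, 1) : R * R).
Local Notation smooth_in := (strip_smooth alpha).
Local Notation D1 f := ('D_(1%R : R) f).

Let p0 : 0 < p. Proof. exact: lt_trans hp. Qed.

Lemma dot0l (b : R * R) : dot 0 b = 0.
Proof. by rewrite /dot /= !mul0r addr0. Qed.

Lemma grad_near0 (g : R * R -> R) x : (\forall y \near x, g y = 0) -> grad g x = 0.
Proof. by move=> e; apply: injective_projections; exact: (derive_near_cst (c := 0)). Qed.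

Lemma near_snd_lt (c : R) (x : R * R) : x.2 < c -> \forall y \near x, y.2 < c.
Proof.
move=> h; have e : \forall s \near x.2, s < c by exact: lt_nbhsl.
exact: (@snd_continuous R x _ e).
Qed.

Lemma near_snd_gt (c : R) (x : R * R) : c < x.2 -> \forall y \near x, c < y.2.
Proof.
move=> h; have e : \forall s \near x.2, c < s by exact: lt_nbhsr.
exact: (@snd_continuous R x _ e).
Qed.

Lemma grad_out (g : R * R -> R) (b c : R) x : (forall y, g y != 0 -> b <= y.2 <= c) ->
  x.2 < b \/ c < x.2 -> grad g x = 0.
Proof.
move=> hg [h|h]; apply: grad_near0.
  apply: filterS (near_snd_lt h) => y yb; apply/eqP; apply: contraTT yb => /hg/andP[].
  by rewrite -leNgt.
apply: filterS (near_snd_gt h) => y yb; apply/eqP; apply: contraTT yb => /hg/andP[].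
by rewrite -leNgt.
Qed.

Lemma grad_snd (f : R -> R) (x : R * R) : smooth f ->
  grad (fun x => f x.2) x = (0, D1 f x.2).
Proof.
move=> sf; have df : derivable f x.2 1 by have [_ /(_ 1)[]] := sf 1%N.
rewrite /grad !derive_snd /=; congr (_, _).
by rewrite (derive_real 0 df).2 mul0r.
Qed.

Lemma strip_smooth_lip W : smooth_in W -> exists2 M : R, 0 <= M &
  forall t s s', `|W (t, s) - W (t, s')| <= M * `|s - s'|.
Proof.
move=> sW; have [M [B [M0 hM]]] := strip_smooth_grad_bounded sW.
exists M => // t s s'.
have hd x : `|'D_e2 W x| <= M.
  have [_ h] := hM x; apply: (le_trans (ler_snd_enorm (grad W x))); apply: (le_trans h).
  by rewrite -[leRHS]mulr1 ler_wpM2l ?box_le1.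
have := increment_le (sW.1 1%N) hd (t, s') (s - s').
rewrite (_ : (t, s') + (s - s') *: e2 = (t, s))//.
by apply: injective_projections; rewrite !coordE /= ?mulr0 ?addr0// mulr1 addrC subrK.
Qed.

(** Layers of height of order [d] along the edges x_2 = 0 and x_2 = L, written as rescaled squares
    so that the change of variables gives an integral proportional to [d]. *)
Let thin (B d L : R) (x : R * R) : R :=
  box B (affine2 (1, d^-1) (0, 0) x) + box B (affine2 (1, - d^-1) (0, d^-1 * L) x).

Let Int_thin B d L : 0 < d -> pint (thin B d L) /\ Int (thin B d L) = 2 * Int (box B) * d.
Proof.
move=> d0; have di : d^-1 != 0 by rewrite invr_eq0 gt_eqF.
have nd : - d^-1 != 0 by rewrite oppr_eq0.
have [p1 I1] := @affine2_Int R (1, d^-1) (0, 0) _ (oner_neq0 _) di (pint_box B).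
have [p2 I2] := @affine2_Int R (1, - d^-1) (0, d^-1 * L) _ (oner_neq0 _) nd (pint_box B).
split; first exact: pintD.
rewrite IntD// I1 I2 /= !mul1r normrN gtr0_norm ?invr_gt0// invrK; ring.
Qed.

(* Multiplying W by a cutoff in x_2 that equals 1 on the support of g costs a bounded amount
   of energy: near the edges |W| <= M x_2 compensates the slope of the cutoff. *)
Lemma cell_approximation L g W K : cell_smooth alpha L g -> smooth_in W ->
  (forall t, W (t, 0) = 0) -> (forall t, W (t, L) = 0) -> N (grad W) <= K ->
  exists w, [/\ cell_smooth alpha L w, N (grad w) <= 2 `^ p * (K + 1) &
    forall lambda, residual p lambda g w = residual p lambda g W].
Proof.
move=> [sg [d d0 hg]] sW W0 WL WK.
have [M M0 hM] := strip_smooth_lip sW.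
have [Ms Ms0 hMs] := @derive_step_le R.
have [b [B0 [_ hb]]] := sW.2.
(* [B] dominates the width of [W] and is at least 2, so that the layers reach height [2 * r]. The
   first 2 in [C] allows for points lying in both layers. *)
pose B := `|b| + 2; pose C := 2 * (4 * M * Ms).
have C0 : 0 <= C by rewrite /C !mulr_ge0// ltW.
pose I := 2 * Int (box B); have I0 : 0 <= I by rewrite /I mulr_ge0// Int_ge0// => x; exact: box_ge0.
have J0 : 0 <= C `^ p * I by rewrite mulr_ge0 ?powR_ge0.
(* [r <= d / 3] makes the cutoff equal to 1 on the support of [g]; the other bound keeps the
   contribution [C^p * I * r] of the layers below 1. *)
pose r := Num.min (d / 3) (C `^ p * I + 1)^-1.
have r0 : 0 < r by rewrite lt_min divr_gt0//= invr_gt0 ltr_wpDl.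
have [r1 r2] : r <= d / 3 /\ r <= (C `^ p * I + 1)^-1 by rewrite !ge_min !lexx orbT.
pose cut := plateau r (L - r) r; pose th (x : R * R) := cut x.2.
have scut : smooth cut by exact: smooth_plateau.
have sth : smooth th := smooth_snd scut.
have gth x : grad th x = (0, D1 cut x.2) by exact: grad_snd.
pose w x := W x * th x; have sw : smooth_in w := strip_smoothM sW sth.
have gw x : grad w x = th x *: grad W x + W x *: grad th x by exact: (grad_mul x sW sth).
exists w; split.
- split => //; exists r => // x; rewrite mulf_eq0 negb_or => /andP[_]; rewrite /th /cut => h.
  apply/andP; split; rewrite leNgt; apply: contra h => h; rewrite plateau_out//.
    by left; exact: ltW.
  by right; exact: ltW.
- have [W1 W2] := strip_smooth_Lpv hp sW.
  have mth : mes th := mes_continuous (Ck_continuous (sth 0%N)).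
  have [LA NA] : Lpv p (fun x => th x *: grad W x) /\ N (fun x => th x *: grad W x) <= 1 `^ p * N (grad W).
    apply: LpvZ => // x; have /andP[t0 t1] := plateau01 r (L - r) r x.2.
    by rewrite ger0_norm.
  have [pt It] := Int_thin B L r0.
  have key x : `|W x * D1 cut x.2| <= 4 * M * Ms * thin B r L x.
    have th0 : 0 <= thin B r L x by rewrite addr_ge0 ?box_ge0.
    have rhs0 : 0 <= 4 * M * Ms * thin B r L x by rewrite !mulr_ge0// ltW.
    have [->|Wx] := eqVneq (W x) 0; first by rewrite mul0r normr0.
    have [x1b _] := hb x Wx; have bB : `|x.1| <= B by rewrite /B; have := ler_norm b; lra.
    have B2 : 2 <= B by rewrite /B lerDr.
    have dc := derive_plateau_le r (L - r) r0 x.2 hMs.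
    (* In a layer [|W| <= 2 * M * r] and the slope of the cutoff is at most [2 * Ms / r]; the powers
       of [r] cancel. *)
    have fin s : `|W x| <= M * s -> s <= 2 * r -> `|W x * D1 cut x.2| <= 4 * M * Ms.
      move=> hW hs; rewrite normrM.
      apply: (@le_trans _ _ (M * (2 * r) * (2 * Ms / r))).
        by apply: ler_pM => //; apply: (le_trans hW); exact: ler_wpM2l.
      by rewrite le_eqVlt; apply/orP; left; apply/eqP; field; rewrite gt_eqF.
    have one (u v : R) : 1 <= u -> 0 <= v -> 4 * M * Ms <= 4 * M * Ms * (u + v).
      by move=> u1 v0; apply: ler_peMr; [rewrite !mulr_ge0// ltW|lra].
    have ri : 0 < r^-1 by rewrite invr_gt0.
    have [h1|h1] := ltP x.2 r; first by rewrite derive_plateau_out ?mulr0 ?normr0//; left.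
    have [h2|h2] := leP x.2 (2 * r).
      apply: (@le_trans _ _ (4 * M * Ms)).
        apply: (fin x.2) => //; have := hM x.1 x.2 0.
        by rewrite W0 !subr0 -surjective_pairing [X in M * X]ger0_norm//; lra.
      apply: one; last exact: box_ge0.
      rewrite /box /affine2 /affine_map /= mul1r !addr0 bB /=.
      rewrite ger0_norm ?mulr_ge0 ?(ltW ri)//; last by lra.
      suff -> : r^-1 * x.2 <= B by []. 
      by rewrite ler_pdivrMl// (le_trans h2)// mulrC ler_wpM2l// ltW.
    have [h3|h3] := ltP x.2 (L - 2 * r).
      rewrite derive_plateau_in ?mulr0 ?normr0//.
      by apply/andP; split; lra.
    have [h4|h4] := ltP (L - r) x.2; first by rewrite derive_plateau_out ?mulr0 ?normr0//; right.
    apply: (@le_trans _ _ (4 * M * Ms)).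
      apply: (fin (L - x.2)); last by lra.
      have := hM x.1 x.2 L.
      by rewrite WL subr0 -surjective_pairing [X in M * X]ler0_norm ?opprB//; lra.
    rewrite /thin addrC; apply: one; last exact: box_ge0.
    rewrite /box /affine2 /affine_map /= mul1r !addr0 bB /=.
    have -> : - r^-1 * x.2 + r^-1 * L = r^-1 * (L - x.2) by ring.
    rewrite ger0_norm ?mulr_ge0 ?(ltW ri)//; last by lra.
    suff -> : r^-1 * (L - x.2) <= B by [].
    by rewrite ler_pdivrMl// (@le_trans _ _ (2 * r))//; [lra|rewrite mulrC ler_wpM2l// ltW].
  have en x : enorm (W x *: grad th x) = `|W x * D1 cut x.2|.
    by rewrite gth enormZ enorm_snd normrM.
  have thin2 x : thin B r L x = 0 \/ 1 <= thin B r L x <= 2.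
    rewrite /thin; have b1 := box_le1 B; have b0 := box_ge0 B.
    rewrite /box; case: (_ && _); case: (_ && _); rewrite /=; [right|right|right|left]; lra.
  have enp x : enorm (W x *: grad th x) `^ p <= C `^ p * thin B r L x.
    rewrite en; have := key x; case: (thin2 x) => [-> |/andP[t1 t2]].
      by rewrite !mulr0 normr_le0 => /eqP ->; rewrite normr0 powR0// gt_eqF.
    move=> h; apply: (@le_trans _ _ (C `^ p)); last by rewrite ler_peMr ?powR_ge0.
    apply: ge0_ler_powR; rewrite ?nnegrE ?normr_ge0 ?(ltW p0)//.
    apply: (le_trans h); rewrite /C [leRHS]mulrC; apply: ler_wpM2l => //.
    by rewrite !mulr_ge0// ltW.
  have mB : mesv (fun x => W x *: grad th x).
    apply: mesvZ; first by case/Lpv_sc : W1.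
    rewrite (_ : grad th = fun x => (0, D1 cut x.2)); last by apply/funext.
    split; first exact: mes_cst.
    have sd := smooth_derive1 scut.
    exact: mes_continuous (Ck_continuous (smooth_snd sd 0%N)).
  have pC := pintZ (C `^ p) pt.
  have LB : Lpv p (fun x => W x *: grad th x).
    split => //; apply: (pint_le (mes_enormp p mB) _ pC) => x.
    by rewrite ger0_norm ?powR_ge0//; exact: enp.
  have NB : N (fun x => W x *: grad th x) <= 1.
    rewrite Lpint.unlock; apply: (le_trans (le_Int LB.2 pC enp)).
    rewrite IntZ// It -/I mulrA.
    have r2' := ler_wpM2l J0 r2; apply: (le_trans r2').
    by rewrite ler_pdivrMr ?ltr_wpDl// mul1r lerDl.
  rewrite (_ : grad w = fun x => th x *: grad W x + W x *: grad th x); last by apply/funext.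
  apply: (le_trans (LpintD_le2 hp LA LB)); apply: ler_wpM2l; first exact: powR_ge0.
  by apply: lerD => //; rewrite powR1 mul1r in NA; exact: le_trans WK.
(* The residual only sees points of the support of [g], where the cutoff is 1 and has zero
   gradient. *)
move=> lambda; rewrite /residual !pairing.unlock; congr (Int _ - lambda * Int _); apply/funext => x.
  have [h|h] := boolP (d <= x.2 <= L - d); last first.
    rewrite (grad_out hg) ?pfield0 ?dot0l//.
    by move: h; rewrite negb_and -!ltNge => /orP.
  have /andP[h1 h2] := h; rewrite gw gth /th.
  rewrite /cut derive_plateau_in ?plateau_in//; try by apply/andP; split; lra.
  by rewrite scale1r -[(0, 0)]/(0 : R * R) scaler0 addr0.
have [gx|gx] := eqVneq (g x) 0; first by rewrite /sc gx -[(0, 0)]/(0 : R * R) pfield0 !dot0l.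
have /andP[h1 h2] := hg x gx; rewrite /sc /w /th /cut plateau_in ?mulr1//.
by apply/andP; split; lra.
Qed.

End cell_boundary.

(** * Reflections, translations and chains of cells *)

Section reflection.
Context {R : realType} (alpha p : R) (hp : 1 < p).
Local Notation sc := scalar_field.
Local Notation N := (Lpint p).
Local Notation smooth_in := (strip_smooth alpha).
Implicit Types (x v w : R * R) (f u phi psi : R * R -> R) (a b : R * R -> R * R).

Let p0 : 0 < p. Proof. exact: lt_trans hp. Qed.

Definition reflect x : R * R := (x.1, - x.2).
Local Notation rho := reflect.

Lemma reflectK x : rho (rho x) = x.
Proof. by rewrite /rho /= opprK -surjective_pairing. Qed.

Lemma enorm_reflect v : enorm (rho v) = enorm v.
Proof. by rewrite /enorm /dot /= mulrNN. Qed.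

Lemma dot_reflect v w : dot (rho v) w = dot v (rho w).
Proof. by rewrite /dot /= mulrN mulNr. Qed.

Lemma pfield_reflect v : pfield p (rho v) = rho (pfield p v).
Proof.
by rewrite /pfield enorm_reflect; apply: injective_projections; rewrite !coordE //= !coordE mulrN.
Qed.

Lemma reflect_affine x : rho x = affine2 (1, -1) (0, 0) x.
Proof. by rewrite /affine2 /affine_map /= mul1r mulN1r !addr0. Qed.

Lemma Int_reflect f : pint f -> pint (fun x => f (rho x)) /\ Int (fun x => f (rho x)) = Int f.
Proof.
move=> pf; have n1 : (-1 : R) != 0 by rewrite oppr_eq0 oner_eq0.
have [] := @affine2_Int R (1, -1) (0, 0) f (oner_neq0 _) n1 pf.
under eq_fun do rewrite -reflect_affine.
by rewrite /= mul1r normrN normr1 invr1 mul1r.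
Qed.

Lemma mes_reflect f : mes f -> mes (fun x => f (rho x)).
Proof.
move=> mf; under eq_fun do rewrite reflect_affine.
exact: (measurableT_comp mf (measurable_affine2 (1, -1) (0, 0))).
Qed.

Lemma Lpv_reflect a : Lpv p a ->
  Lpv p (fun x => rho (a (rho x))) /\ N (fun x => rho (a (rho x))) = N a.
Proof.
move=> [[m1 m2] pa]; have [ps es] := Int_reflect pa; split; last first.
  by rewrite !Lpint.unlock -es; congr Int; apply/funext => x; rewrite enorm_reflect.
split; first by split; [exact: (mes_reflect m1)|exact: (mesN (mes_reflect m2))].
by under eq_fun do rewrite enorm_reflect.
Qed.

Lemma pairing_reflect a b : Lpv p a -> Lpv p b ->
  pairing p (fun x => rho (a (rho x))) b = pairing p a (fun x => rho (b (rho x))).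
Proof.
move=> La Lb; have [Lb' _] := Lpv_reflect Lb.
rewrite !pairing.unlock -(Int_reflect (pint_pairing hp La Lb')).2.
by congr Int; apply/funext => x; rewrite reflectK pfield_reflect dot_reflect.
Qed.

Lemma sc_reflect f : sc (fun x => f (rho x)) = (fun x => rho (sc f (rho x))).
Proof. by apply/funext => x; rewrite /sc /rho /= oppr0. Qed.

(** Covers both the reflection, with [c = -1], and the compressions that adjust the length of a
    cell. *)
Definition stretch (c : R) x : R * R := (x.1, c * x.2).

Lemma reflectE : rho = stretch (-1).
Proof. by apply/funext => x; rewrite /stretch mulN1r. Qed.

Lemma stretch_linear (c t : R) v x :
  stretch c (t *: v + x) = t *: stretch c v + stretch c x.
Proof. by apply: injective_projections; rewrite !coordE //= !coordE mulrDr mulrCA. Qed.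

Lemma smooth_stretch (c : R) f : smooth f -> smooth (fun x => f (stretch c x)).
Proof.
move=> sf k; apply: (Ck_comp_affine _ (stretch_linear c) (sf k)) => x.
have c2 : c * y.2 @[y --> x] --> c * x.2.
  by apply: cvgM; [exact: cvg_cst|exact: snd_continuous].
apply/cvg_ballP => e e0; have b1 : \forall y \near x, ball x e y by exact: near_ball.
have b2 : \forall y \near x, ball (c * x.2) e (c * y.2) by exact: (cvg_ball c2 e0).
by apply: filterS2 b1 b2 => y [/= h1 _] h2; split.
Qed.

Lemma derive_dirZ f (c : R) (e y : R * R) : Ck 1 f -> 'D_(c *: e) f y = c * 'D_e f y.
Proof.
move=> sf; pose l (t : R) := y + t *: e.
have lin (t v z : R) : l (t *: v + z) = t *: (v *: e) + l z.
  by rewrite /l scalerDl addrCA scalerA.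
have [dl _] := is_derive_line e y 0 sf.
have l0 : l 0 = y by rewrite /l scale0r addr0.
have h1 := @derive_comp_affine _ _ _ l (fun v : R => v *: e) f 1 0 lin.
have h2 := @derive_comp_affine _ _ _ l (fun v : R => v *: e) f c 0 lin.
rewrite l0 scale1r in h1; rewrite l0 in h2.
by rewrite -h2 -h1 (derive_real c dl).2.
Qed.

Lemma grad_stretch (c : R) f x : smooth f ->
  grad (fun x => f (stretch c x)) x = stretch c (grad f (stretch c x)).
Proof.
move=> sf; rewrite /grad !(derive_comp_affine f _ _ (stretch_linear c)).
have -> : stretch c ((1, 0) : R * R) = (1, 0) by rewrite /stretch /= mulr0.
have -> : stretch c ((0, 1) : R * R) = c *: ((0, 1) : R * R).
  by apply: injective_projections; rewrite !coordE /= ?mulr0.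
by rewrite derive_dirZ//; exact: sf.
Qed.

Lemma grad_reflect f x : smooth f -> grad (fun x => f (rho x)) x = rho (grad f (rho x)).
Proof. by move=> sf; rewrite reflectE grad_stretch. Qed.

Lemma strip_smooth_reflect f : smooth_in f -> smooth_in (fun x => f (rho x)).
Proof.
move=> [sf [b [B [ba hb]]]]; split; first by rewrite reflectE; exact: smooth_stretch.
by exists b, B; split => // x /hb[/= h1 h2]; split => //; rewrite -normrN.
Qed.

Lemma residual_reflect lambda u phi : smooth_in u -> smooth_in phi ->
  residual p lambda (fun x => u (rho x)) phi = residual p lambda u (fun x => phi (rho x)).
Proof.
move=> su sphi; have [U1 U2] := strip_smooth_Lpv hp su; have [P1 P2] := strip_smooth_Lpv hp sphi.
have gr f : smooth_in f -> grad (fun x => f (rho x)) = fun x => rho (grad f (rho x)).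
  by move=> [sf _]; apply/funext => x; exact: grad_reflect.
by rewrite /residual !gr// !sc_reflect !pairing_reflect.
Qed.

Lemma Lpint_smooth_reflect f : smooth_in f ->
  N (sc (fun x => f (rho x))) = N (sc f) /\ N (grad (fun x => f (rho x))) = N (grad f).
Proof.
move=> sf; have [L1 L2] := strip_smooth_Lpv hp sf.
rewrite (_ : grad (fun x => f (rho x)) = fun x => rho (grad f (rho x))).
  by rewrite sc_reflect (Lpv_reflect L1).2 (Lpv_reflect L2).2.
by apply/funext => x; apply: grad_reflect; case: sf.
Qed.

Lemma gradN phi x : smooth_in phi -> grad (fun x => - phi x) x = - grad phi x.
Proof.
move=> s; have := gradZ (-1) x s; rewrite scaleN1r => <-; congr (grad _ x).
by apply/funext => y; rewrite mulN1r.
Qed.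

Lemma residualNl lambda u phi : smooth_in u -> smooth_in phi ->
  residual p lambda (fun x => - u x) phi = - residual p lambda u phi.
Proof.
move=> su sphi; have [U1 U2] := strip_smooth_Lpv hp su; have [P1 P2] := strip_smooth_Lpv hp sphi.
rewrite /residual opprB addrC; have pN a b : Lpv p a -> Lpv p b -> pairing p (fun x => - a x) b = - pairing p a b.
  move=> La Lb; rewrite !pairing.unlock -IntN; last exact: pint_pairing.
  by congr Int; apply/funext => x; rewrite pfieldN dotNl.
rewrite (_ : grad (fun x => - u x) = fun x => - grad u x); last by apply/funext => x; exact: (gradN x su).
rewrite (_ : sc (fun x => - u x) = fun x => - sc u x).
  by rewrite !pN// mulrN opprK addrC.
by apply/funext => x; apply: injective_projections; rewrite /sc !coordE /= ?oppr0.
Qed.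

Definition disjoint_fields a b := forall x, a x = 0 \/ b x = 0.

Lemma Lpint_disjoint a b : disjoint_fields a b -> Lpv p a -> Lpv p b ->
  N (fun x => a x + b x) = N a + N b.
Proof.
move=> ab La Lb; rewrite !Lpint.unlock -IntD; [|by case: La|by case: Lb].
congr Int; apply/funext => x.
by case: (ab x) => ->; rewrite enorm0 powR0 ?gt_eqF// ?add0r ?addr0.
Qed.

Lemma pairing_disjoint a b c : disjoint_fields a b -> Lpv p a -> Lpv p b -> Lpv p c ->
  pairing p (fun x => a x + b x) c = pairing p a c + pairing p b c.
Proof.
move=> ab La Lb Lc; rewrite !pairing.unlock -IntD; try exact: pint_pairing.
congr Int; apply/funext => x.
by case: (ab x) => ->; rewrite pfield0 dot0l ?add0r ?addr0.
Qed.

Definition below (c : R) f := exists2 d : R, 0 < d & forall x, f x != 0 -> x.2 <= c - d.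
Definition above (c : R) f := exists2 d : R, 0 < d & forall x, f x != 0 -> c + d <= x.2.

(** The gaps ensure that near each point one of the two functions vanishes identically, so that the
    gradients are disjoint as well. *)
Lemma below_above_disjoint c f u : below c f -> above c u ->
  disjoint_fields (sc f) (sc u) /\ disjoint_fields (grad f) (grad u).
Proof.
move=> [d d0 hf] [e e0 hu].
have key x : (\forall y \near x, f y = 0) \/ (\forall y \near x, u y = 0).
  have [h|h] := ltP x.2 (c + e).
    right; apply: filterS (near_snd_lt h) => y ye; apply/eqP; apply: contraTT ye => /hu.
    by rewrite -leNgt.
  have h' : c - d < x.2 by lra.
  left; apply: filterS (near_snd_gt h') => y ye; apply/eqP; apply: contraTT ye => /hf.
  by rewrite -leNgt.
split => x; case: (key x) => h; [left|right|left|right]; try exact: grad_near0.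
  by rewrite /sc (nbhs_singleton h).
by rewrite /sc (nbhs_singleton h).
Qed.

(** At each point one of the two fields is zero, so [pfield] of their sum is the sum of their
    [pfield]s: here additivity in the nonlinear argument is available. *)
Lemma disjoint_sum lambda c f u : below c f -> above c u -> smooth_in f -> smooth_in u ->
  [/\ N (sc (fun x => f x + u x)) = N (sc f) + N (sc u),
     N (grad (fun x => f x + u x)) = N (grad f) + N (grad u) &
     forall phi, smooth_in phi -> residual p lambda (fun x => f x + u x) phi =
       residual p lambda f phi + residual p lambda u phi].
Proof.
move=> bf au sf su; have [F1 F2] := strip_smooth_Lpv hp sf; have [U1 U2] := strip_smooth_Lpv hp su.
have [d1 d2] := below_above_disjoint bf au.
have eg : grad (fun x => f x + u x) = fun x => grad f x + grad u x by apply/funext => x; exact: (gradD x sf su).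
rewrite /residual eg -scD; split; [exact: Lpint_disjoint|exact: Lpint_disjoint|].
move=> phi sphi; have [P1 P2] := strip_smooth_Lpv hp sphi.
by rewrite !pairing_disjoint//; ring.
Qed.

End reflection.

Section chain.
Context {R : realType} (alpha p : R) (hp : 1 < p).
Local Notation sc := scalar_field.
Local Notation N := (Lpint p).
Local Notation smooth_in := (strip_smooth alpha).
Local Notation rho := reflect.
Local Notation D1 f := ('D_(1%R : R) f).
Implicit Types (x : R * R) (f g u phi psi : R * R -> R).

Let p0 : 0 < p. Proof. exact: lt_trans hp. Qed.

Definition odd_ext g x := - g (rho x) + g x.

(** The two halves are separated by x_2 = 0, so the integrals double. Reflection and sign are moved
    onto the test function, of which twice the odd part remains. *)
Lemma odd_ext_facts (lambda L : R) g : cell_smooth alpha L g ->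
  [/\ smooth_in (odd_ext g),
     exists2 d : R, 0 < d & forall x, odd_ext g x != 0 -> - L + d <= x.2 <= L - d,
     N (sc (odd_ext g)) = 2 * N (sc g), N (grad (odd_ext g)) = 2 * N (grad g) &
     forall phi, smooth_in phi ->
       residual p lambda (odd_ext g) phi = residual p lambda g (fun x => phi x - phi (rho x))].
Proof.
move=> [sg [d d0 hg]]; have sr := strip_smooth_reflect sg; have sn := strip_smoothN sr.
have bn : below 0 (fun x => - g (rho x)).
  by exists d => // x; rewrite oppr_eq0 => /hg/andP[/= h _]; lra.
have ag : above 0 g by exists d => // x /hg/andP[h _]; rewrite add0r.
have [e1 e2 e3] := disjoint_sum hp lambda bn ag sn sg.
have [r1 r2] := Lpint_smooth_reflect hp sg.
have n1 : N (sc (fun x => - g (rho x))) = N (sc g).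
  rewrite -r1 -[RHS]LpintN; congr Lpint; apply/funext => x.
  by apply: injective_projections; rewrite /sc !coordE /= ?oppr0.
have n2 : N (grad (fun x => - g (rho x))) = N (grad g).
  rewrite -r2 -[RHS]LpintN; congr Lpint; apply/funext => x; exact: (gradN x sr).
split.
- exact: strip_smoothD.
- exists d => // x h; have [g0|gx] := eqVneq (g x) 0.
    by move: h; rewrite /odd_ext g0 addr0 oppr_eq0 => /hg/= /andP[? ?]; apply/andP; split; lra.
  by have /andP[? ?] := hg x gx; apply/andP; split; lra.
- by rewrite /odd_ext e1 n1; ring.
- by rewrite /odd_ext e2 n2; ring.
move=> phi sphi; have sphir := strip_smooth_reflect sphi.
have sphirn := strip_smoothN sphir.
rewrite /odd_ext e3// (residualNl hp lambda sr sphi) (residual_reflect hp lambda sg sphi) addrC.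
rewrite (residualD hp lambda sg sphi sphirn); congr (_ + _).
have := residualZ hp lambda (-1) sg sphir; rewrite mulN1r => <-.
by congr residual; apply/funext => x; rewrite mulN1r.
Qed.

Lemma residual_shift lambda (k : R * R) u phi : k.1 = 0 -> smooth_in u -> smooth_in phi ->
  residual p lambda (fun x => u (x - k)) phi = residual p lambda u (fun x => phi (x + k)).
Proof.
move=> k1 su sphi; have [U1 U2] := strip_smooth_Lpv hp su; have [P1 P2] := strip_smooth_Lpv hp sphi.
have ps a b : Lpv p a -> Lpv p b -> pairing p (fun x => a (x - k)) b = pairing p a (fun x => b (x + k)).
  move=> La Lb; have [Lbk _] := Lpv_shift k Lb.
  rewrite !pairing.unlock -(Int_shift (- k) (pint_pairing hp La Lbk)).2.
  by congr Int; apply/funext => x; rewrite subrK.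
rewrite /residual; have -> : grad (fun x => u (x - k)) = fun x => grad u (x - k).
  by apply/funext => x; exact: grad_shift.
have -> : grad (fun x => phi (x + k)) = fun x => grad phi (x + k).
  by apply/funext => x; exact: grad_shift.
by rewrite (ps _ _ U2 P2) (ps (sc u) (sc phi) U1 P1).
Qed.

Lemma Lpint_smooth_shift (k : R * R) u : smooth_in u ->
  N (sc (fun x => u (x + k))) = N (sc u) /\ N (grad (fun x => u (x + k))) = N (grad u).
Proof.
move=> su; have [U1 U2] := strip_smooth_Lpv hp su.
split; first exact: (Lpv_shift k U1).2.
rewrite -(Lpv_shift k U2).2; congr Lpint; apply/funext => x; exact: grad_shift.
Qed.

Lemma residual_local lambda (a b : R) u phi :
  (exists2 d : R, 0 < d & forall x, u x != 0 -> a + d <= x.2 <= b - d) ->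
  (forall x, a < x.2 < b -> phi x = 0) -> residual p lambda u phi = 0.
Proof.
move=> [d d0 hu] hphi.
have z (f c : R * R -> R * R) : (forall x, f x = 0 \/ c x = 0) -> pairing p f c = 0.
  move=> h; rewrite pairing.unlock -[RHS]Int0; congr Int; apply/funext => x.
  by case: (h x) => ->; rewrite ?pfield0 ?dot0l// dotC dot0l.
have key x : (a < x.2 < b) \/ (x.2 < a + d \/ b - d < x.2).
  have [h1|h1] := ltP a x.2; last by right; left; lra.
  by have [h2|h2] := ltP x.2 b; [left|right; right; lra].
rewrite /residual !z ?mulr0 ?subr0// => x; have [h|h] := key x.
- by right; rewrite /sc hphi.
- left; rewrite /sc; have [->//|/hu/andP[? ?]] := eqVneq (u x) 0.
  by exfalso; case: h; lra.
- have /andP[h1 h2] := h; right; apply: grad_near0.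
  apply: filterS2 (near_snd_gt h1) (near_snd_lt h2) => y y1 y2.
  by apply: hphi; rewrite y1.
- by left; apply: grad_out hu _.
Qed.

Fixpoint chain (G : R * R -> R) (L : R) n x : R :=
  if n is m.+1 then chain G L m x + G (x - (0, 2 * L * m%:R)) else 0.

(** The transpose of [chain]: testing a chain of copies of [G] with [f] amounts to testing [G] with
    [fold f L n]. *)
Fixpoint fold (f : R * R -> R) (L : R) n x : R :=
  if n is m.+1 then fold f L m x + f (x + (0, 2 * L * m%:R)) else 0.

Lemma residual0 lambda phi : residual p lambda (fun=> 0 : R) phi = 0.
Proof.
apply: (@residual_local lambda 0 0) => [|x /andP[? ?]]; last by lra.
by exists 1 => // x; rewrite eqxx.
Qed.

(** The first [n] copies end below the level [(2 * n - 1) * L] and the next one begins above it, so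
    [disjoint_sum] applies at each step of the induction. *)
Lemma chain_facts (lambda L d : R) G n : 0 < alpha -> 0 < L -> 0 < d -> smooth_in G ->
  (forall x, G x != 0 -> - L + d <= x.2 <= L - d) ->
  [/\ smooth_in (chain G L n),
      forall x, chain G L n x != 0 -> - L + d <= x.2 <= (2 * n%:R - 1) * L - d,
      N (sc (chain G L n)) = n%:R * N (sc G), N (grad (chain G L n)) = n%:R * N (grad G) &
      forall phi, smooth_in phi -> residual p lambda (chain G L n) phi =
        \sum_(k < n) residual p lambda G (fun x => phi (x + (0, 2 * L * k%:R)))].
Proof.
move=> a0 L0 d0 sG hG; elim: n => [|n [s1 h1 N1 N2 r1]].
  have s0 : smooth_in (chain G L 0).
    split; first by move=> k; exact: Ck_cst.
    by exists 0, 0; split => // x; rewrite eqxx.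
  have [Z1 Z2] := strip_smooth_Lpv hp s0.
  have z (a : R * R -> R * R) : (forall x, a x = 0) -> N a = 0.
    move=> a_0; rewrite Lpint.unlock -[RHS]Int0; congr Int; apply/funext => x.
    by rewrite a_0 enorm0 powR0// gt_eqF.
  split => //.
  - by move=> x; rewrite eqxx.
  - by rewrite mul0r; apply: z.
  - by rewrite mul0r; apply: z => x; apply: grad_near0; exact: filterE.
  - by move=> phi _; rewrite big_ord0 residual0.
have k1 : ((0, 2 * L * n%:R) : R * R).1 = 0 by [].
have kn1 : (- ((0, 2 * L * n%:R) : R * R)).1 = 0 by rewrite coordE oppr0.
have sS := strip_smooth_shift kn1 sG.
have hS x : G (x - (0, 2 * L * n%:R)) != 0 ->
    - L + d + 2 * L * n%:R <= x.2 <= L - d + 2 * L * n%:R.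
  by move=> /hG; rewrite !coordE /= => /andP[? ?]; apply/andP; split; lra.
have be : below ((2 * n%:R - 1) * L) (chain G L n) by exists d => // x /h1/andP[].
have ab : above ((2 * n%:R - 1) * L) (fun x => G (x - (0, 2 * L * n%:R))).
  by exists d => // x /hS/andP[? _]; lra.
have [e1 e2 e3] := disjoint_sum hp lambda be ab s1 sS.
have [n1 n2] := Lpint_smooth_shift (- ((0, 2 * L * n%:R) : R * R)) sG.
have Ln : 0 <= L * n%:R by rewrite mulr_ge0// ltW.
split.
- exact: strip_smoothD.
- move=> x; rewrite /= => nz; rewrite -natr1.
  have [c0|cx] := eqVneq (chain G L n x) 0.
    by move: nz; rewrite c0 add0r => /hS/andP[? ?]; apply/andP; split; lra.
  by have /andP[? ?] := h1 x cx; apply/andP; split; lra.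
- by rewrite /= e1 n1 N1 -natr1 mulrDl mul1r.
- by rewrite /= e2 n2 N2 -natr1 mulrDl mul1r.
by move=> phi sphi; rewrite /= e3// r1// big_ord_recr/= residual_shift.
Qed.

(** The constant [C] comes from iterating the triangle inequality and grows with [n]; this is
    harmless because the cell function is chosen after [n]. *)
Lemma fold_facts (lambda L : R) n : 0 < alpha -> exists2 C : R, 0 <= C & forall f G,
  smooth_in f -> smooth_in G ->
  [/\ smooth_in (fold f L n), N (grad (fold f L n)) <= C * N (grad f) &
    residual p lambda G (fold f L n) =
      \sum_(k < n) residual p lambda G (fun x => f (x + (0, 2 * L * k%:R)))].
Proof.
move=> a0; elim: n => [|n [C C0 ih]].
  have s0 : smooth_in (fun=> 0 : R).
    split; first by move=> k; exact: Ck_cst.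
    by exists 0, 0; split => // x; rewrite eqxx.
  have g0 : grad (fun=> 0 : R) = fun=> 0 by apply/funext => x; apply: grad_near0; exact: filterE.
  exists 0 => // f G sf sG; split; first exact: s0.
    rewrite mul0r /= g0 Lpint.unlock le_eqVlt -[X in _ == X]Int0; apply/orP; left; apply/eqP.
    by congr Int; apply/funext => x; rewrite enorm0 powR0// gt_eqF.
  rewrite big_ord0 -[RHS](mul0r (residual p lambda G (fun=> 0 : R))) -(residualZ hp lambda 0 sG s0).
  by congr residual; apply/funext => x; rewrite mul0r.
exists (2 `^ p * (C + 1)) => [|f G sf sG]; first by rewrite mulr_ge0 ?powR_ge0// addr_ge0.
have [s1 N1 r1] := ih f G sf sG.
have k1 : ((0, 2 * L * n%:R) : R * R).1 = 0 by [].
have sS := strip_smooth_shift k1 sf.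
have [n1 n2] := Lpint_smooth_shift (0, 2 * L * n%:R) sf.
have [S1 S2] := strip_smooth_Lpv hp sS; have [F1 F2] := strip_smooth_Lpv hp s1.
split; first exact: strip_smoothD.
  rewrite (_ : grad _ = fun x => grad (fold f L n) x + grad (fun x => f (x + (0, 2 * L * n%:R))) x).
    apply: (le_trans (LpintD_le2 hp F2 S2)); rewrite -[leRHS]mulrA; apply: ler_wpM2l; first exact: powR_ge0.
    by rewrite n2 mulrDl mul1r lerD2r.
  by apply/funext => x; exact: (gradD x s1 sS).
by rewrite /= (residualD hp lambda sG s1 sS) r1 big_ord_recr.
Qed.

(** The sum telescopes: the upper edge of one period is the lower edge of the next. *)
Lemma fold_boundary f (L : R) n t :
  fold f L n (t, L) - fold f L n (t, - L) = f (t, (2 * n%:R - 1) * L) - f (t, - L).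
Proof.
elim: n => [|n ih]; first by rewrite /= subrr mulr0 sub0r mulN1r subrr.
rewrite /= opprD addrACA ih.
have -> : (t, L) + (0, 2 * L * n%:R) = (t, (2 * n.+1%:R - 1) * L).
  by rewrite -natr1; apply: injective_projections; rewrite !coordE /=; ring.
have -> : (t, - L) + (0, 2 * L * n%:R) = (t, (2 * n%:R - 1) * L).
  by apply: injective_projections; rewrite !coordE /=; ring.
by rewrite addrC addrA subrK.
Qed.

End chain.

Section chain_estimate.
Context {R : realType} (alpha p : R) (a0 : 0 < alpha) (hp : 1 < p).
Local Notation sc := scalar_field.
Local Notation N := (Lpint p).
Local Notation smooth_in := (strip_smooth alpha).
Local Notation rho := reflect.
Local Notation D1 f := ('D_(1%R : R) f).
Implicit Types (x : R * R) (f g u phi psi : R * R -> R).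

Let p0 : 0 < p. Proof. exact: lt_trans hp. Qed.

Lemma Lpint_mul_le (M : R) phi (th : R * R -> R) : smooth_in phi -> smooth th -> 0 <= M ->
  (forall x, `|th x| <= 1) -> (forall x, enorm (grad th x) <= M) ->
  N (sc (fun x => phi x * th x)) <= N (sc phi) /\
  N (grad (fun x => phi x * th x)) <= 2 `^ p * (N (grad phi) + M `^ p * N (sc phi)).
Proof.
move=> s1 s2 M0 th1 gM; have [P1 P2] := strip_smooth_Lpv hp s1.
have mth : mes th := mes_continuous (Ck_continuous (s2 0%N)).
have mgth : mesv (grad th).
  have cth v : continuous ('D_v th) by have [_ /(_ v)[_ []]] := s2 1%N.
  by split; apply: mes_continuous; exact: cth.
split.
  have -> : sc (fun x => phi x * th x) = (fun x => th x *: sc phi x).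
    by rewrite scZ; under [in RHS]eq_fun do rewrite mulrC.
  by have [_] := LpvZ hp mth P1 th1; rewrite powR1 mul1r.
rewrite (_ : grad _ = fun x => th x *: grad phi x + phi x *: grad th x); last first.
  by apply/funext => x; exact: (grad_mul x s1 s2).
have [L1 N1] := LpvZ hp mth P2 th1.
have [L2 N2] : Lpv p (fun x => phi x *: grad th x) /\
    N (fun x => phi x *: grad th x) <= M `^ p * N (sc phi).
  apply: Lpv_le => //; first by apply: mesvZ => //; case/Lpv_sc : P1.
  by move=> x; rewrite enormZ enorm_sc mulrC ler_wpM2r.
apply: (le_trans (LpintD_le2 hp L1 L2)); apply: ler_wpM2l; first exact: powR_ge0.
by rewrite powR1 mul1r in N1; exact: lerD.
Qed.

Lemma cutoff_split (L : R) : 0 < L -> exists2 E : R, 0 <= E &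
  forall n phi, smooth_in phi -> N (sc phi) + N (grad phi) <= 2 -> exists f psi,
  [/\ [/\ smooth_in f, N (grad f) <= E & forall t, f (t, - L) = 0 /\ f (t, (2 * n%:R - 1) * L) = 0],
     [/\ smooth_in psi, N (sc psi) <= 2, N (grad psi) <= E &
        forall x, 0 <= x.2 <= (2 * n%:R - 2) * L -> psi x = 0] &
     phi = fun x => f x + psi x].
Proof.
move=> L0; have [Ms Ms0 hMs] := @derive_step_le R.
pose M := 2 * Ms / L; have M0 : 0 <= M by rewrite !mulr_ge0 ?invr_ge0 ?(ltW L0) ?(ltW Ms0).
have Mp0 : 0 <= M `^ p := powR_ge0 _ _.
have T2 : 0 <= 2 `^ p :> R := powR_ge0 _ _.
exists (2 `^ p * (2 + M `^ p * 2)); first by rewrite mulr_ge0// addr_ge0// mulr_ge0.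
move=> n phi sphi phi2.
pose cut := plateau (- L) ((2 * n%:R - 1) * L) L; pose th x : R := cut x.2.
have scut : smooth cut by exact: smooth_plateau.
have sth : smooth th := smooth_snd scut.
have gM x : enorm (grad th x) <= M.
  by rewrite (grad_snd x scut) enorm_snd; exact: derive_plateau_le.
have th01 x : 0 <= th x <= 1 by exact: plateau01.
pose th' x : R := 1 - th x.
have sth' : smooth th'.
  move=> k; have := CkD (Ck_cst k (1 : R)) (CkM (Ck_cst k (-1 : R)) (sth k)).
  by apply: eq_Ck => x; rewrite /th' mulN1r.
have hth x : `|th x| <= 1 by have /andP[t0 t1] := th01 x; rewrite ger0_norm.
have hth' x : `|th' x| <= 1.
  by have /andP[t0 t1] := th01 x; rewrite /th' ger0_norm ?subr_ge0// lerBlDr lerDl.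
have gM' x : enorm (grad th' x) <= M.
  have -> : grad th' x = - grad th x; last by rewrite enormN.
  have dth v : derivable th x v by have [_ /(_ v)[]] := sth 1%N.
  rewrite /grad; apply: injective_projections; rewrite !coordE /=;
    by rewrite deriveB ?derive_cst ?sub0r.
have phN0 : 0 <= N (sc phi) := Lpint_ge0 _ _.
have phG0 : 0 <= N (grad phi) := Lpint_ge0 _ _.
have phN2 : N (sc phi) <= 2 by apply: le_trans phi2; rewrite lerDl.
have phG2 : N (grad phi) <= 2 by apply: le_trans phi2; rewrite lerDr.
have le2 : 2 `^ p * (N (grad phi) + M `^ p * N (sc phi)) <= 2 `^ p * (2 + M `^ p * 2).
  by apply: ler_wpM2l => //; apply: lerD => //; exact: ler_wpM2l.
have [f1 f2] := Lpint_mul_le sphi sth M0 hth gM.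
have [q1 q2] := Lpint_mul_le sphi sth' M0 hth' gM'.
exists (fun x => phi x * th x), (fun x => phi x * th' x); split; [split|split|].
- exact: strip_smoothM sphi sth.
- exact: le_trans f2 le2.
- by move=> t; rewrite /th /cut /= !plateau_out ?mulr0//; [right|left].
- exact: strip_smoothM sphi sth'.
- exact: le_trans q1 phN2.
- exact: le_trans q2 le2.
- move=> x /andP[x1 x2]; rewrite /th' /th /cut plateau_in ?subrr ?mulr0//.
  by apply/andP; split; lra.
by apply/funext => x; rewrite /th'; ring.
Qed.

(* Unfolding by reflections turns f into a function W on one cell that vanishes on its
   horizontal edges. *)
Lemma residual_chain_fold (lambda L E : R) n : 0 < L -> 0 <= E -> exists2 K : R, 0 <= K &
  forall (eps : R) g, cell_smooth alpha L g ->
  (forall w, cell_smooth alpha L w -> N (grad w) <= K -> `|residual p lambda g w| <= eps) ->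
  forall f, smooth_in f -> N (grad f) <= E ->
  (forall t, f (t, - L) = 0 /\ f (t, (2 * n%:R - 1) * L) = 0) ->
  `|residual p lambda (chain (odd_ext g) L n) f| <= eps.
Proof.
move=> L0 E0; have [C C0 hC] := fold_facts hp lambda L n a0.
have T2 : 0 <= 2 `^ p :> R := powR_ge0 _ _.
have CE0 : 0 <= C * E by exact: mulr_ge0.
(* The inner term bounds the energy of the folded function minus its reflection; the outer factor
   and the 1 come from [cell_approximation]. *)
exists (2 `^ p * (2 `^ p * (C * E + C * E) + 1)).
  by rewrite mulr_ge0// addr_ge0// mulr_ge0// addr_ge0.
move=> eps g cg crit f sf fE f0.
have [sG [d d0 hG] _ _ rG] := odd_ext_facts hp lambda cg.
have [_ _ _ _ rU] := chain_facts hp lambda n a0 L0 d0 sG hG.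
have [sP NP rP] := hC f _ sf sG.
rewrite rU// -rP rG//; move: (fold f L n) sP NP (fold_boundary f L n) => F sF NF Fb.
have sFr := strip_smooth_reflect sF.
have [P1 P2] := strip_smooth_Lpv hp sF; have [Q1 Q2] := strip_smooth_Lpv hp sFr.
have [_ r2] := Lpint_smooth_reflect hp sF.
have NFE : N (grad F) <= C * E by apply: (le_trans NF); exact: ler_wpM2l.
have LQ := LpvN hp Q2.
have sW := strip_smoothB sF sFr.
have W0 t : F (t, 0) - F (rho (t, 0)) = 0 by rewrite /rho /= oppr0 subrr.
(* On the edge x_2 = L the odd part is the difference of the folded values at the two edges, that
   is, of [f] at the two ends of the chain. *)
have WL t : F (t, L) - F (rho (t, L)) = 0.
  by rewrite -[rho _]/(t, - L) Fb !(f0 t).1 (f0 t).2 subrr.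
have WK : N (grad (fun x => F x - F (rho x))) <= 2 `^ p * (C * E + C * E).
  have -> : grad (fun x => F x - F (rho x)) = fun x => grad F x + - grad (fun x => F (rho x)) x.
    by apply/funext => x; exact: (grad_sub x sF sFr).
  apply: (le_trans (LpintD_le2 hp P2 LQ)); apply: (ler_wpM2l T2).
  by rewrite LpintN r2; apply: lerD.
have [w [cw wK e]] := cell_approximation hp cg sW W0 WL WK.
by rewrite -e; exact: crit.
Qed.

(* Only the first and the last period meet the support of psi. *)
Lemma residual_chain_ends (lambda L E : R) n g psi : 0 <= lambda -> 0 < L ->
  cell_smooth alpha L g -> N (sc g) = 1 -> N (grad g) <= lambda + 1 ->
  smooth_in psi -> N (sc psi) <= 2 -> N (grad psi) <= E ->
  (forall x, 0 <= x.2 <= (2 * n.+2%:R - 2) * L -> psi x = 0) ->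
  `|residual p lambda (chain (odd_ext g) L n.+2) psi| <=
  2 * ((2 * (lambda + 1) + E) + lambda * (2 + 2)).
Proof.
move=> l0 L0 cg g1 gE spsi psiN psiG psi0.
have [sG [d d0 hG] G1 G2 _] := odd_ext_facts hp lambda cg.
have [_ _ _ _ ->//] := chain_facts hp lambda n.+2 a0 L0 d0 sG hG.
have one (k : R) : `|residual p lambda (odd_ext g) (fun x => psi (x + (0, 2 * L * k)))| <=
    (2 * (lambda + 1) + E) + lambda * (2 + 2).
  have k1 : ((0, 2 * L * k) : R * R).1 = 0 by [].
  move: ((0, 2 * L * k) : R * R) k1 => h h1.
  have sS := strip_smooth_shift h1 spsi.
  have [n1 n2] := Lpint_smooth_shift hp h spsi.
  apply: (le_trans (residual_le hp lambda sG sS)).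
  rewrite n1 n2 G1 G2 g1 mulr1 (ger0_norm l0); apply: lerD.
    by apply: lerD => //; exact: ler_wpM2l.
  by apply: ler_wpM2l => //; exact: lerD.
rewrite big_ord_recl big_ord_recr /= big1 ?add0r.
  by rewrite [leRHS]mulr_natl [leRHS]mulr2n; apply: (le_trans (ler_normD _ _)); apply: lerD; exact: one.
move=> i _; apply: (@residual_local R p lambda (- L) L) => [|x /andP[x1 x2]].
  by exists d.
have iL : 0 <= L * (i : nat)%:R by rewrite mulr_ge0// ltW.
have iL2 : L * (i.+1)%:R <= L * n%:R by rewrite ler_pM2l// ler_nat.
apply: psi0; rewrite !coordE /= /bump /= add1n.
by rewrite -!natr1 in iL2 *; apply/andP; split; lra.
Qed.

(** The order of quantifiers is the content: [B] precedes [n], so normalising a long chain makes it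
    negligible, whereas [K] may depend on [n] because [g] comes last. *)
Lemma chain_residual_le (lambda L : R) : 0 <= lambda -> 0 < L ->
  exists2 B : R, 0 <= B & forall n : nat, exists2 K : R, 0 <= K &
  forall (eps : R) g, cell_smooth alpha L g -> N (sc g) = 1 -> N (grad g) <= lambda + 1 ->
  (forall w, cell_smooth alpha L w -> N (grad w) <= K -> `|residual p lambda g w| <= eps) ->
  forall phi, smooth_in phi -> N (sc phi) + N (grad phi) <= 2 ->
  `|residual p lambda (chain (odd_ext g) L n.+2) phi| <= eps + B.
Proof.
move=> l0 L0; have [E E0 split_phi] := cutoff_split L0.
exists (2 * ((2 * (lambda + 1) + E) + lambda * (2 + 2))) => [|n].
  by rewrite mulr_ge0// !addr_ge0// mulr_ge0// addr_ge0.
have [K K0 hK] := residual_chain_fold lambda n.+2 L0 E0.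
exists K => // eps g cg g1 gE crit phi sphi phi2.
have [f [psi [[sf fE f0] [sp pN pE psi0] ->]]] := split_phi n.+2 phi sphi phi2.
have [sG [d d0 hG] _ _ _] := odd_ext_facts hp lambda cg.
have [sU _ _ _ _] := chain_facts hp lambda n.+2 a0 L0 d0 sG hG.
rewrite (residualD hp lambda sU sf sp); apply: (le_trans (ler_normD _ _)); apply: lerD.
  exact: (hK eps g).
exact: residual_chain_ends.
Qed.

End chain_estimate.

(** * Product functions and the cell of optimal length *)

Section products.
Context {R : realType} (alpha p : R) (hp : 1 < p).
Local Notation mu := (@lebesgue_measure R).
Local Notation sc := scalar_field.
Local Notation N := (Lpint p).
Local Notation smooth_in := (strip_smooth alpha).
Local Notation D1 f := ('D_(1%R : R) f).
Implicit Types (x : R * R) (f g u phi psi : R * R -> R).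

Let p0 : 0 < p. Proof. exact: lt_trans hp. Qed.

Lemma Lpint_product (a b : R -> R) (A B : R) : continuous a -> continuous b ->
  Int1 p a = A%:E -> Int1 p b = B%:E -> Lpv p (sc (fun x => a x.1 * b x.2)) ->
  N (sc (fun x => a x.1 * b x.2)) = A * B.
Proof.
move=> ca cb eA eB L; have A0 : (0 <= A%:E)%E by rewrite -eA Int1_ge0.
have [e _] := Lpint_slices L; apply: EFin_inj; rewrite e /= EFinM -eB [in RHS]Int1.unlock.
have mb := measurable_powR_norm p cb.
rewrite -(ge0_integralZl _ measurableT mb _ A0); last by move=> y _; rewrite lee_fin powR_ge0.
apply: eq_integral => y _.
have -> : (fun t : R => a t * b y) = (fun t => b y * a t) by apply/funext => t; rewrite mulrC.
by rewrite (Int1Z p (b y) ca) eA muleC.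
Qed.

Lemma smooth_fst (a : R -> R) : smooth a -> smooth (fun x : R * R => a x.1).
Proof. by move=> sa k; apply: (Ck_comp_affine (l := fst) (L := fst)) => //; exact: fst_continuous. Qed.

Lemma grad_fst (a : R -> R) x : smooth a -> grad (fun x => a x.1) x = (D1 a x.1, 0).
Proof.
move=> sa; have da : derivable a x.1 1 by have [_ /(_ 1)[]] := sa 1%N.
rewrite /grad !(derive_comp_affine (l := fst) (L := fst) a)//=; congr (_, _).
by rewrite (derive_real 0 da).2 mul0r.
Qed.

Lemma product_smooth (a b : R -> R) (B : R) : itv_smooth alpha a -> smooth b ->
  (forall y, b y != 0 -> `|y| <= B) ->
  smooth_in (fun x => a x.1 * b x.2) /\
  forall x, grad (fun x => a x.1 * b x.2) x = (D1 a x.1 * b x.2, a x.1 * D1 b x.2).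
Proof.
move=> [sa [c [ca ha]]] sb hb; have s1 := smooth_fst sa; have s2 := smooth_snd sb.
split; first split.
- by move=> k; apply: CkM.
- exists c, B; split => // x; rewrite mulf_eq0 negb_or => /andP[/ha ? /hb ?]; split.
  + by [].
  + by [].
move=> x; have g1 := grad_fst x sa; have g2 := grad_snd x sb.
have d1 v : derivable (fun x : R * R => a x.1) x v by have [_ /(_ v)[]] := s1 1%N.
have d2 v : derivable (fun x : R * R => b x.2) x v by have [_ /(_ v)[]] := s2 1%N.
have e1 : 'D_((1, 0) : R * R) (fun x : R * R => a x.1) x = D1 a x.1 := congr1 fst g1.
have e1' : 'D_((0, 1) : R * R) (fun x : R * R => a x.1) x = 0 := congr1 snd g1.
have e2 : 'D_((1, 0) : R * R) (fun x : R * R => b x.2) x = 0 := congr1 fst g2.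
have e2' : 'D_((0, 1) : R * R) (fun x : R * R => b x.2) x = D1 b x.2 := congr1 snd g2.
rewrite /grad.
by rewrite (derive_mul (d1 _) (d2 _)) (derive_mul (d1 _) (d2 _)) e1 e1' e2 e2' !mulr0 addr0 add0r mulrC.
Qed.

Lemma Int1_gt0 (f : R -> R) (u v : R) : u < v -> continuous f ->
  (forall y, u <= y <= v -> f y = 1) -> (0 < Int1 p f)%E.
Proof.
move=> uv cf f1; pose I : set R := `[u, v]%classic.
have mI : measurable (I : set (measurableTypeR R)) by exact: measurable_itv.
apply: (@lt_le_trans _ _ (\int[mu]_(x in I) (1 : R)%:E)%E).
  have eI : (mu I = (v - u)%:E)%E by rewrite lebesgue_measure_itv/= lte_fin uv EFinB.
  by rewrite integral_cst// mul1e; apply: (@lt_le_trans _ _ (v - u)%:E); [rewrite lte_fin subr_gt0|rewrite -eI].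
rewrite Int1.unlock; apply: (@le_trans _ _ (\int[mu]_(x in I) (`|f x| `^ p)%:E)%E).
  rewrite le_eqVlt; apply/orP; left; apply/eqP; apply: eq_integral => x.
  by rewrite inE /I /= in_itv/= => /f1 ->; rewrite normr1 powR1.
by apply: ge0_subset_integral => //; exact: measurable_powR_norm.
Qed.

Lemma plateau_supp (a b d y : R) : 0 < d -> plateau a b d y != 0 -> a <= y <= b.
Proof.
move=> d0 h; apply/andP; split; rewrite leNgt; apply: contra h => h.
  by rewrite plateau_out//; left; exact: ltW.
by rewrite plateau_out//; right; exact: ltW.
Qed.

(** The infimum of the empty set is 0 by convention, so an explicit competitor, a normalised
    plateau, is exhibited before taking almost minimizers. *)
Lemma pi_set_neq0 : pi_set p !=set0.
Proof.
pose k := plateau (- (1 / 4)) (1 / 4) (1 / 8 : R).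
have d0 : 0 < 1 / 8 :> R by rewrite divr_gt0.
have sk : itv_smooth (1 / 2) k.
  split; first exact: smooth_plateau.
  exists (1 / 4); split; first by lra.
  by move=> x /(plateau_supp d0); rewrite ler_norml.
have ck := Ck_continuous (sk.1 0%N).
have [a a_ge0 ea] := itv_smooth_Int1 hp sk.
have [b b_ge0 eb] := itv_smooth_Int1 hp (itv_smooth_derive sk).
have a_gt0 : 0 < a.
  rewrite -lte_fin -ea; apply: (@Int1_gt0 k (- (1 / 8)) (1 / 8)) => //; first by lra.
  by move=> y /andP[? ?]; rewrite /k plateau_in//; apply/andP; split; lra.
pose c := a `^ - p^-1; have c0 : 0 < c by rewrite powR_gt0.
have cp : c `^ p = a^-1 by rewrite -powRrM mulNr mulVf ?gt_eqF// powR_inv1.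
have dk t : derivable k t 1 by have [_ /(_ 1)[]] := sk.1 1%N.
exists ((a^-1 * b) `^ p^-1); exists (fun t => c * k t); split.
- split; first by move=> n; apply: CkM; [exact: Ck_cst|exact: sk.1].
  have [B [B2 hB]] := sk.2; exists B; split => // x; rewrite mulf_eq0 negb_or => /andP[_ /hB].
  by [].
- by rewrite Int1Z// ea gtr0_norm// cp -EFinM mulVf// gt_eqF.
rewrite (_ : D1 _ = fun t => c * D1 k t); last first.
  by apply/funext => t; rewrite (_ : (fun s => c * k s) = c *: k)// deriveZ.
rewrite Int1Z//; last exact: Ck_continuous ((itv_smooth_derive sk).1 0%N).
by rewrite eb gtr0_norm// cp -EFinM poweR_EFin.
Qed.

End products.

Section optimal_cell.
Context {R : realType} (alpha p : R) (a0 : 0 < alpha) (hp : 1 < p).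
Local Notation sc := scalar_field.
Local Notation N := (Lpint p).
Local Notation smooth_in := (strip_smooth alpha).
Local Notation D1 f := ('D_(1%R : R) f).
Implicit Types (f g u phi psi : R * R -> R).

Let p0 : 0 < p. Proof. exact: lt_trans hp. Qed.

Lemma powR_invK (x : R) : 0 <= x -> (x `^ p^-1) `^ p = x.
Proof. by move=> x0; rewrite -powRrM mulVf ?gt_eqF// powRr1. Qed.

(** The hypothesis says that [2 * alpha * lambda^(1/p)] lies strictly above the infimum [pi_p]. A
    competitor below this number, dilated from the unit interval to [(- alpha, alpha)], is the
    profile. *)
Lemma near_optimal_profile (lambda : R) : (pi_p p / (2 * alpha)) `^ p < lambda ->
  exists psi : R -> R, exists A A' : R,
    [/\ itv_smooth alpha psi, Int1 p psi = A%:E, Int1 p (D1 psi) = A'%:E, 0 < A & A' < lambda * A].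
Proof.
move=> hl; have s0 : 0 < 2 * alpha by rewrite mulr_gt0.
have l0 : 0 < lambda by apply: le_lt_trans hl; exact: powR_ge0.
have q0 : 0 < lambda `^ p^-1 by rewrite powR_gt0.
have pl : pi_p p < 2 * alpha * lambda `^ p^-1.
  rewrite -ltr_pdivrMl// mulrC ltNge; apply: contraTN hl; rewrite -leNgt => h.
  rewrite -[lambda](powR_invK (ltW l0)).
  by rewrite ge0_ler_powR ?nnegrE ?powR_ge0 ?(ltW p0)// divr_ge0 ?pi_p_ge0 ?(ltW s0).
have hinf : has_inf (pi_set p).
  by split; [exact: pi_set_neq0|exists 0 => t; exact: pi_set_ge0].
have e0 : 0 < 2 * alpha * lambda `^ p^-1 - pi_p p by rewrite subr_gt0.
have [t pt] := inf_adherent e0 hinf; rewrite -pi_pE// addrC subrK => tl.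
have t0 := pi_set_ge0 pt.
have [phi [sphi e1 e2]] := pt.
have sd := itv_smooth_derive sphi; have [b b0 eb] := itv_smooth_Int1 hp sd.
have bt : b = t `^ p.
  move: e2; rewrite eb poweR_EFin => -[] <-; by rewrite powR_invK.
pose c := (2 * alpha)^-1; have c0 : 0 < c by rewrite invr_gt0.
have cn : c != 0 by rewrite gt_eqF.
pose psi (y : R) := phi (c * y).
have spsi : itv_smooth alpha psi.
  have := itv_smooth_scale c0 sphi; congr itv_smooth.
  by rewrite /c invrK; field.
have cphi := Ck_continuous (sphi.1 0%N); have cd := Ck_continuous (sd.1 0%N).
have dpsi : D1 psi = fun y => c * D1 phi (c * y).
  by apply/funext => y; rewrite (derive_scale1 c sphi.1).
have csd : continuous (fun y => D1 phi (c * y)).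
  have cl : continuous (fun y : R => c * y) by move=> y; apply: cvgM; [exact: cvg_cst|exact: cvg_id].
  by move=> y; exact: (@continuous_comp _ _ _ (fun y : R => c * y) (D1 phi) y (cl y) (cd _)).
exists psi, (2 * alpha), (c `^ p * (2 * alpha * b)).
have ci : `|c|^-1 = 2 * alpha by rewrite gtr0_norm// invrK.
split => //.
- by rewrite (Int1_scale p cn cphi) e1 ci mule1.
- by rewrite dpsi (Int1Z p c csd) (Int1_scale p cn cd) eb ci gtr0_norm// -!EFinM.
rewrite mulrCA mulrC ltr_pM2r// bt -powRM ?(ltW c0)//.
rewrite -[ltRHS](powR_invK (ltW l0)).
rewrite gt0_ltr_powR ?nnegrE ?mulr_ge0 ?powR_ge0 ?(ltW c0)//.
by rewrite ltr_pdivrMl.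
Qed.

(** The profile is multiplied by a plateau spread over a length 1/s in x_2. The vertical derivative
    carries the factor [s^p] and is negligible in a long cell. *)
Lemma small_quotient (lambda : R) : (pi_p p / (2 * alpha)) `^ p < lambda ->
  exists2 L : R, 0 < L & exists2 g, cell_smooth alpha L g & N (grad g) < lambda * N (sc g).
Proof.
move=> hl; have [psi [A [A' [spsi eA eA' A0 AA]]]] := near_optimal_profile hl.
have A'0 : 0 <= A' by rewrite -lee_fin -eA' Int1_ge0.
pose k := plateau (1 / 8) (7 / 8) (1 / 8 : R).
have d0 : 0 < 1 / 8 :> R by rewrite divr_gt0.
have ksupp y : k y != 0 -> 1 / 8 <= y <= 7 / 8 by exact: plateau_supp.
have sk : itv_smooth 1 k.
  split; first exact: smooth_plateau.
  by exists (7 / 8); split => [|x /ksupp]; [lra|rewrite ler_norml; lra].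
have sdk := itv_smooth_derive sk.
have [K K_ge0 eK] := itv_smooth_Int1 hp sk; have [K' K'0 eK'] := itv_smooth_Int1 hp sdk.
have ck := Ck_continuous (sk.1 0%N); have cdk := Ck_continuous (sdk.1 0%N).
have K0 : 0 < K.
  rewrite -lte_fin -eK; apply: (@Int1_gt0 _ p k (1 / 4) (3 / 4)) => //; first by lra.
  by move=> y /andP[? ?]; rewrite /k plateau_in//; apply/andP; split; lra.
have gap : 0 < lambda * A - A' by rewrite subr_gt0.
(* Half of the gap pays for the factor [1 + e] on the horizontal energy; a quarter will pay for the
   vertical energy. *)
pose e := (lambda * A - A') / (2 * (A' + 1)).
have e_gt0 : 0 < e by rewrite divr_gt0// mulr_gt0//; lra.
have eA1 : e * A' <= (lambda * A - A') / 2.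
  rewrite /e -mulrA ler_pM2l// invfM -mulrA ler_piMr ?invr_ge0//.
  by rewrite ler_pdivrMl ?mulr1; lra.
pose r := (1 + e) `^ p^-1 - 1.
have r0 : 0 < r.
  have q0 : 0 < p^-1 by rewrite invr_gt0.
  have := @gt0_ltr_powR _ p^-1 q0 1 (1 + e); rewrite powR1 subr_gt0 !nnegrE; apply; lra.
have rp : (1 + r) `^ p = 1 + e.
  by rewrite /r addrC subrK -powRrM mulVf ?gt_eqF// powRr1//; lra.
pose C := (1 + r^-1) `^ p * (A * K').
have C0 : 0 <= C by rewrite mulr_ge0 ?powR_ge0// mulr_ge0// ltW.
have g4 : 0 < (lambda * A - A') / 4 * K by rewrite mulr_gt0// divr_gt0.
have [s s0 hs] := powR_small p0 C0 g4.
have sn : s != 0 by rewrite gt_eqF.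
have sks : smooth (fun y => k (s * y)) by exact: smooth_scale sk.1.
have kb y : k (s * y) != 0 -> 1 / 8 / s <= y <= 7 / 8 / s.
  move=> /ksupp/andP[h1 h2]; apply/andP; split.
    by rewrite ler_pdivrMr// [leRHS]mulrC.
  by rewrite ler_pdivlMr// [leLHS]mulrC.
have kB y : k (s * y) != 0 -> `|y| <= 7 / 8 / s.
  move=> /kb/andP[y1 y2]; rewrite ger0_norm//; apply: le_trans y1.
  by rewrite divr_ge0// ltW.
have [sg gg] := product_smooth spsi sks kB.
have dks y : D1 (fun y => k (s * y)) y = s * D1 k (s * y) by exact: derive_scale1 sk.1 _.
exists s^-1; first by rewrite invr_gt0.
exists (fun x => psi x.1 * k (s * x.2)).
  split => //; exists (1 / 8 / s); first by rewrite divr_gt0.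
  move=> x; rewrite mulf_eq0 negb_or => /andP[_ /kb/andP[x1 x2]]; rewrite x1 (le_trans x2)//.
  by rewrite le_eqVlt; apply/orP; left; apply/eqP; field.
have [G1 G2] := strip_smooth_Lpv hp sg.
have [F1 _] := N_fst hp G2; have [F2 _] := N_snd hp G2.
have cs (f : R -> R) : continuous f -> continuous (fun y => f (s * y)).
  move=> cf; have cl : continuous (fun y : R => s * y) by move=> y; apply: cvgM; [exact: cvg_cst|exact: cvg_id].
  by move=> y; exact: (@continuous_comp _ _ _ (fun y : R => s * y) f y (cl y) (cf _)).
have I1 : Int1 p (fun y => k (s * y)) = (s^-1 * K)%:E.
  by rewrite (Int1_scale p sn ck) eK gtr0_norm.
have I2 : Int1 p (fun y => s * D1 k (s * y)) = (s `^ p * (s^-1 * K'))%:E.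
  by rewrite (Int1Z p s (cs _ cdk)) (Int1_scale p sn cdk) eK' gtr0_norm.
have cpsi := Ck_continuous (spsi.1 0%N).
have cdpsi := Ck_continuous ((itv_smooth_derive spsi).1 0%N).
have cks := cs k ck.
have N1 : N (sc (fun x => psi x.1 * k (s * x.2))) = A * (s^-1 * K).
  exact: (@Lpint_product R p psi (fun y => k (s * y)) A (s^-1 * K) cpsi cks eA I1 G1).
have ef : (fun x : R * R => (grad (fun x => psi x.1 * k (s * x.2)) x).1) =
    fun x => D1 psi x.1 * k (s * x.2) by apply/funext => x; rewrite gg.
have es : (fun x : R * R => (grad (fun x => psi x.1 * k (s * x.2)) x).2) =
    fun x => psi x.1 * (s * D1 k (s * x.2)) by apply/funext => x; rewrite gg dks.
rewrite ef in F1; rewrite es in F2.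
have N2 : N (sc (fun x => D1 psi x.1 * k (s * x.2))) = A' * (s^-1 * K).
  exact: (@Lpint_product R p (D1 psi) (fun y => k (s * y)) A' (s^-1 * K) cdpsi cks eA' I1 F1).
have csd : continuous (fun y => s * D1 k (s * y)).
  by move=> y; apply: cvgM; [exact: cvg_cst|exact: (cs _ cdk)].
have N3 : N (sc (fun x => psi x.1 * (s * D1 k (s * x.2)))) = A * (s `^ p * (s^-1 * K')).
  exact: (@Lpint_product R p psi (fun y => s * D1 k (s * y)) A (s `^ p * (s^-1 * K')) cpsi csd eA I2 F2).
have [F3 N3'] : Lpv p (fun x => (0, psi x.1 * (s * D1 k (s * x.2))) : R * R) /\
    N (fun x => (0, psi x.1 * (s * D1 k (s * x.2))) : R * R) =
    N (sc (fun x => psi x.1 * (s * D1 k (s * x.2)))).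
  have [[m _] pf] := F2; split; last by rewrite !Lpint.unlock; congr Int; apply/funext => x; rewrite enorm_snd enorm_sc.
  split; first by split; [exact: mes_cst|].
  rewrite (_ : (fun x => _) = (fun x => enorm (sc (fun x => psi x.1 * (s * D1 k (s * x.2))) x) `^ p))//.
  by apply/funext => x; rewrite enorm_snd enorm_sc.
have [_ NG] := LpvD_le hp r0 F1 F3.
rewrite N3' N2 N3 rp in NG.
have eg : grad (fun x => psi x.1 * k (s * x.2)) =
    fun x => sc (fun x => D1 psi x.1 * k (s * x.2)) x + (0, psi x.1 * (s * D1 k (s * x.2))).
  apply/funext => x; rewrite gg dks; apply: injective_projections;
    by rewrite /sc !coordE /= ?addr0 ?add0r.
rewrite N1 eg; apply: (le_lt_trans NG).
have hs' := hs s (ltW s0) (lexx _).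
have si : 0 < s^-1 by rewrite invr_gt0.
rewrite (_ : (1 + e) * _ + _ = s^-1 * ((1 + e) * A' * K + s `^ p * C)); last by rewrite /C; ring.
rewrite (_ : lambda * _ = s^-1 * (lambda * A * K)); last by ring.
rewrite ltr_pM2l//.
have e1 : (1 + e) * A' * K <= (A' + (lambda * A - A') / 2) * K.
  by apply: ler_wpM2r; [exact: ltW|rewrite mulrDl mul1r lerD2l].
apply: (le_lt_trans (lerD e1 hs')).
have gK : 0 < (lambda * A - A') * K by rewrite mulr_gt0.
lra.
Qed.

End optimal_cell.

Section optimal_cell_existence.
Context {R : realType} (alpha p : R) (a0 : 0 < alpha) (hp : 1 < p).
Local Notation sc := scalar_field.
Local Notation N := (Lpint p).
Local Notation smooth_in := (strip_smooth alpha).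
Implicit Types (f g u phi psi : R * R -> R).

Let p0 : 0 < p. Proof. exact: lt_trans hp. Qed.

Lemma enorm_stretch (c : R) (v : R * R) : 1 <= c -> enorm (stretch c v) <= c * enorm v.
Proof.
move=> c1; rewrite -[X in X * _]ger0_norm ?(le_trans ler01 c1)// -enormZ.
rewrite /enorm; apply: ler_wsqrtr; rewrite /dot /stretch !coordE /=.
have q0 : 0 <= v.1 * v.1 by rewrite -expr2 sqr_ge0.
have c2 : 1 <= c * c by rewrite -[leLHS]mulr1 ler_pM.
rewrite lerD2r mulrACA; exact: ler_peMl.
Qed.

Lemma Int_stretch (c : R) f : 0 < c -> pint f ->
  pint (fun x => f (stretch c x)) /\ Int (fun x => f (stretch c x)) = c^-1 * Int f.
Proof.
move=> c0 pf; have cn : c != 0 by rewrite gt_eqF.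
have [] := @affine2_Int R (1, c) (0, 0) f (oner_neq0 _) cn pf.
have -> : (fun x => f (affine2 (1, c) (0, 0) x)) = fun x => f (stretch c x).
  by apply/funext => x; rewrite /affine2 /affine_map /= mul1r !addr0.
by rewrite /= mul1r gtr0_norm.
Qed.

(** Compression divides both integrals by [c] and multiplies the second component of the gradient
    alone by [c], so the quotient grows by at most [c^p]. *)
Lemma cell_stretch (c L : R) g : 1 <= c -> cell_smooth alpha L g ->
  [/\ cell_smooth alpha (L / c) (fun x => g (stretch c x)),
     N (sc (fun x => g (stretch c x))) = c^-1 * N (sc g) &
     N (grad (fun x => g (stretch c x))) <= c^-1 * (c `^ p * N (grad g))].
Proof.
move=> c1 [sg [d d0 hg]]; have c0 : 0 < c := lt_le_trans ltr01 c1.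
have [[b [B [ba hb]]] [G1 G2]] := (sg.2, strip_smooth_Lpv hp sg).
have bd x : g (stretch c x) != 0 -> d / c <= x.2 <= L / c - d / c.
  move=> /hg/andP[/= x1 x2]; rewrite -mulrBl ler_pdivrMr// ler_pdivlMr//.
  by rewrite ![x.2 * c]mulrC x1.
have sgc : smooth_in (fun x => g (stretch c x)).
  split; first exact: smooth_stretch sg.1.
  exists b, (`|L / c| + `|d / c|); split => // x nz.
  have [x1 _] := hb _ nz; have /andP[x2 x3] := bd x nz; split => //.
  rewrite ler_norml; have := ler_norm (L / c); have := ler_norm (- (d / c)).
  have := ler_norm (d / c); have := ler_norm (- (L / c)); rewrite !normrN.
  have := normr_ge0 (L / c); have := normr_ge0 (d / c).
  by move: x2 x3; lra.
have [F1 F2] := strip_smooth_Lpv hp sgc.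
split; first split => //.
- by exists (d / c); [exact: divr_gt0|exact: bd].
- rewrite !Lpint_sc; have [_ pg] := (Lpv_sc p g).1 G1.
  exact: (Int_stretch c0 pg).2.
have [_ pG] := G2; have [ps es] := Int_stretch c0 (pintZ (c `^ p) pG).
rewrite Lpint.unlock -(IntZ (c `^ p) pG) -es; apply: le_Int; [exact: F2.2|exact: ps|move=> x].
rewrite grad_stretch; last exact: sg.1.
rewrite -powRM ?enorm_ge0 ?(ltW c0)//.
by rewrite ge0_ler_powR ?nnegrE ?enorm_ge0 ?mulr_ge0 ?enorm_ge0 ?(ltW c0) ?(ltW p0)// enorm_stretch.
Qed.

(** A translate of [g] by [L] has disjoint support, so the increment over [L] has exactly twice the
    integral of [g], whereas [smooth_incr_le] bounds it by [2^p L^p] times the vertical energy. A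
    short cell therefore has a large quotient. *)
Lemma cell_length_ge (lambda L : R) g : 0 < L -> cell_smooth alpha L g ->
  N (grad g) < lambda * N (sc g) -> 2 < lambda * (2 `^ p * L `^ p).
Proof.
move=> L0 [sg [d d0 hg]] gl; have [G1 G2] := strip_smooth_Lpv hp sg.
have k1 : (L *: ((0, 1) : R * R)).1 = 0 by rewrite coordE mulr0.
have ss := strip_smooth_shift k1 sg; have sn := strip_smoothN sg.
have bs : below 0 (fun x => g (x + L *: ((0, 1) : R * R))).
  by exists d => // x /hg; rewrite !coordE /= mulr1 => /andP[_ h]; lra.
have an : above 0 (fun x => - g x).
  by exists d => // x; rewrite oppr_eq0 => /hg/andP[h _]; lra.
have [e1 _ _] := disjoint_sum hp 0 bs an ss sn.
have [n1 _] := Lpint_smooth_shift hp (L *: ((0, 1) : R * R)) sg.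
have n2 : N (sc (fun x => - g x)) = N (sc g).
  rewrite -[RHS]LpintN; congr Lpint; apply/funext => x.
  by apply: injective_projections; rewrite /sc !coordE /= ?oppr0.
have h := smooth_incr_le hp L sg; rewrite -/(incr L g) in h.
rewrite (_ : incr L g = fun x => g (x + L *: ((0, 1) : R * R)) + - g x)// e1 n1 n2 in h.
have [_ gs] := N_snd hp G2; rewrite (gtr0_norm L0) in h.
have LL0 : 0 < 2 `^ p * L `^ p by rewrite mulr_gt0 ?powR_gt0.
have h2 := ler_wpM2l (ltW LL0) gs; rewrite mulrA in h.
have {h2}h := le_trans h h2.
rewrite -(ltr_pM2l LL0) in gl; have h3 := le_lt_trans h gl.
have N0 : 0 < N (sc g).
  rewrite lt_neqAle Lpint_ge0 andbT eq_sym; apply: contraTneq h3 => ->.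
  by rewrite !mulr0 addr0 ltxx.
rewrite -(ltr_pM2r N0); move: h3; rewrite mulr2n mulrDl mul1r.
by congr (_ < _); ring.
Qed.

Lemma optimal_cell (lambda : R) : (pi_p p / (2 * alpha)) `^ p < lambda ->
  exists L : R, [/\ 0 < L,
    forall g, cell_smooth alpha L g -> lambda * N (sc g) <= N (grad g) &
    forall eta : R, 0 < eta -> exists g, [/\ cell_smooth alpha L g, N (sc g) = 1 &
      N (grad g) <= lambda + eta]].
Proof.
move=> hl; have l0 : 0 < lambda by apply: le_lt_trans hl; exact: powR_ge0.
pose S : set R := [set L | 0 < L /\ exists2 g, cell_smooth alpha L g & N (grad g) < lambda * N (sc g)].
(* The lower bound on admissible lengths given by [cell_length_ge]; it makes the infimum
   positive. *)
pose c := (2 / (lambda * 2 `^ p)) `^ p^-1.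
have c0 : 0 < c by rewrite powR_gt0// divr_gt0// mulr_gt0// powR_gt0.
have Sc L : S L -> c <= L.
  move=> [L0 [g cg gl]]; have h := cell_length_ge L0 cg gl.
  rewrite leNgt; apply: contraTN h => Lc; rewrite -leNgt mulrA.
  rewrite -ler_pdivlMl ?mulr_gt0 ?powR_gt0// mulrC.
  rewrite -[leRHS](powR_invK hp); last by rewrite divr_ge0// mulr_ge0 ?powR_ge0 ?ltW.
  by rewrite ge0_ler_powR ?nnegrE ?(ltW p0) ?(ltW L0) ?(ltW c0)// ltW.
have hS : has_inf S.
  split; last by exists c.
  by have [L L0 [g cg gl]] := small_quotient a0 hp hl; exists L; split => //; exists g.
pose L := inf S; have L0 : 0 < L by apply: lt_le_trans c0 _; apply: lb_le_inf; [exact: hS.1|exact: Sc].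
have Smin K : S K -> L <= K by move=> SK; apply: ge_inf => //; exact: hS.2.
(* A function violating the bound has a margin [d] at both edges; shifted down by [d / 2] it fits in
   the cell of length [L - d], below the infimum. *)
have min g : cell_smooth alpha L g -> lambda * N (sc g) <= N (grad g).
  move=> [sg [d d0 hg]]; rewrite leNgt; apply/negP => gl.
  have [x gx] : exists x, g x != 0.
    apply: contrapT => nx; have z : g = fun=> 0.
      by apply/funext => x; apply: contrapT => /eqP gx; apply: nx; exists x.
    have N0 : N (sc g) = 0.
      rewrite Lpint.unlock z -[RHS]Int0; congr Int; apply/funext => x.
      by rewrite enorm_sc normr0 powR0// gt_eqF.
    by move: gl; rewrite N0 mulr0 ltNge Lpint_ge0.
  have /andP[x1 x2] := hg x gx.
  have k1 : ((0, d / 2) : R * R).1 = 0 by [].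
  have [n1 n2] := Lpint_smooth_shift hp (0, d / 2) sg.
  suff : S (L - d) by move/Smin; lra.
  split; first by lra.
  exists (fun x => g (x + (0, d / 2))); last by rewrite n1 n2.
  split; first exact: strip_smooth_shift.
  exists (d / 2); first by rewrite divr_gt0.
  by move=> y /hg; rewrite !coordE /= => /andP[? ?]; apply/andP; split; lra.
exists L; split => // eta eta0.
(* A cell of length [K < L * t] with quotient below [lambda] is compressed to length [L]; the
   quotient grows by at most [t^p = 1 + eta / lambda]. *)
pose t := (1 + eta / lambda) `^ p^-1.
have t1 : 1 < t.
  have q0 : 0 < p^-1 by rewrite invr_gt0.
  have el : 0 < eta / lambda by rewrite divr_gt0.
  have := @gt0_ltr_powR _ p^-1 q0 1 (1 + eta / lambda); rewrite powR1 !nnegrE; apply; lra.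
have tp : t `^ p = 1 + eta / lambda by rewrite powR_invK// addr_ge0// divr_ge0// ltW.
have dL : 0 < L * t - L by rewrite subr_gt0 ltr_pMr.
have [K [K0 [g cg gl]] Kt] := inf_adherent dL hS; rewrite -/L addrC subrK in Kt.
have LK : L <= K by apply: Smin; split => //; exists g.
pose s := K / L; have s1 : 1 <= s by rewrite ler_pdivlMr// mul1r.
have s0 : 0 < s := lt_le_trans ltr01 s1.
have st : s <= t by rewrite ler_pdivrMr// mulrC ltW.
have [cs n1 n2] := cell_stretch s1 cg.
rewrite (_ : K / s = L) in cs; last by rewrite /s; field; rewrite !gt_eqF.
set h := fun x => g (stretch s x) in cs n1 n2.
have Ng : 0 < N (sc g).
  rewrite lt_neqAle Lpint_ge0 andbT eq_sym; apply: contraTneq gl => ->.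
  by rewrite mulr0 ltNge Lpint_ge0.
have Nh : 0 < N (sc h) by rewrite n1 mulr_gt0// invr_gt0.
have Eh : N (grad h) <= (lambda + eta) * N (sc h).
  apply: (le_trans n2); rewrite n1 [leRHS]mulrCA ler_pM2l ?invr_gt0//.
  have sp : s `^ p <= 1 + eta / lambda.
    by rewrite -tp ge0_ler_powR ?nnegrE ?(ltW p0) ?(ltW s0) ?(ltW (lt_trans ltr01 t1)).
  apply: (le_trans (ler_pM (powR_ge0 _ _) (Lpint_ge0 _ _) sp (ltW gl))).
  by rewrite mulrA mulrDl mul1r divfK ?gt_eqF.
pose k := N (sc h) `^ - p^-1; have k0 : 0 < k by rewrite powR_gt0.
have kp : k `^ p = (N (sc h))^-1.
  by rewrite -powRrM mulNr mulVf ?gt_eqF// powR_inv1// ltW.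
have [H1 H2] := strip_smooth_Lpv hp cs.1.
exists (fun x => k * h x); split; first exact: cell_smoothZ.
- by rewrite -(scZ (fun=> k)) LpintZc// gtr0_norm// kp mulVf// gt_eqF.
rewrite (_ : grad _ = fun x => k *: grad h x).
  by rewrite LpintZc// gtr0_norm// kp mulrC ler_pdivrMr.
by apply/funext => x; apply: gradZ; exact: cs.1.
Qed.

End optimal_cell_existence.

(** * From chains of cells to singular Palais-Smale sequences *)

Section almost_solutions.
Context {R : realType} (alpha p : R) (a0 : 0 < alpha) (hp : 1 < p).
Local Notation sc := scalar_field.
Local Notation N := (Lpint p).
Local Notation smooth_in := (strip_smooth alpha).
Implicit Types (f g u phi psi : R * R -> R).

Let p0 : 0 < p. Proof. exact: lt_trans hp. Qed.
Let p10 : 0 < p - 1. Proof. by rewrite subr_gt0. Qed.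

(** The degree is [p - 1] here but [p] in the norm constraint; the mismatch makes the residual of a
    normalised chain decay as its length grows. *)
Lemma residualZl (lambda c : R) u phi : 0 <= c -> smooth_in u -> smooth_in phi ->
  residual p lambda (fun x => c * u x) phi = c `^ (p - 1) * residual p lambda u phi.
Proof.
move=> c0 su sphi; have [U1 U2] := strip_smooth_Lpv hp su; have [P1 P2] := strip_smooth_Lpv hp sphi.
have pZ a b : Lpv p a -> Lpv p b -> pairing p (fun x => c *: a x) b = c `^ (p - 1) * pairing p a b.
  move=> La Lb; rewrite !pairing.unlock -IntZ; last exact: pint_pairing.
  by congr Int; apply/funext => x; rewrite pfieldZp// dotZl.
rewrite /residual (_ : grad _ = fun x => c *: grad u x); last by apply/funext => x; exact: (gradZ c x su).
by rewrite -(scZ (fun=> c)) !pZ// mulrBr mulrCA.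
Qed.

(** The bound 2 on the test functions leaves room to replace an element of the unit ball of
    W^{1,p}_0 by a nearby test function. The last clause serves singularity. *)
Definition almost_solution (lambda eps r : R) u :=
  [/\ smooth_in u, N (sc u) = 1, `|N (grad u) - lambda| <= eps,
    forall phi, smooth_in phi -> N (sc phi) + N (grad phi) <= 2 ->
      `|residual p lambda u phi| <= eps &
    forall x, u x != 0 -> r <= x.2].

Lemma almost_solution_above (lambda eps r : R) : (pi_p p / (2 * alpha)) `^ p < lambda -> 0 < eps ->
  exists u, almost_solution lambda eps r u.
Proof.
move=> hl eps0; have l0 : 0 <= lambda by apply: ltW; apply: le_lt_trans hl; exact: powR_ge0.
have [L [L0 Lmin Lnear]] := optimal_cell a0 hp hl.
have [B B0 hB] := chain_residual_le a0 hp l0 L0.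
have B1 : 0 <= 1 + B by rewrite addr_ge0.
have [d d0 hd] := powR_small p10 B1 eps0.
(* The chain has [n.+2] periods, each holding [g] and its reflection, hence the total mass [m]. The
   bound [m >= d^(- p)] gives [c = m^(- 1/p) <= d], which brings [c^(p - 1) * (1 + B)] below
   [eps]. *)
pose n := Num.bound (d `^ (- p)); pose m : R := n.+2%:R * 2.
have m0 : 0 < m by rewrite mulr_gt0// ltr0n.
pose c := m `^ (- p^-1); have c0 : 0 < c by rewrite powR_gt0.
have cp : c `^ p = m^-1 by rewrite -powRrM mulNr mulVf ?gt_eqF// powR_inv1// ltW.
have cd : c <= d.
  have dm : d `^ (- p) <= m.
    have := archi_boundP (powR_ge0 d (- p)); rewrite -/n => /ltW h; apply: (le_trans h).
    rewrite /m -natrM ler_nat; apply: leq_trans (leq_pmulr n.+2 (isT : (0 < 2)%N)).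
    exact: leq_trans (leqnSn n) (leqnSn n.+1).
  rewrite -[d]powRr1 ?(ltW d0)// -[X in d `^ X](_ : - p * - p^-1 = 1).
    rewrite powRrM /c ![_ `^ (- p^-1)]powRN lef_pV2 ?posrE ?powR_gt0//.
    by rewrite ge0_ler_powR ?nnegrE ?powR_ge0 ?invr_ge0 ?(ltW m0) ?(ltW p0).
  by rewrite mulrNN mulfV// gt_eqF.
have [K K0 hK] := hB n.
have [eta eta0 crit] := almost_critical hp l0 K0 ltr01 Lmin.
pose eta' := Num.min eta (Num.min 1 eps).
have eta'0 : 0 < eta' by rewrite !lt_min eta0 ltr01.
have [e1 e2 e3] : [/\ eta' <= eta, eta' <= 1 & eta' <= eps] by rewrite !ge_min !lexx !orbT.
have [g [cg g1 gE]] := Lnear eta' eta'0.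
have gcrit := crit g cg g1 (le_trans gE (lerD (lexx _) e1)).
have UK := hK 1 g cg g1 (le_trans gE (lerD (lexx _) e2)) gcrit.
have [sG [b b0 hG] G1 G2 _] := odd_ext_facts hp lambda cg.
have [sU hU U1 U2 _] := chain_facts hp lambda n.+2 a0 L0 b0 sG hG.
move: (chain _ _ _) sU hU U1 U2 UK => U sU hU U1 U2 UK.
rewrite G1 g1 mulr1 -/m in U1; rewrite G2 mulrA -/m in U2.
(* The chain starts above the level [- L], so a shift by [r + L] puts it above [r]. *)
have k1 : ((0, r + L) : R * R).1 = 0 by [].
have kn1 : (- ((0, r + L) : R * R)).1 = 0 by rewrite coordE oppr0.
have sS := strip_smooth_shift kn1 sU.
have [S1 S2] := Lpint_smooth_shift hp (- ((0, r + L) : R * R)) sU.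
have [LS1 LS2] := strip_smooth_Lpv hp sS.
have gl : lambda <= N (grad g) by have := Lmin g cg; rewrite g1 mulr1.
exists (fun x => c * U (x - (0, r + L))); split.
- exact: strip_smoothZ.
- by rewrite -(scZ (fun=> c)) LpintZc// (gtr0_norm c0) S1 U1 cp mulVf// gt_eqF.
- rewrite (_ : grad _ = fun x => c *: grad (fun x => U (x - (0, r + L))) x).
    rewrite LpintZc// (gtr0_norm c0) S2 U2 cp mulKf ?gt_eqF// ger0_norm ?subr_ge0//.
    by rewrite lerBlDl; apply: (le_trans gE); rewrite lerD2l.
  by apply/funext => x; exact: (gradZ c x sS).
- move=> phi sphi phi2; have sp := strip_smooth_shift k1 sphi.
  have [q1 q2] := Lpint_smooth_shift hp (0, r + L) sphi.
  rewrite (residualZl lambda (ltW c0) sS sphi) (residual_shift hp lambda k1 sU sphi).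
  have h := UK _ sp; rewrite q1 q2 in h; have {}h := h phi2.
  rewrite normrM ger0_norm ?powR_ge0//.
  apply: le_trans (hd c (ltW c0) cd); apply: ler_wpM2l => //; exact: powR_ge0.
move=> x; rewrite mulf_eq0 negb_or => /andP[_ /hU]; rewrite !coordE /= => /andP[? _].
lra.
Qed.

Lemma almost_solution_exists (lambda eps r : R) : (pi_p p / (2 * alpha)) `^ p <= lambda -> 0 < eps ->
  exists u, almost_solution lambda eps r u.
Proof.
move=> hl eps0; have e4 : 0 < eps / 4 by rewrite divr_gt0.
have hl' : (pi_p p / (2 * alpha)) `^ p < lambda + eps / 4 by apply: (le_lt_trans hl); rewrite ltrDl.
(* Working at level [lambda + eps / 4] includes the threshold. Going back to [lambda] changes the
   residual by at most [eps / 4] times the bound 3 on the pairing of [u] with [phi]. *)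
have [u [su u1 uE ures ur]] := almost_solution_above r hl' e4.
exists u; split => //.
  by move: uE; rewrite !ler_norml => /andP[? ?]; apply/andP; split; lra.
move=> phi sphi phi2; have := ures phi sphi phi2.
have [U1 U2] := strip_smooth_Lpv hp su; have [P1 P2] := strip_smooth_Lpv hp sphi.
have p3 : `|pairing p (sc u) (sc phi)| <= 3.
  apply: (le_trans (pairing_le hp U1 P1)); rewrite u1.
  by have := Lpint_ge0 p (grad phi); lra.
have e3 := ler_wpM2l (ltW e4) p3.
rewrite (_ : residual p (lambda + eps / 4) u phi =
  residual p lambda u phi - eps / 4 * pairing p (sc u) (sc phi)); last by rewrite /residual; ring.
move=> h; rewrite -[X in `|X|](subrK (eps / 4 * pairing p (sc u) (sc phi))).
rewrite (le_trans (ler_normD _ _))// normrM (gtr0_norm e4).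
by move: e3 h; lra.
Qed.

End almost_solutions.

Section ess_spectrum.
Context {R : realType} (alpha p : R) (a0 : 0 < alpha) (hp : 1 < p).
Local Notation Omega := (strip alpha).
Local Notation sc := scalar_field.
Local Notation N := (Lpint p).
Local Notation smooth_in := (strip_smooth alpha).
Implicit Types (f g u w phi psi : R * R -> R).

Let p0 : 0 < p. Proof. exact: lt_trans hp. Qed.

Lemma residual_closure (lambda eps : R) u w (k : R * R -> R * R) : smooth_in u ->
  (forall phi, smooth_in phi -> N (sc phi) + N (grad phi) <= 2 ->
     `|residual p lambda u phi| <= eps) ->
  in_closure alpha p w k -> N (sc w) + N k <= 1 ->
  `|pairing p (grad u) k - lambda * pairing p (sc u) (sc w)| <= eps.
Proof.
move=> su H [Lw Lk cl] wk1; have [U1 U2] := strip_smooth_Lpv hp su.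
(* With [(1 + r)^p = 3 / 2] and the error term at most 1/4, the two integrals of the approximant add
   up to at most 3/2 + 1/4 + 1/4 = 2. *)
pose r := (3 / 2 : R) `^ p^-1 - 1.
have r0 : 0 < r.
  have q0 : 0 < p^-1 by rewrite invr_gt0.
  have := @gt0_ltr_powR _ p^-1 q0 1 (3 / 2); rewrite powR1 subr_gt0 !nnegrE; apply; lra.
have rp : (1 + r) `^ p = 3 / 2 by rewrite /r addrC subrK powR_invK//; lra.
pose C := (1 + r^-1) `^ p; have C0 : 0 <= C := powR_ge0 _ _.
have C4 : 0 < 4 * (C + 1) by rewrite mulr_gt0// ltr_wpDl.
pose e1 := (4 * (C + 1))^-1; have e10 : 0 < e1 by rewrite invr_gt0.
have Ce1 : C * e1 <= 1 / 4.
  by rewrite /e1 ler_pdivrMr//; lra.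
rewrite -subr_le0.
apply: (@ler_young_small _ p (N (grad u) + `|lambda| * N (sc u)) (1 + `|lambda|)) => t e t0 e0.
have m0 : 0 < Num.min e e1 by rewrite lt_min e0.
have [me me1] : Num.min e e1 <= e /\ Num.min e e1 <= e1 by rewrite !ge_min !lexx orbT.
have [phi [sphi h1 h2]] := cl _ m0.
have [P1 P2] := strip_smooth_Lpv hp sphi.
have D1 := LpvB hp Lw P1; have D2 := LpvB hp Lk P2.
have close (a b : R * R -> R * R) : Lpv p a -> Lpv p (fun x => a x - b x) ->
    N (fun x => a x - b x) < Num.min e e1 -> N b <= 3 / 2 * N a + 1 / 4.
  move=> La Lab hab; have [_ K] := LpvD_le hp r0 La (LpvN hp Lab).
  rewrite LpintN rp -/C in K.
  rewrite (_ : b = fun x => a x + - (a x - b x)).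
    apply: (le_trans K); apply: lerD => //; apply: le_trans Ce1.
    by apply: ler_wpM2l => //; apply: (le_trans (ltW hab)).
  by apply/funext => x; rewrite opprB addrC subrK.
have phi2 : N (sc phi) + N (grad phi) <= 2.
  by have := close _ _ Lw D1 h1; have := close _ _ Lk D2 h2; lra.
have Hphi := H phi sphi phi2.
have split_res : pairing p (grad u) k - lambda * pairing p (sc u) (sc w) =
   residual p lambda u phi + (pairing p (grad u) (fun x => k x - grad phi x) -
   lambda * pairing p (sc u) (fun x => sc w x - sc phi x)).
  by rewrite /residual !pairingB//; ring.
have Y2 := pairing_young hp t0 U2 D2; have Y1 := pairing_young hp t0 U1 D1.
have tp : 0 <= t `^ (1 - p) by exact: powR_ge0.
have h2' := ler_wpM2l tp (le_trans (ltW h2) me).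
have h1' := ler_wpM2l tp (le_trans (ltW h1) me).
have Z1 := le_trans Y1 (lerD (lexx _) h1'); have Z2 := le_trans Y2 (lerD (lexx _) h2').
have Z3 := ler_wpM2l (normr_ge0 lambda) Z1; rewrite -normrM in Z3.
rewrite split_res lerBlDr (le_trans (ler_normD _ _))//.
have Z4 := ler_normB (pairing p (grad u) (fun x => k x - grad phi x))
  (lambda * pairing p (sc u) (fun x => sc w x - sc phi x)).
have -> : t `^ (1 - p) * ((1 + `|lambda|) * e) = t `^ (1 - p) * e + `|lambda| * (t `^ (1 - p) * e) by ring.
rewrite mulrDr in Z3.
by rewrite mulrDr; lra.
Qed.

Lemma dual_norm_le (lambda eps : R) (u : W01p Omega p) : smooth_in u -> W01p_grad u = grad u ->
  (forall phi, smooth_in phi -> N (sc phi) + N (grad phi) <= 2 ->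
     `|residual p lambda u phi| <= eps) ->
  (dual_norm (fun phi : W01p Omega p =>
     plaplacian u phi - lambda * power_functional u phi)%R <= eps%:E)%E.
Proof.
move=> su gu H; apply: ge_ereal_sup => _ [phi /= phi1 <-]; rewrite lee_fin.
have cphi := W01p_in_closure hp phi; have [L1 L2 _] := cphi.
rewrite plaplacianE power_functionalE gu (on_stripv_grad su) (on_strip_smooth su).
apply: residual_closure => //.
move: phi1; rewrite /W01p_norm (W1p_norm_strip hp)//; last by case: (W01p_inW1p phi).
rewrite lee_fin => h; rewrite -[leLHS](powR_invK hp) ?addr_ge0 ?Lpint_ge0//.
apply: (@le_trans _ _ (1 `^ p)); last by rewrite powR1.
by rewrite ge0_ler_powR ?nnegrE ?powR_ge0 ?(ltW p0).
Qed.

(** The supremum is taken in the extended reals, where that of an empty set would be minus infinity;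
    the zero function shows that the unit ball is inhabited. *)
Lemma dual_norm_ge0 (F : W01p Omega p -> R) : (0 <= dual_norm F)%E.
Proof.
have s0 : smooth_in (fun=> 0 : R).
  split; first by move=> k; exact: Ck_cst.
  by exists 0, 0; split => // x; rewrite eqxx.
have [z z1 z2] := W01p_of_smooth hp s0; have [L1 L2] := strip_smooth_Lpv hp s0.
have n0 (a : R * R -> R * R) : (forall x, a x = 0) -> N a = 0.
  move=> a_0; rewrite Lpint.unlock -[RHS]Int0; congr Int; apply/funext => x.
  by rewrite a_0 enorm0 powR0// gt_eqF.
apply: (@le_trans _ _ `|F z|%:E); first by rewrite lee_fin.
apply: ereal_sup_ubound; exists z => //=.
rewrite /W01p_norm (W1p_norm_strip hp).
- rewrite z1 z2 (on_strip_smooth s0) (on_stripv_grad s0) !n0 ?addr0 ?powR0 ?lee_fin//.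
    by rewrite invr_eq0 gt_eqF.
  by move=> x; apply: grad_near0; exact: filterE.
- by case: (W01p_inW1p z).
- by rewrite z2 (on_stripv_grad s0).
Qed.

Lemma ess_spectrum_superset (lambda : R) : (pi_p p / (2 * alpha)) `^ p <= lambda ->
  ess_spectrum Omega p lambda.
Proof.
move=> hl; pose eps (n : nat) : R := n.+1%:R^-1.
have eps0 n : 0 < eps n by rewrite invr_gt0 ltr0n.
have /choice[u hu] n : exists u, almost_solution alpha p lambda (eps n) n.+1%:R u.
  exact: almost_solution_exists.
have /choice[v hv] n : exists v : W01p Omega p, W01p_fun v = u n /\ W01p_grad v = grad (u n).
  by have [su _ _ _ _] := hu n; have [v v1 v2] := W01p_of_smooth hp su; exists v.
have sv n : smooth_in (v n) by rewrite (hv n).1; have [] := hu n.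
have gv n : W01p_grad (v n) = grad (v n) by rewrite (hv n).2 (hv n).1.
have ceps : (eps n)%:E @[n --> \oo] --> 0%E.
  by apply: cvg_EFin; [exact: nearW|exact: cvg_harmonic].
exists v.
  split => [n||].
  - rewrite (Lp_norm_strip hp); last by case: (W01p_inW1p (v n)).
    by rewrite (on_strip_smooth (sv n)) (hv n).1; have [_ -> _ _ _] := hu n; rewrite powR1.
  - have Ev n : energy Omega p (W01p_grad (v n)) = (N (grad (u n)))%:E.
      have [L1 L2] := strip_smooth_Lpv hp (sv n).
      by rewrite (energy_strip hp) gv (on_stripv_grad (sv n))// (hv n).1.
    under eq_fun do rewrite Ev.
    apply: cvg_EFin; first exact: nearW.
    apply/cvgrPdist_le => e e0.
    have /cvgrPdist_le /(_ e e0) := @cvg_harmonic R.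
    apply: filterS => n; rewrite sub0r normrN ger0_norm ?(ltW (eps0 n))// => h.
    by have [_ _ h' _ _] := hu n; rewrite distrC; exact: le_trans h' h.
  apply: (@squeeze_cvge _ _ _ _ (fun=> 0%E) _ (fun n => (eps n)%:E)).
  - apply: nearW => n; rewrite dual_norm_ge0/=.
    apply: dual_norm_le => // phi sphi phi2.
    by rewrite (hv n).1; have [_ _ _ h _] := hu n; exact: h.
  - exact: cvg_cst.
  - exact: ceps.
move=> r r0.
have ev : \forall n \near \oo, Lp_norm (Omega `&` eball r) p (v n) = 0%E.
  (* The n-th function lives at height at least [n + 1], so its restriction to a fixed ball is
     eventually identically zero. *)
  have [m hm] : exists m : nat, r <= m%:R.
    by exists (Num.bound r); apply: ltW; apply: archi_boundP; exact: ltW.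
  exists m => // n /= mn; rewrite /Lp_norm.
  have -> : (v n : R * R -> R) \_ (Omega `&` eball r) = fun=> 0.
    apply/funext => x; rewrite patchE; case: ifPn => //.
    rewrite inE => -[_ xr]; rewrite (hv n).1; have [_ _ _ _ h] := hu n.
    apply: contrapT => /eqP /h nx.
    have := le_lt_trans (le_trans (ler_norm _) (ler_snd_enorm x)) xr.
    rewrite ltNge => /negP; apply; apply: le_trans nx; apply: (le_trans hm).
    by rewrite ler_nat leqW.
  by rewrite Lnorm0// gt_eqF.
by apply: cvg_near_cst; exact: ev.
Qed.

Lemma ess_spectrum_strip :
  ess_spectrum Omega p = `[(pi_p p / (2 * alpha)) `^ p, +oo[%classic.
Proof.
apply/seteqP; split => lambda /=; rewrite in_itv/= andbT.
  exact: ess_lower_bound.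
exact: ess_spectrum_superset.
Qed.

End ess_spectrum.


Theorem theorem5p6 (R : realType) (alpha : R) (halpha : 0 < alpha)
    (p : R) (hp : 1 < p) :
  ess_spectrum (strip alpha) p = `[(pi_p p / (2 * alpha)) `^ p, +oo[%classic /\
  eigen_spectrum (strip alpha) p = set0.
Proof. by split; [exact: ess_spectrum_strip|exact: eigen_empty]. Qed.
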